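(* Suppose that: (i) for every $s\in\mathcal U$ with a self loop, $(A_{ss},B_{ss})$ is stabilizable and $(A_{ss},C_{ss})$ is detectable, where $Q_{ss}=C_{ss}^\top C_{ss}$; (ii) $A$ is stable with $\|A^k\|\le\kappa_0\gamma_0^k$ for all $k\ge0$, $\kappa_0\ge1$, $\rho(A)<\gamma_0<1$; (iii) $\sigma_m(R)\ge1$ and $\sigma_n(Q)\ge1$; (iv) $\|\hat A-A\|\le\bar\varepsilon$ and $\|\hat B-B\|\le\bar\varepsilon$, where $$\bar\varepsilon=\frac{(1-\gamma)^3}{768\kappa^4pq}(\tilde\Gamma+1)^{-2}\tilde\Gamma^{-9}(1+\sigma_1(R^{-1}))^{-2}\big(20(\tilde\Gamma+1)^2\tilde\Gamma^7\sigma_1(R)\big)^{-D_{\max}}.$$ Then the costs $\hat J$ of the policy $\hat u$ and $\tilde J$ of the policy $\tilde u$ (see context) satisfy $$\hat J-\tilde J\le696\frac{\kappa^6\sigma_w^2np^4q^3}{(1-\gamma)^4(1-\gamma^2)}\tilde\Gamma^{4D_{\max}+2}(\tilde\Gamma+1)^{2D_{\max}+3}(\sigma_1(Q)+\sigma_1(R))\bar\varepsilon.$$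
   Context: $\|\cdot\|$ is the spectral norm (Euclidean for vectors), $\sigma_1\ge\sigma_2\ge\cdots$ singular values, $\rho$ spectral radius; a matrix is stable if its spectral radius is less than 1. Networked system. Let $p\ge1$, $\mathcal V=\{1,\dots,p\}$. Subsystem $i$ has state in $\mathbb R^{n_i}$ and input in $\mathbb R^{m_i}$, $n_i\ge m_i$; $n=\sum_i n_i$, $m=\sum_i m_i$. The stacked system is $x(t+1)=Ax(t)+Bu(t)+w(t)$, $x(0)=0$, where $A=(A_{ij})\in\mathbb R^{n\times n}$, $B=(B_{ij})\in\mathbb R^{n\times m}$ have blocks $A_{ij}\in\mathbb R^{n_i\times n_j}$, $B_{ij}\in\mathbb R^{n_i\times m_j}$ with $A_{ij}=0$, $B_{ij}=0$ if $j\notin\mathcal N_i$ ($\mathcal N_i\subseteq\mathcal V$ is the set of subsystems directly affecting $i$), and $w(t)$, $t\ge0$, are i.i.d. $\mathcal N(0,\sigma_w^2I)$, $\sigma_w>0$. Delays. $\mathcal G(\mathcal V,\mathcal A)$ is a directed graph without self loops, each edge carrying a delay $0$ or $1$, with no directed cycle of total delay zero. $D_{ii}=0$; for $i\ne j$, $D_{ij}$ is the smallest total delay of a directed path from $j$ to $i$ ($+\infty$ if none). Standing assumption: $D_{ij}\le1$ for all $i$ and $j\in\mathcal N_i$. $D_{\max}$ is the maximum of $D_{ij}$ over pairs such that there is a directed path from $j$ to $i$ (equivalently over finite $D_{ij}$). Information graph. $s_j(k)=\{i\in\mathcal V:D_{ij}\le k\}$, $\mathcal U=\{s_j(k):k\ge0,j\in\mathcal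 V\}$, edges $s_j(k)\to s_j(k+1)$. Every $r\in\mathcal U$ has exactly one outgoing edge $r\to s$ (possibly a self loop); the graph is a forest of trees oriented toward roots, and the set $\mathcal R$ of roots is the set of nodes with a self loop. Write $w_i\to s$ iff $s=s_i(0)$ (for such $s$, $i$ is unique). $q=|\mathcal U|$. Submatrices. For $s,r\subseteq\mathcal V$, $A_{sr}$ (or $A_{s,r}$) is the submatrix of block rows $s$ and block columns $r$; likewise for $B,Q,R,I,\hat A,\hat B$. Gains. $Q\succeq0$ is $n\times n$, $R\succ0$ is $m\times m$. For $r\to s$, $$K_r=-(R_{rr}+B_{sr}^\top P_sB_{sr})^{-1}B_{sr}^\top P_sA_{sr},\quad P_r=Q_{rr}+K_r^\top R_{rr}K_r+(A_{sr}+B_{sr}K_r)^\top P_s(A_{sr}+B_{sr}K_r),$$ where for $s$ with a self loop $P_s$ is the unique positive semidefinite solution of the resulting Riccati equation (then $A_{ss}+B_{ss}K_s$ is stable). Constants. For $s\in\mathcal R$ fix $\kappa_s\ge1$, $\rho(A_{ss}+B_{ss}K_s)<\gamma_s<1$ with $\|(A_{ss}+B_{ss}K_s)^k\|\le\kappa_s\gamma_s^k$ for all $k\ge0$. $\gamma=\max\{\max_{s\in\mathcal R}\gamma_s,\gamma_0\}$, $\kappa=\max\{\max_{s\in\mathcal R}\kappa_s,\kappa_0\}$, $\Gamma=\max\{\|A\|,\|B\|,\max_{s\in\mathcal U}\|P_s\|,\max_{s\in\mathcal U}\|K_s\|\}$, $\tilde\Gamma=\Gamma+1$. Estimated gains.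 $\hat A\in\mathbb R^{n\times n}$, $\hat B\in\mathbb R^{n\times m}$ are fixed matrices. $\hat K_r,\hat P_r$ are defined by the same recursions as $K_r,P_r$ with $A,B$ replaced by $\hat A,\hat B$ (for self-loop nodes $\hat P_r$ is the positive semidefinite solution of the resulting Riccati equation). Policy $\hat u$: $\hat x(t+1)=A\hat x(t)+B\hat u(t)+w(t)$, $\hat x(0)=0$, $\hat u_i(t)=\sum_{r\ni i}I_{\{i\},r}\hat K_r\hat\zeta_r(t)$, $\hat\zeta_r(0)=0$, $$\hat\zeta_r(t+1)=\sum_{v\to r}(\hat A_{rv}+\hat B_{rv}\hat K_v)\hat\zeta_v(t)+\sum_{w_j\to r}I_{r,\{j\}}\hat w_j(t),\quad \hat w_j(t)=\hat x_j(t+1)-\sum_{l\in\mathcal N_j}\big(\hat A_{jl}\hat x_l(t)+\hat B_{jl}\hat u_l(t)\big).$$ Cost $\hat J=\limsup_{T\to\infty}\mathbb E[\frac1T\sum_{t=0}^{T-1}(\hat x(t)^\top Q\hat x(t)+\hat u(t)^\top R\hat u(t))]$. Policy $\tilde u$: $\tilde x(t+1)=A\tilde x(t)+B\tilde u(t)+w(t)$, $\tilde x(0)=0$, $\tilde u_i(t)=\sum_{s\ni i}I_{\{i\},s}\hat K_s\tilde\zeta_s(t)$, $\tilde\zeta_s(0)=0$, $\tilde\zeta_s(t+1)=\sum_{r\to s}(A_{sr}+B_{sr}\hat K_r)\tilde\zeta_r(t)+\sum_{w_i\to s}I_{s,\{i\}}w_i(t)$. Cost $\tilde J=\lim_{T\to\infty}\mathbb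 E[\frac1T\sum_{t=0}^{T-1}(\tilde x(t)^\top Q\tilde x(t)+\tilde u(t)^\top R\tilde u(t))]$ (the limit exists under the hypotheses). *)

(* Defs.v *)
From HB Require Import structures.
From mathcomp Require Import all_boot all_order all_algebra.
From mathcomp Require Import complex.
From mathcomp Require Import all_classical all_reals all_analysis.

Set Implicit Arguments.
Unset Strict Implicit.
Unset Printing Implicit Defensive.

Import Order.TTheory GRing.Theory Num.Theory.
Import numFieldNormedType.Exports.

Local Open Scope classical_set_scope.
Local Open Scope ring_scope.

Section MatrixNotions.
Variable R : realType.

Definition enorm n (x : 'cV[R]_n) : R := Num.sqrt (\sum_(k < n) x k ord0 ^+ 2).

(* The norm induced by the Euclidean norms. Not to be confused with the
   entrywise sup norm `|M| that MathComp-Analysis puts on matrices. *)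
Definition specnorm m n (M : 'M[R]_(m, n)) : R :=
  sup [set enorm (M *m x) | x in [set x : 'cV[R]_n | enorm x <= 1]].

Definition complex_eigenvalue n (M : 'M[R]_n) : set R[i] :=
  [set z | eigenvalue (map_mx (@real_complex R) M) z].

Definition spectral_radius n (M : 'M[R]_n) : R :=
  sup [set ComplexField.Normc.normc z | z in complex_eigenvalue M].

Definition stable n (M : 'M[R]_n) : Prop := spectral_radius M < 1.

(* s lists, in nonincreasing order, the nonnegative square roots of the
   eigenvalues of M^T M, repeated according to (algebraic) multiplicity. *)
Definition is_singular_values m n (M : 'M[R]_(m, n)) (s : seq R) : Prop :=
  [/\ sorted >=%R s, all (fun a => 0 <= a) s &
      char_poly (M^T *m M) = \prod_(a <- s) ('X - (a ^+ 2)%:P)].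

Definition singular_values m n (M : 'M[R]_(m, n)) : seq R :=
  xget [::] [set s | is_singular_values M s].

(* Numbered from 1: singval 1 M is the largest one. *)
Definition singval (k : nat) m n (M : 'M[R]_(m, n)) : R :=
  nth 0 (singular_values M) k.-1.

Definition quad n (M : 'M[R]_n) (x : 'cV[R]_n) : R := (x^T *m M *m x) ord0 ord0.

Definition psd n (M : 'M[R]_n) : Prop :=
  M^T = M /\ forall x : 'cV[R]_n, 0 <= quad M x.

Definition pd n (M : 'M[R]_n) : Prop :=
  M^T = M /\ forall x : 'cV[R]_n, x != 0 -> 0 < quad M x.

Definition stabilizable n m (A : 'M[R]_n) (B : 'M[R]_(n, m)) : Prop :=
  exists K : 'M[R]_(m, n), stable (A + B *m K).

Definition detectable n m (A : 'M[R]_n) (C : 'M[R]_(m, n)) : Prop :=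
  exists L : 'M[R]_(n, m), stable (A + L *m C).

End MatrixNotions.

Section Blocks.
Variables (R : realType) (p : nat).
Implicit Types (d e : 'I_p -> nat) (s r : {set 'I_p}).

(* Indices of a stacked vector with blocks of sizes d 0, ..., d p.-1 that lie
   in a block belonging to s. *)
Definition coords d s : {set 'I_(\sum_(i < p) d i)%N} := [set k | tagnat.sig1 k \in s].

(* Block rows s and block columns r of M; #|coords d s| is the sum of the d i
   for i in s, and enum_val lists the indices in increasing order. *)
Definition subm d e s r
    (M : 'M[R]_((\sum_(i < p) d i)%N, (\sum_(i < p) e i)%N)) :
    'M[R]_(#|coords d s|, #|coords e r|) :=
  mxsub enum_val enum_val M.

Definition subv d s (x : 'cV[R]_(\sum_(i < p) d i)%N) :
    'cV[R]_#|coords d s| :=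
  rowsub enum_val x.

Definition subI d s r : 'M[R]_(#|coords d s|, #|coords d r|) :=
  subm s r 1%:M.

End Blocks.

Section InformationGraph.
Variables (p : nat) (arc : rel 'I_p) (delay : 'I_p -> 'I_p -> nat).
Implicit Types (i j : 'I_p) (r s : {set 'I_p}).

(* Total delay of the directed path j :: c. *)
Definition path_delay j (c : seq 'I_p) : nat := sumn (pairmap delay j c).

(* arc i j is an edge from i to j, and delay i j is its delay. In the last
   clause the cycle is j -> c_1 -> ... -> c_l = j. *)
Definition delay_graph : Prop :=
  [/\ irreflexive arc,
      forall i j, arc i j -> (delay i j <= 1)%N &
      forall j c, path arc j c -> last j c = j -> uniq c -> c <> [::] ->
        (0 < path_delay j c)%N].

Definition has_path_delay j i (k : nat) : Prop :=
  exists c, [/\ path arc j c, last j c = i & path_delay j c = k].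

(* D_ij, for paths from j to i, with None standing for +oo. *)
Definition dist i j : option nat :=
  if i == j then Some 0%N else
  if pselect (exists k, `[< has_path_delay j i k >]) is left ex
  then Some (ex_minn ex) else None.

Definition dist_le i j (k : nat) : bool :=
  if dist i j is Some l then (l <= k)%N else false.

(* The maximum of the finite D_ij. *)
Definition dist_max : nat := \max_(i < p) \max_(j < p) odflt 0%N (dist i j).

Definition reach j (k : nat) : {set 'I_p} := [set i | dist_le i j k].

Definition info_nodes : {set {set 'I_p}} :=
  [set s | `[< exists j k, s = reach j k >]].

Definition info_edge : rel {set 'I_p} := fun r s =>
  `[< exists j k, r = reach j k /\ s = reach j k.+1 >].

Definition info_root s : bool := info_edge s s.

End InformationGraph.

Section Gains.
Variables (R : realType) (p : nat) (n_ m_ : 'I_p -> nat).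
Variables (arc : rel 'I_p) (delay : 'I_p -> 'I_p -> nat).
Notation n := (\sum_(i < p) n_ i)%N.
Notation m := (\sum_(i < p) m_ i)%N.
Variables (A : 'M[R]_n) (B : 'M[R]_(n, m)) (Q : 'M[R]_n) (Rc : 'M[R]_m).
Variables (P : forall s : {set 'I_p}, 'M[R]_#|coords n_ s|)
          (K : forall s : {set 'I_p}, 'M[R]_(#|coords m_ s|, #|coords n_ s|)).

(* When r = s the two equations form the Riccati equation of the self loop. *)
Definition gain_equations (r s : {set 'I_p}) : Prop :=
  let Asr := subm s r A in let Bsr := subm s r B in
  let Qrr := subm r r Q in let Rrr := subm r r Rc in
  K r = - (invmx (Rrr + Bsr^T *m P s *m Bsr) *m Bsr^T *m P s *m Asr) /\
  P r = Qrr + (K r)^T *m Rrr *m K r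
      + (Asr + Bsr *m K r)^T *m P s *m (Asr + Bsr *m K r).

Definition is_gains : Prop :=
  (forall r s, info_edge arc delay r s -> gain_equations r s) /\
  (forall s, info_root arc delay s -> psd (P s)).

End Gains.

Section Policies.
Variables (R : realType) (p : nat) (n_ m_ : 'I_p -> nat).
Variables (arc : rel 'I_p) (delay : 'I_p -> 'I_p -> nat).
Variable (nbr : 'I_p -> {set 'I_p}).
Notation n := (\sum_(i < p) n_ i)%N.
Notation m := (\sum_(i < p) m_ i)%N.
Notation U := (info_nodes arc delay).
Notation edge := (info_edge arc delay).
Notation leaf j := (reach arc delay j 0).
Variables (A : 'M[R]_n) (B : 'M[R]_(n, m)).
Variables (Ah : 'M[R]_n) (Bh : 'M[R]_(n, m)).
Variable (Kh : forall s : {set 'I_p}, 'M[R]_(#|coords m_ s|, #|coords n_ s|)).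

(* Noise, state, input and internal states along one sample path. *)
Variables (w x : nat -> 'cV[R]_n) (u : nat -> 'cV[R]_m).
Variable (zeta : nat -> forall s : {set 'I_p}, 'cV[R]_#|coords n_ s|).

Definition dynamics : Prop :=
  x 0%N = 0 /\ forall t, x t.+1 = A *m x t + B *m u t + w t.

Definition control_law : Prop :=
  forall t (i : 'I_p),
    subv [set i] (u t) =
    \sum_(r in U | i \in r) subI R m_ [set i] r *m Kh r *m zeta t r.

Definition noise_estimate (t : nat) (j : 'I_p) :
    'cV[R]_#|coords n_ [set j]| :=
  subv [set j] (x t.+1) -
  \sum_(l in nbr j) (subm [set j] [set l] Ah *m subv [set l] (x t)
                     + subm [set j] [set l] Bh *m subv [set l] (u t)).

Definition hat_policy : Prop :=
  [/\ dynamics, control_law,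
      forall r, r \in U -> zeta 0%N r = 0 &
      forall t r, r \in U ->
        zeta t.+1 r =
        \sum_(v | edge v r) (subm r v Ah + subm r v Bh *m Kh v) *m zeta t v
        + \sum_(j | leaf j == r)
            subI R n_ r [set j] *m noise_estimate t j].

Definition tilde_policy : Prop :=
  [/\ dynamics, control_law,
      forall s, s \in U -> zeta 0%N s = 0 &
      forall t s, s \in U ->
        zeta t.+1 s =
        \sum_(r | edge r s) (subm s r A + subm s r B *m Kh r) *m zeta t r
        + \sum_(i | leaf i == s)
            subI R n_ s [set i] *m subv [set i] (w t)].

End Policies.

Section Noise.
Context d (Omega : measurableType d) (R : realType) (Pr : probability Omega R).
Variable n : nat.

(* The law of X is N(0, sigma^2 I_n), the n-fold product of N(0, sigma^2),
   given by its values on measurable boxes. The second parameter of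
   normal_prob is the standard deviation. *)
Definition centered_isotropic_gaussian (sigma : R) (X : Omega -> 'cV[R]_n) :
    Prop :=
  (forall k, measurable_fun setT (fun om => X om k ord0)) /\
  forall b : 'I_n -> set R, (forall k, measurable (b k)) ->
    Pr [set om | forall k, b k (X om k ord0)] =
    (\prod_(k < n) normal_prob 0 sigma (b k))%E.

Definition sigma_algebra_of (X : Omega -> 'cV[R]_n) : set (set Omega) :=
  <<s [set E | exists k (b : set R),
         measurable b /\ E = [set om | b (X om k ord0)]] >>.

Definition mutually_independent (w : nat -> Omega -> 'cV[R]_n) : Prop :=
  forall (J : seq nat) (E : nat -> set Omega), uniq J ->
    (forall t, t \in J -> sigma_algebra_of (w t) (E t)) ->
    Pr (\bigcap_(t in [set` J]) E t) = (\prod_(t <- J) Pr (E t))%E.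

Definition iid_gaussian_noise (sigma : R) (w : nat -> Omega -> 'cV[R]_n) :
    Prop :=
  (forall t, centered_isotropic_gaussian sigma (w t)) /\
  mutually_independent w.

Definition average_cost m (Q : 'M[R]_n) (Rc : 'M[R]_m)
    (x : nat -> Omega -> 'cV[R]_n) (u : nat -> Omega -> 'cV[R]_m) :
    nat -> \bar R := fun T =>
  ('E_Pr[(fun om => T%:R^-1 *
     \sum_(0 <= t < T) (quad Q (x t om) + quad Rc (u t om)))%R])%E.

End Noise.

(* Main.v *)
From HB Require Import structures.
Require Import Defs.
From mathcomp Require Import all_boot all_order all_algebra.
From mathcomp Require Import all_classical all_reals all_analysis.
From mathcomp Require Import measurable_realfun.
From mathcomp Require Import zify ring lra.

Set Implicit Arguments.
Unset Strict Implicit.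
Unset Printing Implicit Defensive.

Import Order.TTheory GRing.Theory Num.Theory.
Import numFieldNormedType.Exports.

Local Open Scope classical_set_scope.
Local Open Scope ring_scope.

(** The excess cost is bounded on every sample path by a multiple of eps times
    the energy of the noise; expectations come last.

    Value functions. For a node r with successor s, the value quad (P r) z is the
    cost of one step of the optimal feedback followed by the value at s
    ([value_eq]), and at most the cost of one step of any other input
    ([value_le]). Applying the true optimal feedback K in the estimated system
    therefore bounds the estimated values Ph from above. One such step costs
    O(eps) |z|^2 more than in the true system, and the running cost, which is at
    least |z|^2 because Q >= I, pays for it: (1 + al) P is a supersolution of the
    estimated recursion with one and the same al = O(eps) at all nodes
    ([supersolution], [comparison]). At a root, where the recursion is a Riccati
    equation, one iterates the stable closed loop. Hence
    |z|^2 <= quad (Ph s) z <= Gammat |z|^2 on the support of every node s.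

    Chains. These two bounds make the square root of quad (Ph s) a Lyapunov
    function which decreases by the factor 1 - 1 / (2 Gammat) along every edge
    ([V_contract]) and which dominates the norms of the state, of the input and of
    the cost. Noise that entered subsystem j sits, k steps later, at the node
    reach j k, and the internal states are sums of such contributions
    ([internal_state]). The total size of the contributions obeys a scalar stable
    recursion, so that energies over a finite horizon are controlled by
    [l2_filter]. Under the comparison policy the state is the sum of the chains
    driven by the noise. Under the learned policy it is the sum of the chains
    driven by the estimated noise, plus a drift ([driftS]) that is filtered by the
    stable matrix A and whose source is O(eps). The error of the estimated noise
    is itself O(eps) times the state and the input, and the loop is closed by
    [small_gain]. This gives [pathwise_cost].

    Expectations. The coordinates of the noise are orthogonal with variance at
    most sigma_w^2 ([noise_orthogonal], [noise_var_le]). The expected cost of the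
    comparison policy at time t is therefore a sum of nonnegative costs of the lags
    up to t, which is bounded because of the energy estimate applied to unit
    impulses ([sum_lag_cost]); so the average cost converges ([average_cost_cvg]),
    and the expectation of the pathwise bound gives the theorem. *)

(** * Quadratic forms and the seminorms they define *)

Lemma ler_of_sqr (R : realDomainType) (x y : R) : 0 <= y -> x ^+ 2 <= y ^+ 2 -> x <= y.
Proof.
move=> y0; have [x0|/ltW x0 _] := leP 0 x; last exact: le_trans y0.
by rewrite ler_pXn2r.
Qed.

Section QuadraticForms.
Variable R : realType.
Implicit Types n m : nat.

Definition bform n (M : 'M[R]_n) (x y : 'cV[R]_n) : R :=
  (x^T *m M *m y) ord0 ord0.

Lemma bformDl n (M : 'M[R]_n) x y z : bform M (x + y) z = bform M x z + bform M y z.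
Proof. by rewrite /bform linearD /= !mulmxDl mxE. Qed.

Lemma bformDr n (M : 'M[R]_n) x y z : bform M z (x + y) = bform M z x + bform M z y.
Proof. by rewrite /bform mulmxDr mxE. Qed.

Lemma bformZl n (M : 'M[R]_n) a x y : bform M (a *: x) y = a * bform M x y.
Proof. by rewrite /bform linearZ /= -!scalemxAl mxE. Qed.

Lemma bformZr n (M : 'M[R]_n) a x y : bform M x (a *: y) = a * bform M x y.
Proof. by rewrite /bform -scalemxAr mxE. Qed.

Lemma bformNr n (M : 'M[R]_n) x y : bform M x (- y) = - bform M x y.
Proof. by rewrite -scaleN1r bformZr mulN1r. Qed.

Lemma bformC n (M : 'M[R]_n) x y : M^T = M -> bform M x y = bform M y x.
Proof.
move=> MT; rewrite /bform -[in LHS](trmxK (x^T *m M *m y)) mxE.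
by rewrite !trmx_mul trmxK MT mulmxA.
Qed.

Lemma bformE n (M : 'M[R]_n) x y :
  bform M x y = \sum_i \sum_j x i ord0 * M i j * y j ord0.
Proof.
rewrite /bform mxE exchange_big /=; apply: eq_bigr => j _.
by rewrite mxE mulr_suml; apply: eq_bigr => i _; rewrite mxE.
Qed.

Lemma bform1 n (M : 'M[R]_n) x y : bform M x y = bform 1%:M x (M *m y).
Proof. by rewrite /bform mulmx1 mulmxA. Qed.

Lemma quad_bform n (M : 'M[R]_n) x : quad M x = bform M x x.
Proof. by []. Qed.

Lemma quadD n (M : 'M[R]_n) x y : M^T = M ->
  quad M (x + y) = quad M x + 2 * bform M x y + quad M y.
Proof.
move=> MT; rewrite !quad_bform !bformDl !bformDr (bformC y x MT).
by ring.
Qed.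

Lemma quadZ n (M : 'M[R]_n) a x : quad M (a *: x) = a ^+ 2 * quad M x.
Proof. by rewrite !quad_bform bformZl bformZr mulrA. Qed.

Lemma quadN n (M : 'M[R]_n) x : quad M (- x) = quad M x.
Proof. by rewrite -scaleN1r quadZ sqrrN expr1n mul1r. Qed.

Lemma quad0 n (M : 'M[R]_n) : quad M 0 = 0.
Proof. by rewrite /quad mulmx0 mxE. Qed.

Lemma quad_addM n (M N : 'M[R]_n) x : quad (M + N) x = quad M x + quad N x.
Proof. by rewrite /quad mulmxDr mulmxDl mxE. Qed.

Lemma quad_congr n m (M : 'M[R]_n) (F : 'M[R]_(n, m)) x :
  quad (F^T *m M *m F) x = quad M (F *m x).
Proof. by rewrite /quad trmx_mul !mulmxA. Qed.

Lemma psd_congr n m (M : 'M[R]_n) (F : 'M[R]_(n, m)) :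
  psd M -> psd (F^T *m M *m F).
Proof.
move=> [MT M0]; split=> [|x]; last by rewrite quad_congr.
by rewrite !trmx_mul trmxK MT mulmxA.
Qed.

Lemma psd_add n (M N : 'M[R]_n) : psd M -> psd N -> psd (M + N).
Proof.
move=> [MT M0] [NT N0]; split=> [|x]; first by rewrite linearD /= MT NT.
by rewrite quad_addM addr_ge0.
Qed.

Lemma psd1 n : psd (1%:M : 'M[R]_n).
Proof.
split=> [|x]; first exact: trmx1.
rewrite /quad mulmx1 mxE; apply: sumr_ge0 => k _.
by rewrite !mxE -expr2 sqr_ge0.
Qed.

Lemma quad1E n (x : 'cV[R]_n) : quad 1%:M x = \sum_(k < n) x k ord0 ^+ 2.
Proof. by rewrite /quad mulmx1 mxE; apply: eq_bigr => k _; rewrite mxE expr2. Qed.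

(** Cauchy-Schwarz for a degenerate inner product: a direction on which the
    form vanishes must be orthogonal to everything. *)
Lemma psd_CS n (M : 'M[R]_n) x y : psd M ->
  bform M x y ^+ 2 <= quad M x * quad M y.
Proof.
move=> [MT M0]; set b := bform M x y.
have H a c : 0 <= a ^+ 2 * quad M x + 2 * (a * c * b) + c ^+ 2 * quad M y.
  by have := M0 (a *: x + c *: y); rewrite quadD // !quadZ bformZl bformZr !mulrA.
have [qy0|] := eqVneq (quad M y) 0.
  have [->|b0] := eqVneq b 0; first by rewrite expr0n qy0 mulr0.
  (* Along this combination the form would take the value -1. *)
  have := H 1 (- ((quad M x + 1) / (2 * b))).
  have -> : 1 ^+ 2 * quad M x + 2 * (1 * (- ((quad M x + 1) / (2 * b))) * b) +
    (- ((quad M x + 1) / (2 * b))) ^+ 2 * quad M y = -1.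
    by rewrite qy0 mulr0 addr0; field.
  by rewrite lerNr oppr0 ler10.
move=> qyn0; have qy : 0 < quad M y by rewrite lt_def qyn0 M0.
have := H (quad M y) (- b).
have -> : quad M y ^+ 2 * quad M x + 2 * (quad M y * (- b) * b) + (- b) ^+ 2 * quad M y
  = quad M y * (quad M x * quad M y - b ^+ 2) by ring.
by rewrite pmulr_rge0 // subr_ge0.
Qed.

Definition qnorm n (M : 'M[R]_n) (x : 'cV[R]_n) : R := Num.sqrt (quad M x).

Lemma qnorm_ge0 n (M : 'M[R]_n) x : 0 <= qnorm M x.
Proof. exact: sqrtr_ge0. Qed.

Lemma sqr_qnorm n (M : 'M[R]_n) x : psd M -> qnorm M x ^+ 2 = quad M x.
Proof. by move=> [_ M0]; rewrite sqr_sqrtr. Qed.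

Lemma bform_le n (M : 'M[R]_n) x y : psd M -> bform M x y <= qnorm M x * qnorm M y.
Proof.
move=> Mp; have [_ M0] := Mp.
rewrite (le_trans (ler_norm _)) // -(ler_pXn2r (_ : (0 < 2)%N)) ?nnegrE //.
- by rewrite exprMn !sqr_qnorm // real_normK ?num_real // psd_CS.
- by rewrite mulr_ge0 ?qnorm_ge0.
Qed.

Lemma qnormD n (M : 'M[R]_n) x y : psd M -> qnorm M (x + y) <= qnorm M x + qnorm M y.
Proof.
move=> Mp; rewrite -(ler_pXn2r (_ : (0 < 2)%N)) ?nnegrE ?addr_ge0 ?qnorm_ge0 //.
rewrite sqr_qnorm // quadD; last by case: Mp.
rewrite sqrrD !sqr_qnorm // lerD2r lerD2l mulr2n mulrDl !mul1r.
by rewrite lerD ?bform_le.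
Qed.

Lemma qnorm0 n (M : 'M[R]_n) : qnorm M 0 = 0.
Proof. by rewrite /qnorm quad0 sqrtr0. Qed.

Lemma qnormN n (M : 'M[R]_n) x : qnorm M (- x) = qnorm M x.
Proof. by rewrite /qnorm quadN. Qed.

Lemma qnormB n (M : 'M[R]_n) x y : psd M -> qnorm M (x - y) <= qnorm M x + qnorm M y.
Proof. by move=> Mp; rewrite -(qnormN M y) qnormD. Qed.

Lemma qnormZ n (M : 'M[R]_n) a x : qnorm M (a *: x) = `|a| * qnorm M x.
Proof. by rewrite /qnorm quadZ sqrtrM ?sqr_ge0 // sqrtr_sqr. Qed.

Lemma qnorm_sum n (M : 'M[R]_n) I (r : seq I) (P : pred I) (F : I -> 'cV[R]_n) :
  psd M -> qnorm M (\sum_(i <- r | P i) F i) <= \sum_(i <- r | P i) qnorm M (F i).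
Proof.
move=> Mp; elim/big_ind2: _ => [|a b c e ab ce|//]; first by rewrite qnorm0.
by apply: le_trans (qnormD _ _ Mp) _; exact: lerD.
Qed.

Lemma enormE n (x : 'cV[R]_n) : enorm x = qnorm 1%:M x.
Proof. by rewrite /enorm /qnorm quad1E. Qed.

Lemma enorm_ge0 n (x : 'cV[R]_n) : 0 <= enorm x.
Proof. exact: sqrtr_ge0. Qed.

Lemma sqr_enorm n (x : 'cV[R]_n) : enorm x ^+ 2 = quad 1%:M x.
Proof. by rewrite enormE sqr_qnorm //; exact: psd1. Qed.

Lemma enormD n (x y : 'cV[R]_n) : enorm (x + y) <= enorm x + enorm y.
Proof. by rewrite !enormE qnormD //; exact: psd1. Qed.

Lemma enorm0 n : enorm (0 : 'cV[R]_n) = 0.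
Proof. by rewrite enormE qnorm0. Qed.

Lemma enormN n (x : 'cV[R]_n) : enorm (- x) = enorm x.
Proof. by rewrite !enormE qnormN. Qed.

Lemma enormZ n a (x : 'cV[R]_n) : enorm (a *: x) = `|a| * enorm x.
Proof. by rewrite !enormE qnormZ. Qed.

Lemma enorm_sum n I (r : seq I) (P : pred I) (F : I -> 'cV[R]_n) :
  enorm (\sum_(i <- r | P i) F i) <= \sum_(i <- r | P i) enorm (F i).
Proof.
rewrite enormE (eq_bigr (fun i => qnorm 1%:M (F i))) => [|i _]; last exact: enormE.
by apply: qnorm_sum; exact: psd1.
Qed.

Lemma enorm_eq0 n (x : 'cV[R]_n) : (enorm x == 0) = (x == 0).
Proof.
apply/eqP/eqP => [x0|->]; last exact: enorm0.
have : quad 1%:M x = 0 by rewrite -sqr_enorm x0 expr0n.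
rewrite quad1E => /eqP; rewrite psumr_eq0 => [/allP H|k _]; last exact: sqr_ge0.
apply/matrixP => k j; rewrite ord1 mxE; apply/eqP.
by have := H k; rewrite mem_index_enum => /(_ isT) /=; rewrite sqrf_eq0.
Qed.

Lemma ler_coord_enorm n (x : 'cV[R]_n) k : `|x k ord0| <= enorm x.
Proof.
rewrite -(ler_pXn2r (_ : (0 < 2)%N)) ?nnegrE ?enorm_ge0 //.
rewrite sqr_enorm quad1E real_normK ?num_real // (bigD1 k) //= lerDl.
by apply: sumr_ge0 => i _; exact: sqr_ge0.
Qed.

Lemma quad_bounded n (M : 'M[R]_n) :
  exists2 c, 0 <= c & forall x, quad M x <= c * quad 1%:M x.
Proof.
exists (\sum_i \sum_j `|M i j|) => [|x].
  by apply: sumr_ge0 => i _; apply: sumr_ge0.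
rewrite quad_bform bformE -sqr_enorm mulr_suml; apply: ler_sum => i _.
rewrite mulr_suml; apply: ler_sum => j _.
apply: le_trans (ler_norm _) _; rewrite !normrM expr2 mulrAC mulrC.
by rewrite ler_wpM2l // ler_pM // ler_coord_enorm.
Qed.

Lemma specnorm_has_sup m n (M : 'M[R]_(m, n)) :
  has_sup [set enorm (M *m x) | x in [set x : 'cV[R]_n | enorm x <= 1]].
Proof.
split; first by exists (enorm (M *m 0)); exists 0 => //=; rewrite enorm0.
have [c c0 Hc] := quad_bounded (M^T *m 1%:M *m M).
exists (Num.sqrt c) => _ [x /= x1 <-].
rewrite enormE /qnorm -quad_congr ler_wsqrtr //.
apply: le_trans (Hc x) _; rewrite -[leRHS]mulr1 ler_wpM2l //.
by rewrite -sqr_enorm expr_le1 ?enorm_ge0.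
Qed.

Lemma specnorm_ge0 m n (M : 'M[R]_(m, n)) : 0 <= specnorm M.
Proof.
apply: ub_le_sup; first by case: (specnorm_has_sup M).
by exists 0; rewrite /= ?mulmx0 enorm0.
Qed.

Lemma specnormP m n (M : 'M[R]_(m, n)) x : enorm (M *m x) <= specnorm M * enorm x.
Proof.
have [->|x0] := eqVneq x 0; first by rewrite mulmx0 !enorm0 mulr0.
have ex : 0 < enorm x by rewrite lt_def enorm_eq0 x0 enorm_ge0.
rewrite -ler_pdivrMr //; apply: ub_le_sup; first by case: (specnorm_has_sup M).
exists ((enorm x)^-1 *: x) => /=.
  by rewrite enormZ ger0_norm ?invr_ge0 ?enorm_ge0 // mulVf // gt_eqF.
by rewrite -scalemxAr enormZ ger0_norm ?invr_ge0 ?enorm_ge0 // mulrC.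
Qed.

Lemma quad_specnorm n (M : 'M[R]_n) x : quad M x <= specnorm M * quad 1%:M x.
Proof.
have -> : quad M x = bform 1%:M x (M *m x) by rewrite quad_bform bform1.
apply: le_trans (bform_le _ _ (psd1 _)) _; rewrite -!enormE -sqr_enorm expr2 mulrCA.
by rewrite ler_wpM2l ?enorm_ge0 ?specnormP.
Qed.

End QuadraticForms.

(** * Singular values and positive definiteness *)

Section SingularValues.
Variable R : realType.

Lemma singval_ge0 m n (M : 'M[R]_(m, n)) k : 0 <= singval k M.
Proof.
rewrite /singval /singular_values; case: xgetP => [s _ [_ /allP s0 _]|_]; last by rewrite nth_nil.
have [ks|ks] := ltnP k.-1 (size s); last by rewrite nth_default.
exact/s0/mem_nth.
Qed.

(** By Cauchy-Schwarz for M applied to M x and x, |M x|^2 is at most a multiple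
    of quad M x, and |x| is at most a multiple of |M x|. *)
Lemma psd_unit_coercive n (M : 'M[R]_n) : psd M -> M \in unitmx ->
  exists2 c, 0 < c & forall x, c * quad 1%:M x <= quad M x.
Proof.
move=> Mp Mu; set a := specnorm (invmx M) + 1; set b := specnorm M + 1.
have a0 : 0 < a by rewrite ltr_wpDl ?specnorm_ge0.
have b0 : 0 < b by rewrite ltr_wpDl ?specnorm_ge0.
exists (a ^+ 2 * b)^-1 => [|x]; first by rewrite invr_gt0 mulr_gt0 ?exprn_gt0.
have ab : 0 < a ^+ 2 * b by rewrite mulr_gt0 ?exprn_gt0.
rewrite ler_pdivrMl // -sqr_enorm.
have xM : enorm x <= a * enorm (M *m x).
  have := specnormP (invmx M) (M *m x); rewrite mulmxA mulVmx // mul1mx => /le_trans.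
  by apply; rewrite ler_wpM2r ?enorm_ge0 // lerDl.
have Mb y : quad M y <= b * enorm y ^+ 2.
  apply: le_trans (quad_specnorm _ _) _.
  by rewrite sqr_enorm ler_wpM2r ?(psd1 R n).2 // lerDl.
have : (enorm (M *m x)) ^+ 2 <= b * quad M x.
  have [->|y0] := eqVneq (enorm (M *m x)) 0.
    by rewrite expr0n mulr_ge0 ?(ltW b0) // Mp.2.
  have y2 : 0 < enorm (M *m x) ^+ 2 by rewrite lt_def sqr_ge0 sqrf_eq0 y0.
  rewrite -(ler_pM2r y2); have := psd_CS (M *m x) x Mp.
  have -> : bform M (M *m x) x = enorm (M *m x) ^+ 2.
    by rewrite sqr_enorm /bform /quad mulmx1 trmx_mul Mp.1 !mulmxA.
  rewrite -expr2 => /le_trans; apply.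
  by rewrite -mulrA mulrCA [leRHS]mulrC ler_wpM2r ?Mp.2 ?Mb // mulrC.
move=> H; rewrite -mulrA; apply: (@le_trans _ _ (a ^+ 2 * enorm (M *m x) ^+ 2)).
  by rewrite -exprMn ler_pXn2r // nnegrE ?enorm_ge0 // (le_trans (enorm_ge0 _) xM).
by rewrite ler_pM2l ?exprn_gt0.
Qed.

(** The largest c with M >= c I is an eigenvalue of M, so that its square is a
    root of the characteristic polynomial of M^T M. *)
Lemma singval_psd_ge1 n (M : 'M[R]_n) : psd M -> 1 <= singval n M ->
  forall x, quad 1%:M x <= quad M x.
Proof.
move=> Mp; rewrite /singval /singular_values; case: xgetP => [s _ [ss s0 sM]|_]; last first.
  by rewrite nth_nil ler10.
have sz : size s = n.
  by have := size_char_poly (M^T *m M); rewrite sM size_prod_XsubC => -[->].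
case: n M Mp s ss s0 sM sz => [|n] M Mp s ss s0 sM sz.
  by rewrite nth_default ?sz // ler10.
rewrite /= => s1.
have s_ge1 a : a \in s -> 1 <= a.
  move=> sa; apply: le_trans s1 _.
  rewrite -(nth_index 0 sa); apply: (sorted_leq_nth _ _ 0 ss) => //.
  - by move=> u v w; rewrite /= => uv vw; exact: le_trans vw uv.
  - by move=> u; rewrite /=.
  - by rewrite inE index_mem.
  - by rewrite inE sz.
  - by rewrite -ltnS -sz index_mem.
pose S := [set c : R | forall x, c * quad 1%:M x <= quad M x].
pose x0 : 'cV[R]_n.+1 := delta_mx ord0 ord0.
have q1 x : 0 <= quad (1%:M : 'M[R]_n.+1) x by exact: (psd1 R _).2.
have q1x0 : quad 1%:M x0 = 1.
  rewrite quad1E (bigD1 ord0) //= big1 ?addr0 ?mxE ?eqxx ?expr1n //.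
  by move=> i /negPf i0; rewrite mxE i0 expr0n.
have S0 : S 0 by move=> x; rewrite mul0r Mp.2.
have supS : has_sup S.
  split; first by exists 0.
  by exists (quad M x0) => c /(_ x0); rewrite q1x0 mulr1.
set l := sup S.
have l0 : 0 <= l by apply: ub_le_sup S0; case: supS.
have lS : S l.
  move=> x; have [xz|xn] := eqVneq (quad 1%:M x) 0; first by rewrite xz mulr0 Mp.2.
  have xp : 0 < quad 1%:M x by rewrite lt_def xn q1.
  rewrite -ler_pdivlMr //; apply: ge_sup; first by exists 0.
  by move=> c /(_ x); rewrite ler_pdivlMr.
pose N := M - l%:M.
have qN x : quad N x = quad M x - l * quad 1%:M x.
  rewrite /N quad_addM; congr (_ + _).
  by rewrite /quad mulmxN mulNmx mul_mx_scalar -scalemxAl mulmx1 !mxE.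
have Np : psd N.
  split=> [|x]; first by rewrite /N linearB /= Mp.1 tr_scalar_mx.
  by rewrite qN subr_ge0.
have detN : \det N == 0.
  apply/negPn/negP => Nd; have [|c c0 Hc] := psd_unit_coercive Np.
    by rewrite unitmxE unitfE.
  (* An invertible M - l I would leave room above the supremum l. *)
  have : S (l + c).
    by move=> x; rewrite mulrDl -lerBrDl -qN.
  move=> /(ub_le_sup supS.2); rewrite gerDl; by rewrite leNgt c0.
have [v v0 vN] := det0P detN.
have vM : v *m M = l *: v.
  by move: vN; rewrite /N mulmxBr mul_mx_scalar => /eqP; rewrite subr_eq0 => /eqP.
have : root (char_poly (M^T *m M)) (l ^+ 2).
  rewrite -eigenvalue_root_char; apply/eigenvalueP; exists v => //.
  by rewrite Mp.1 mulmxA vM -scalemxAl vM scalerA expr2.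
rewrite sM => /rootP; rewrite horner_prod => /eqP; rewrite prodf_seq_eq0.
case/hasP => a sa; rewrite /= hornerXsubC subr_eq0 eqf_sqr => /orP la.
have l1 : 1 <= l.
  have a1 := s_ge1 _ sa; case: la => /eqP lE; first by rewrite lE.
  by move: l0; rewrite lE oppr_ge0 => /(le_trans a1); rewrite ler10.
by move=> x; apply: le_trans (lS x); rewrite ler_peMl.
Qed.

Lemma singval1_ge1 n (M : 'M[R]_n) : 1 <= singval n M -> 1 <= singval 1 M.
Proof.
rewrite /singval /singular_values; case: xgetP => [s _ [ss s0 sM]|_]; last first.
  by rewrite !nth_nil.
have sz : size s = n.
  by have := size_char_poly (M^T *m M); rewrite sM size_prod_XsubC => -[->].
move=> h; apply: le_trans h _.
case: n M s ss s0 sM sz => [|n] M s ss s0 sM sz; first by rewrite !nth_default ?sz.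
apply: (sorted_leq_nth _ _ 0 ss) => //; rewrite ?inE ?sz //.
- by move=> u v w; rewrite /= => uv vw; exact: le_trans vw uv.
- by move=> u; rewrite /=.
Qed.

End SingularValues.

(** * The information graph *)

Section InfoGraph.
Variables (p : nat) (arc : rel 'I_p) (delay : 'I_p -> 'I_p -> nat).
Hypothesis G : delay_graph arc delay.
Implicit Types (i j l : 'I_p).

Notation dle := (dist_le arc delay).
Notation reach := (reach arc delay).
Notation edge := (info_edge arc delay).
Notation root := (info_root arc delay).

Lemma dist_leP i j k :
  reflect (exists c, [/\ path arc j c, last j c = i & (path_delay delay j c <= k)%N])
          (dle i j k).
Proof.
rewrite /dist_le /dist; case: eqVneq => [->|ij].
  by apply: ReflectT; exists [::].
case: pselect => [ex|nex]; last first.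
  apply: ReflectF => -[c [pc lc _]]; apply: nex.
  by exists (path_delay delay j c); apply/asboolP; exists c.
case: ex_minnP => l /asboolP Hl lmin.
apply: (iffP idP) => [lk|[c' [pc' lc' dk]]].
  by have [c [pc lc dc]] := Hl; exists c; rewrite dc.
by apply: leq_trans dk; apply: lmin; apply/asboolP; exists c'.
Qed.

Lemma path_delay_cat j c c' :
  path_delay delay j (c ++ c') = (path_delay delay j c + path_delay delay (last j c) c')%N.
Proof. by rewrite /path_delay pairmap_cat sumn_cat. Qed.

(** Arcs have delay at most 1, so a path of total delay at most k.+1 can be cut
    before the delay exceeds k, leaving a tail of delay at most 1. *)
Lemma path_delay_split j c k : path arc j c -> (path_delay delay j c <= k.+1)%N ->
  exists c1 c2, [/\ c = c1 ++ c2, (path_delay delay j c1 <= k)%N &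
                    (path_delay delay (last j c1) c2 <= 1)%N].
Proof.
have [_ delay1 _] := G.
elim/last_ind: c => [|c i IH]; first by exists [::], [::].
rewrite rcons_path => /andP [pc arci].
have pd1 l : path_delay delay l [:: i] = delay l i by rewrite /path_delay /= addn0.
rewrite -cats1 path_delay_cat pd1 => dk.
have di := delay1 _ _ arci.
have [ck|ck] := leqP (path_delay delay j c) k.
  by exists c, [:: i]; rewrite pd1.
have ck1 : (path_delay delay j c <= k.+1)%N := leq_trans (leq_addr _ _) dk.
have d0 : delay (last j c) i = 0%N.
  by apply/eqP; rewrite -leqn0 -(leq_add2l k.+1) addn0; apply: leq_trans dk; rewrite leq_add2r.
have [c1 [c2 [cE d1 d2]]] := IH pc ck1.
exists c1, (c2 ++ [:: i]); split=> //; first by rewrite catA -cE.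
by rewrite path_delay_cat -last_cat -cE pd1 d0 addn0.
Qed.

Lemma dist_leS i j k : dle i j k.+1 = [exists l, dle l j k && dle i l 1].
Proof.
apply/dist_leP/existsP => [[c [pc lc dc]]|[l /andP[/dist_leP [c [pc lc dc]]]]].
  have [c1 [c2 [cE d1 d2]]] := path_delay_split pc dc.
  move: pc lc; rewrite cE cat_path last_cat => /andP[p1 p2] lc.
  exists (last j c1); apply/andP; split; apply/dist_leP; first by exists c1.
  by exists c2.
move=> /dist_leP [c' [pc' lc' dc']]; exists (c ++ c').
by rewrite cat_path last_cat path_delay_cat pc lc pc' lc' -addn1 leq_add.
Qed.

(** The successor of a node depends only on the set it is, not on the pair
    (j, k) presenting it, because reach j k.+1 is the set of subsystems within
    delay 1 of reach j k. *)
Lemma reachS_inj j k j' k' : reach j k = reach j' k' -> reach j k.+1 = reach j' k'.+1.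
Proof.
move=> /setP H; apply/setP => i; rewrite !inE !dist_leS.
by apply: eq_existsb => l; have := H l; rewrite !inE => ->.
Qed.

Lemma info_edgeE j k s : edge (reach j k) s = (reach j k.+1 == s).
Proof.
apply/asboolP/eqP => [[j' [k' [/reachS_inj E ->]]]|<-]; first by [].
by exists j, k.
Qed.

Lemma mem_info_nodes j k : reach j k \in info_nodes arc delay.
Proof. by rewrite inE; apply/asboolP; exists j, k. Qed.

Lemma mem_reach0 j : j \in reach j 0.
Proof. by rewrite inE /dist_le /dist eqxx. Qed.

(** Beyond the largest finite distance, reach j k no longer grows. *)
Lemma reach_root j k : (dist_max arc delay <= k)%N -> root (reach j k).
Proof.
move=> Dk; rewrite /info_root info_edgeE; apply/eqP/setP => i; rewrite !inE /dist_le.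
have : (odflt 0%N (dist arc delay i j) <= dist_max arc delay)%N.
  apply: leq_trans (leq_bigmax i); apply: leq_trans (leq_bigmax j) => //.
by case: (dist arc delay i j) => //= l lD; rewrite !(leq_trans lD) // ltnW.
Qed.

(** The standing assumption on delays: what is supported on reach j k spreads in
    one step to no subsystem outside reach j k.+1. *)
Lemma neighbour_reachS (nbr : 'I_p -> {set 'I_p}) i l j k :
  (forall i j, j \in nbr i -> dle i j 1) ->
  l \in reach j k -> l \in nbr i -> i \in reach j k.+1.
Proof.
move=> nd; rewrite !inE => lj /nd il; rewrite dist_leS.
by apply/existsP; exists l; rewrite lj.
Qed.

End InfoGraph.

(** * Blocks as compressions by coordinate projections *)

Section Selection.
Variables (R : realType) (p : nat).
Implicit Types (d e : 'I_p -> nat) (s r : {set 'I_p}).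

(** sel d s restricts stacked vectors to the blocks in s and its transpose pads
    with zeros; writing submatrices as compressions puts the vectors of all nodes
    in one space, and avoids casts between the dependent types of the nodes. *)
Definition sel d s : 'M[R]_(#|coords d s|, \sum_(i < p) d i) := rowsub enum_val 1%:M.

Definition msk d s : 'M[R]_(\sum_(i < p) d i) := (sel d s)^T *m sel d s.

Lemma selE d s i j : sel d s i j = (enum_val i == j)%:R.
Proof. by rewrite !mxE. Qed.

Lemma submE d e s r (M : 'M[R]_(\sum_(i < p) d i, \sum_(i < p) e i)) :
  subm s r M = sel d s *m M *m (sel e r)^T.
Proof.
have -> : (sel e r)^T = colsub enum_val 1%:M.
  by apply/matrixP => i j; rewrite !mxE eq_sym.
by rewrite /sel -rowsubE mulmx_colsub mulmx1; apply/matrixP => i j; rewrite !mxE.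
Qed.

Lemma subvE d s (x : 'cV[R]_(\sum_(i < p) d i)) : subv s x = sel d s *m x.
Proof. by rewrite /sel -rowsubE. Qed.

Lemma sel_selT d s : sel d s *m (sel d s)^T = 1%:M.
Proof.
have -> : sel d s *m (sel d s)^T = subm s s 1%:M by rewrite submE mulmx1.
apply/matrixP => i j; rewrite !mxE.
by rewrite (inj_eq enum_val_inj).
Qed.

Lemma mskE d s i j : msk d s i j = ((i == j) && (tagnat.sig1 i \in s))%:R.
Proof.
rewrite mxE; under eq_bigr do rewrite mxE !selE -natrM mulnb.
have [is_|isN] := boolP (tagnat.sig1 i \in s); last first.
  rewrite andbF [LHS]big1 // => k _; case: eqP => //= ki; move: isN.
  by have := enum_valP k; rewrite ki inE => ->.
have is' : i \in coords d s by rewrite inE.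
rewrite andbT (bigD1 (enum_rank_in is' i)) //= enum_rankK_in // eqxx /=.
rewrite [X in _ + X]big1 ?addr0 // => k ki; case: eqP => //= kE; case/negP: ki.
by apply/eqP/enum_val_inj; rewrite enum_rankK_in.
Qed.

Lemma msk_mulE d s m (M : 'M[R]_(_, m)) i j :
  (msk d s *m M) i j = (tagnat.sig1 i \in s)%:R * M i j.
Proof.
rewrite mxE (bigD1 i) //= mskE eqxx /= [X in _ + X]big1 ?addr0 // => k ki.
by rewrite mskE eq_sym (negPf ki) mul0r.
Qed.

Lemma mskI d s r : msk d s *m msk d r = msk d (s :&: r).
Proof.
apply/matrixP => i j; rewrite msk_mulE !mskE inE.
by case: (_ \in s); rewrite ?mul1r //= ?mul0r andbF.
Qed.

Lemma msk_tr d s : (msk d s)^T = msk d s.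
Proof. by rewrite /msk trmx_mul trmxK. Qed.


Lemma mskT d : msk d [set: 'I_p]%SET = 1%:M.
Proof. by apply/matrixP => i j; rewrite mskE mxE inE andbT. Qed.

Lemma sum_msk d s : \sum_(j in s) msk d [set j]%SET = msk d s.
Proof.
apply/matrixP => i k; rewrite summxE; under eq_bigr do rewrite mskE inE.
rewrite mskE; have [is_|isN] := boolP (tagnat.sig1 i \in s); last first.
  rewrite andbF [LHS]big1 // => j js; case: (tagnat.sig1 i =P j) => [E|_]; last by rewrite andbF.
  by rewrite E js in isN.
rewrite (bigD1 (tagnat.sig1 i)) //= eqxx [X in _ + X]big1 ?addr0 // => j /andP[_].
by rewrite eq_sym => /negPf ->; rewrite andbF.
Qed.

Lemma sum_msk1 d : \sum_j msk d [set j]%SET = 1%:M.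
Proof. by rewrite -mskT -sum_msk; apply: eq_bigl => j; rewrite inE. Qed.

Lemma msk_selT d s : msk d s *m (sel d s)^T = (sel d s)^T.
Proof. by rewrite /msk -mulmxA sel_selT mulmx1. Qed.

Lemma msk_sub_selT d s r : s \subset r -> msk d r *m (sel d s)^T = (sel d s)^T.
Proof.
by move=> sr; rewrite -msk_selT mulmxA mskI (finset.setIidPr sr).
Qed.

Lemma sel_sub_msk d s r : s \subset r -> sel d s *m msk d r = sel d s.
Proof. by move=> sr; rewrite -[in RHS](trmxK (sel d s)) -(msk_sub_selT d sr) trmx_mul msk_tr trmxK. Qed.

Lemma msk1_selT d s j : j \notin s -> msk d [set j]%SET *m (sel d s)^T = 0.
Proof.
move=> js; rewrite -msk_selT mulmxA mskI; apply/matrixP => i k.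
rewrite mxE big1 ?mxE // => l _; rewrite mskE !inE.
case: eqP => [->|]; rewrite ?mul0r //=; case: eqP => [->|]; rewrite ?mul0r //=.
by rewrite (negPf js) mul0r.
Qed.

Lemma quad1_selT d s y : quad 1%:M ((sel d s)^T *m y) = quad 1%:M y.
Proof. by rewrite -quad_congr trmxK mulmx1 sel_selT. Qed.

Lemma quad1_msk d s x : quad 1%:M (msk d s *m x) = quad (msk d s) x.
Proof. by rewrite -quad_congr mulmx1 msk_tr mskI finset.setIid. Qed.

Lemma quad1_sum_msk d x : \sum_j quad 1%:M (msk d [set j]%SET *m x) = quad 1%:M x.
Proof.
under eq_bigr do rewrite quad1_msk quad_bform.
rewrite -(sum_msk1 d) /quad mulmx_sumr mulmx_suml summxE.
by apply: eq_bigr.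
Qed.

Lemma quad1_msk_le d s x : quad 1%:M (msk d s *m x) <= quad 1%:M x.
Proof.
rewrite !quad1E; apply: ler_sum => k _; rewrite msk_mulE.
by case: (_ \in s); rewrite ?mul1r // mul0r expr0n sqr_ge0.
Qed.

Lemma enorm_msk d s x : enorm (msk d s *m x) <= enorm x.
Proof. by rewrite !enormE ler_wsqrtr // quad1_msk_le. Qed.

Lemma enorm_selT d s y : enorm ((sel d s)^T *m y) = enorm y.
Proof. by rewrite !enormE /qnorm quad1_selT. Qed.

(** Cauchy-Schwarz over the p blocks: this is where the factors sqrt p come
    from. *)
Lemma sqr_sum_le (F : 'I_p -> R) : (\sum_j F j) ^+ 2 <= p%:R * \sum_j F j ^+ 2.
Proof.
have := psd_CS (const_mx 1 : 'cV[R]_p) (\col_j F j) (psd1 R p).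
rewrite !quad1E /bform mulmx1 mxE.
under eq_bigr do rewrite !mxE mul1r.
under [X in _ <= X * _]eq_bigr do rewrite mxE expr1n.
under [X in _ <= _ * X]eq_bigr do rewrite mxE.
by rewrite sumr_const card_ord.
Qed.

End Selection.

(** * Value functions of the nodes and the Riccati recursion *)

Section CompletionOfSquares.
Variable R : realType.

Lemma pos_unitmx n (M : 'M[R]_n) : (forall x, x != 0 -> 0 < quad M x) -> M \in unitmx.
Proof.
move=> M0; rewrite unitmxE unitfE; apply/negP => /det0P [v v0 vM].
have : v^T != 0 by rewrite -(inj_eq (@trmx_inj _ _ _)) trmxK linear0.
by move=> /M0; rewrite /quad trmxK vM mul0mx mxE ltxx.
Qed.

(** The quadratic function of v on the right has the positive definite matrix
    H as Hessian, up to a factor 2, and is minimal at v = K z. *)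
Lemma complete_squares n m l (As : 'M[R]_(n, l)) (Bs : 'M[R]_(n, m))
    (Rr : 'M[R]_m) (P : 'M[R]_n) (z : 'cV[R]_l) (v : 'cV[R]_m) :
  let H := Rr + Bs^T *m P *m Bs in
  let K := - (invmx H *m Bs^T *m P *m As) in
  pd Rr -> psd P ->
  quad Rr (K *m z) + quad P (As *m z + Bs *m (K *m z)) <=
  quad Rr v + quad P (As *m z + Bs *m v).
Proof.
move=> H K Rp Pp.
have Bp := psd_congr Bs Pp.
have Hpos x : x != 0 -> 0 < quad H x.
  by move=> x0; rewrite quad_addM ltr_pwDl ?Rp.2 ?Bp.2.
have HT : H^T = H by rewrite /H linearD /= Rp.1 Bp.1.
(* The normal equation of the minimization. *)
have HK : H *m (K *m z) = - (Bs^T *m P *m As *m z).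
  by rewrite /K mulNmx mulmxN !mulmxA mulmxV ?mul1mx // pos_unitmx.
have cross u : bform P (As *m z) (Bs *m u) = - bform H (K *m z) u.
  rewrite (bformC _ _ HT) [bform H _ _]bform1 HK bformNr opprK.
  by rewrite (bformC _ _ Pp.1) /bform trmx_mul mulmx1 !mulmxA.
have E u : quad Rr u + quad P (As *m z + Bs *m u) =
    quad H u - 2 * bform H (K *m z) u + quad P (As *m z).
  rewrite (quadD _ _ Pp.1) cross quad_addM quad_congr; ring.
rewrite !E lerD2r -!quad_bform.
have : 0 <= quad H (v - K *m z).
  by have [->|/Hpos/ltW //] := eqVneq (v - K *m z) 0; rewrite quad0.
rewrite quadD // quadN !quad_bform bformNr (bformC v _ HT); lra.
Qed.

End CompletionOfSquares.

Section Values.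
Variables (R : realType) (p : nat) (n_ m_ : 'I_p -> nat).
Notation n := (\sum_(i < p) n_ i)%N.
Notation m := (\sum_(i < p) m_ i)%N.
Variables (Q : 'M[R]_n) (Rc : 'M[R]_m).
Hypotheses (Q_psd : psd Q) (Rc_pd : pd Rc).

Lemma pd_psd l (M : 'M[R]_l) : pd M -> psd M.
Proof.
move=> [MT M0]; split=> // x; have [->|/M0/ltW //] := eqVneq x 0; by rewrite quad0.
Qed.

Lemma pd_subm s : pd (subm s s Rc).
Proof.
rewrite submE -{1}[sel R m_ s]trmxK; split=> [|x x0].
  exact: (psd_congr _ (pd_psd Rc_pd)).1.
rewrite quad_congr; apply: Rc_pd.2; apply: contra x0 => /eqP x0.
by rewrite -[x]mul1mx -(sel_selT R m_ s) -mulmxA x0 mulmx0.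
Qed.

Section Recursion.
Variables (A : 'M[R]_n) (B : 'M[R]_(n, m)).
Variables (P : forall s : {set 'I_p}, 'M[R]_#|coords n_ s|)
          (K : forall s : {set 'I_p}, 'M[R]_(#|coords m_ s|, #|coords n_ s|)).

Definition value (s : {set 'I_p}) : 'M[R]_n :=
  (sel R n_ s)^T *m P s *m sel R n_ s.

Definition feedback (s : {set 'I_p}) : 'M[R]_(m, n) :=
  (sel R m_ s)^T *m K s *m sel R n_ s.

Lemma value_msk (s r : {set 'I_p}) (z : 'cV[R]_n) : s \subset r -> quad (value s) (msk R n_ r *m z) = quad (value s) z.
Proof. by move=> sr; rewrite !quad_congr mulmxA sel_sub_msk. Qed.

Lemma feedback_msk (s : {set 'I_p}) (z : 'cV[R]_n) : msk R m_ s *m (feedback s *m z) = feedback s *m z.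
Proof. by rewrite /feedback !mulmxA msk_selT. Qed.

Lemma psd_value s : psd (P s) -> psd (value s).
Proof. exact: psd_congr. Qed.

Variables r s : {set 'I_p}.
Hypothesis rs : gain_equations A B Q Rc P K r s.
Hypothesis Ps : psd (P s).

Lemma psd_riccati_step : psd (P r).
Proof.
have [_ ->] := rs; apply: psd_add; last exact: psd_congr.
apply: psd_add; last exact/psd_congr/pd_psd/pd_subm.
by rewrite submE -{1}[sel R n_ r]trmxK; exact: psd_congr.
Qed.

Lemma sel_step (z : 'cV[R]_n) (u : 'cV[R]_m) : msk R n_ r *m z = z -> msk R m_ r *m u = u ->
  sel R n_ s *m (A *m z + B *m u) =
  subm s r A *m (sel R n_ r *m z) + subm s r B *m (sel R m_ r *m u).
Proof.
move=> zr ur; rewrite !submE -!mulmxA [_^T *m (_ *m z)]mulmxA zr.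
by rewrite [_^T *m (_ *m u)]mulmxA ur mulmxDr.
Qed.

Lemma value_eq z : msk R n_ r *m z = z ->
  quad (value r) z = quad Q z + quad Rc (feedback r *m z)
                     + quad (value s) (A *m z + B *m (feedback r *m z)).
Proof.
move=> zr; rewrite !quad_congr sel_step ?feedback_msk //.
have -> : sel R m_ r *m (feedback r *m z) = K r *m (sel R n_ r *m z).
  by rewrite /feedback !mulmxA sel_selT mul1mx.
have [_ ->] := rs; rewrite !quad_addM !quad_congr mulmxDl !mulmxA.
congr (_ + _ + _).
  by rewrite submE -{1}[sel R n_ r]trmxK quad_congr !mulmxA -[_^T *m _]/(msk R n_ r) zr.
by rewrite submE -{1}[sel R m_ r]trmxK quad_congr /feedback !mulmxA.
Qed.

(** Suboptimality of an arbitrary input, by completion of squares. *)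
Lemma value_le z u : msk R n_ r *m z = z -> msk R m_ r *m u = u ->
  quad (value r) z <= quad Q z + quad Rc u + quad (value s) (A *m z + B *m u).
Proof.
move=> zr ur; rewrite value_eq // -!addrA lerD2l.
have qR v : msk R m_ r *m v = v -> quad Rc v = quad (subm r r Rc) (sel R m_ r *m v).
  move=> vr; rewrite submE -{1}[sel R m_ r]trmxK quad_congr mulmxA.
  by rewrite -[_^T *m _]/(msk R m_ r) vr.
rewrite !qR ?feedback_msk // !quad_congr !sel_step ?feedback_msk //.
have -> : sel R m_ r *m (feedback r *m z) = K r *m (sel R n_ r *m z).
  by rewrite /feedback !mulmxA sel_selT mul1mx.
have [-> _] := rs; apply: complete_squares => //; exact: pd_subm.
Qed.

End Recursion.
End Values.

(** * Certainty-equivalent value functions are nearly the true ones *)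

Lemma le0_geometric (R : realType) (x a l : R) : 0 <= l < 1 ->
  (forall k, x <= a * l ^+ k) -> x <= 0.
Proof.
move=> /andP[l0 l1] H.
have c : geometric a l @ \oo --> (0 : R) by apply: cvg_geometric; rewrite ger0_norm.
rewrite -(cvg_lim (@Rhausdorff R) c); apply: limr_ge; first by apply/cvg_ex; exists 0.
by apply: nearW => k; exact: H.
Qed.

Section Comparison.
Variables (R : realType) (p : nat) (n_ m_ : 'I_p -> nat).
Variables (arc : rel 'I_p) (delay : 'I_p -> 'I_p -> nat).
Hypothesis G : delay_graph arc delay.
Notation n := (\sum_(i < p) n_ i)%N.
Notation m := (\sum_(i < p) m_ i)%N.
Notation reach := (reach arc delay).
Variables (Q : 'M[R]_n) (Rc : 'M[R]_m).
Hypotheses (Q_psd : psd Q) (Rc_pd : pd Rc).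

(** Properties of nodes are proved from the roots backwards. *)
Lemma reach_ind (C : {set 'I_p} -> Prop) :
  (forall s, info_edge arc delay s s -> C s) ->
  (forall r s, info_edge arc delay r s -> C s -> C r) ->
  forall j k, C (reach j k).
Proof.
move=> C0 CS j k; set D := dist_max arc delay.
have [l] := ubnP (D - k)%N; elim: l k => // l IH k Hl.
have [kD|kD] := leqP D k; first exact/C0/reach_root.
apply: (CS _ (reach j k.+1)); first by rewrite info_edgeE.
apply: IH; apply: leq_trans (_ : (D - k <= l)%N); last by rewrite -ltnS.
by rewrite subnS prednK // subn_gt0.
Qed.

Section OneSystem.
Variables (A : 'M[R]_n) (B : 'M[R]_(n, m)).
Variables (P : forall s : {set 'I_p}, 'M[R]_#|coords n_ s|)
          (K : forall s : {set 'I_p}, 'M[R]_(#|coords m_ s|, #|coords n_ s|)).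
Hypothesis PK : is_gains arc delay A B Q Rc P K.

Lemma psd_gain j k : psd (P (reach j k)).
Proof.
have [ge roots] := PK; apply: (reach_ind (C := fun s => psd (P s))); first exact: roots.
by move=> r s rs; exact: (psd_riccati_step Q_psd Rc_pd (ge _ _ rs)).
Qed.

Lemma psd_nodes r s : info_edge arc delay r s -> psd (P r) /\ psd (P s).
Proof. by case/asboolP => j [k [-> ->]]; split; exact: psd_gain. Qed.

Lemma value_ge r s z : info_edge arc delay r s -> msk R n_ r *m z = z ->
  quad Q z + quad Rc (feedback K r *m z) <= quad (value P r) z.
Proof.
move=> rs zr; have [_ Ps] := psd_nodes rs.
by rewrite (value_eq (PK.1 _ _ rs)) // lerDl (psd_value Ps).2.
Qed.

Lemma value_ub s c z : 0 <= c -> (forall y, quad (P s) y <= c * quad 1%:M y) ->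
  quad (value P s) z <= c * quad 1%:M z.
Proof.
move=> c0 Hc; rewrite quad_congr; apply: le_trans (Hc _) _.
rewrite ler_wpM2l // -quad1_selT; rewrite mulmxA; exact: quad1_msk_le.
Qed.

End OneSystem.

Variables (A : 'M[R]_n) (B : 'M[R]_(n, m)) (Ah : 'M[R]_n) (Bh : 'M[R]_(n, m)).
Variables (P Ph : forall s : {set 'I_p}, 'M[R]_#|coords n_ s|)
          (K Kh : forall s : {set 'I_p}, 'M[R]_(#|coords m_ s|, #|coords n_ s|)).
Hypotheses (PK : is_gains arc delay A B Q Rc P K)
           (PKh : is_gains arc delay Ah Bh Q Rc Ph Kh).
Variables (c eps : R).
Hypothesis Q_ge1 : forall x, quad 1%:M x <= quad Q x.
Hypotheses (c_ge0 : 0 <= c) (eps_ge0 : 0 <= eps).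
Hypothesis P_le : forall s, s \in info_nodes arc delay ->
  forall x, quad (P s) x <= c * quad 1%:M x.
Hypothesis K_le : forall s, s \in info_nodes arc delay ->
  forall x, enorm (K s *m x) <= c * enorm x.
Hypothesis A_le : forall x, enorm ((Ah - A) *m x) <= eps * enorm x.
Hypothesis B_le : forall x, enorm ((Bh - B) *m x) <= eps * enorm x.

Lemma edge_nodes r s : info_edge arc delay r s ->
  (r \in info_nodes arc delay) /\ (s \in info_nodes arc delay).
Proof. by case/asboolP => j [k [-> ->]]; split; exact: mem_info_nodes. Qed.

(** Over one step of the true optimal feedback, passing to the estimated
    dynamics costs at most this multiple of |z|^2. *)
Definition step_error := 2 * (c * ((c + 1) * eps)) + c * ((c + 1) * eps) ^+ 2.

Lemma step_perturbation r s z : info_edge arc delay r s -> msk R n_ r *m z = z ->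
  quad (value P s) (Ah *m z + Bh *m (feedback K r *m z)) <=
  quad (value P s) (A *m z + B *m (feedback K r *m z)) + step_error * quad 1%:M z.
Proof.
move=> rs zr; have [rU sU] := edge_nodes rs.
have [Pr Ps] := psd_nodes PK rs.
have Vs := psd_value Ps; set u := feedback K r *m z.
set a := A *m z + B *m u; set d := (Ah - A) *m z + (Bh - B) *m u.
have -> : Ah *m z + Bh *m u = a + d by rewrite /a /d !mulmxBl addrACA !subrKC.
have ec : 0 <= (c + 1) * eps by rewrite mulr_ge0 // addr_ge0.
have ule : enorm u <= c * enorm z.
  rewrite /u /feedback -!mulmxA enorm_selT; apply: le_trans (K_le rU _) _.
  by rewrite ler_wpM2l // -(enorm_selT (R := R)) mulmxA enorm_msk.
have dle : enorm d <= (c + 1) * eps * enorm z.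
  apply: le_trans (enormD _ _) _; apply: le_trans (lerD (A_le _) (B_le _)) _.
  rewrite -mulrDr mulrAC mulrC ler_wpM2r // mulrDl mul1r addrC lerD2r //.
have qa : quad (value P s) a <= c * quad 1%:M z.
  apply: le_trans (value_ub _ c_ge0 (P_le rU)).
  rewrite (value_eq (PK.1 _ _ rs)) // lerDr addr_ge0 ?Q_psd.2 //.
  exact: (pd_psd Rc_pd).2.
have qd : quad (value P s) d <= c * (((c + 1) * eps) ^+ 2 * quad 1%:M z).
  apply: le_trans (value_ub _ c_ge0 (P_le sU)) _; rewrite ler_wpM2l //.
  by rewrite -!sqr_enorm -exprMn ler_pXn2r // nnegrE ?enorm_ge0 // (mulr_ge0 ec) ?enorm_ge0.
have bad : bform (value P s) a d <= c * ((c + 1) * eps) * quad 1%:M z.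
  have q1 : 0 <= quad 1%:M z by exact: (psd1 R n).2.
  apply: ler_of_sqr; first by rewrite mulr_ge0 // mulr_ge0.
  apply: le_trans (psd_CS _ _ Vs) _.
  apply: le_trans (ler_pM _ _ qa qd) _; rewrite ?Vs.2 //.
  by rewrite le_eqVlt; apply/orP; left; apply/eqP; ring.
rewrite (quadD _ _ Vs.1) -addrA lerD2l.
have -> : step_error * quad 1%:M z =
    2 * (c * ((c + 1) * eps) * quad 1%:M z) + c * (((c + 1) * eps) ^+ 2 * quad 1%:M z).
  by rewrite /step_error; ring.
by apply: lerD; [rewrite ler_pM2l|].
Qed.

Variable al : R.
Hypothesis al_ge0 : 0 <= al.
Hypothesis al_step : (1 + al) * step_error <= al.

Lemma step_error_ge0 : 0 <= step_error.
Proof. by rewrite /step_error addr_ge0 ?mulr_ge0 ?exprn_ge0 ?addr_ge0 ?mulr_ge0 ?addr_ge0. Qed.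

(** The running cost, which is at least |z|^2, pays for the perturbation, so
    that (1 + al) V remains a supersolution of the perturbed recursion. The same
    al works at every node: errors do not grow along the graph. *)
Lemma supersolution r s z : info_edge arc delay r s -> msk R n_ r *m z = z ->
  quad Q z + quad Rc (feedback K r *m z) +
    (1 + al) * quad (value P s) (Ah *m z + Bh *m (feedback K r *m z)) <=
  (1 + al) * quad (value P r) z.
Proof.
move=> rs zr; have := step_perturbation rs zr.
have := value_eq (PK.1 _ _ rs) zr.
set V := quad (value P r) z; set W := quad (value P s) (A *m z + _).
set W' := quad (value P s) (Ah *m z + _) => VE WW.
have := Q_ge1 z; have := (pd_psd Rc_pd).2 (feedback K r *m z).
have := (psd1 R n).2 z; have := Q_psd.2 z.
move: VE; set q := quad Q z; set r0 := quad Rc _; set z1 := quad 1%:M z => VE q0 z0 r00 zq.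
have : (1 + al) * W' <= (1 + al) * W + (1 + al) * (step_error * z1).
  by rewrite -mulrDr ler_wpM2l // addr_ge0.
have : (1 + al) * step_error * z1 <= al * q.
  by apply: ler_pM => //; rewrite mulr_ge0 ?step_error_ge0 ?addr_ge0.
have : 0 <= al * r0 by rewrite mulr_ge0.
rewrite VE !mulrDr !mulrDl -!mulrA; lra.
Qed.

Lemma estimated_value_le r s z : info_edge arc delay r s -> msk R n_ r *m z = z ->
  quad (value Ph r) z <= quad Q z + quad Rc (feedback K r *m z) +
    quad (value Ph s) (Ah *m z + Bh *m (feedback K r *m z)).
Proof.
move=> rs zr; have [_ Phs] := psd_nodes PKh rs.
by apply: (value_le Rc_pd (PKh.1 _ _ rs)) => //; rewrite feedback_msk.
Qed.

Lemma value_msk_id (P' : forall s : {set 'I_p}, 'M[R]_#|coords n_ s|) s z :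
  quad (value P' s) (msk R n_ s *m z) = quad (value P' s) z.
Proof. exact: value_msk. Qed.

(** At a self loop, the excess f of the estimated value over (1 + al) V does not
    decrease along the closed loop L of the true feedback in the estimated system.
    The supersolution V decreases geometrically along L, and f is bounded by a
    multiple of V, so f <= 0. *)
Lemma comparison_root s z : info_edge arc delay s s -> msk R n_ s *m z = z ->
  quad (value Ph s) z <= (1 + al) * quad (value P s) z.
Proof.
move=> ss zs; have [sU _] := edge_nodes ss.
have [_ Ps] := psd_nodes PK ss; have [_ Phs] := psd_nodes PKh ss.
have al1 : 0 < 1 + al by rewrite ltr_pwDl.
pose L (y : 'cV[R]_n) : 'cV[R]_n := msk R n_ s *m (Ah *m y + Bh *m (feedback K s *m y)).
pose f y := quad (value Ph s) y - (1 + al) * quad (value P s) y.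
have Ls y : msk R n_ s *m L y = L y by rewrite /L mulmxA mskI finset.setIid.
have ks k : msk R n_ s *m iter k L z = iter k L z by case: k => [|k] /=; [exact: zs|exact: Ls].
have f_step y : msk R n_ s *m y = y -> f y <= f (L y).
  move=> ys; rewrite /f /L !value_msk_id.
  have := estimated_value_le ss ys; have := supersolution ss ys; lra.
have c1 : 0 < c + 1 by rewrite ltr_wpDl.
(* c + 1 in place of c keeps the inverse meaningful when c = 0. *)
set l := 1 - ((1 + al) * (c + 1))^-1.
have d0 : 0 < (1 + al) * (c + 1) by rewrite mulr_gt0.
have d1 : 1 <= (1 + al) * (c + 1) by rewrite mulr_ege1 // ?lerDl ?lerDr.
have l01 : 0 <= l < 1.
  by rewrite /l subr_ge0 invf_le1 // d1 ltrBlDr ltrDl invr_gt0.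
have V_step y : msk R n_ s *m y = y ->
    quad (value P s) (L y) <= l * quad (value P s) y.
  move=> ys; rewrite /L value_msk_id /l mulrBl mul1r.
  rewrite -(ler_pM2l al1) mulrBr invfM !mulrA divff ?mul1r ?gt_eqF //.
  have : (c + 1)^-1 * quad (value P s) y <= quad Q y.
    rewrite ler_pdivrMl //; apply: le_trans (value_ub _ c_ge0 (P_le sU)) _.
    apply: ler_pM; rewrite ?(psd1 R n).2 ?lerDl //; exact: Q_ge1.
  have := supersolution ss ys; have := (pd_psd Rc_pd).2 (feedback K s *m y); lra.
have Vk k : quad (value P s) (iter k L z) <= l ^+ k * quad (value P s) z.
  elim: k => [|k IH]; first by rewrite expr0 mul1r.
  apply: le_trans (V_step _ (ks k)) _; rewrite exprS -mulrA ler_wpM2l //.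
  by case/andP: l01.
have fk k : f z <= f (iter k L z).
  by elim: k => [//|k IH]; apply: le_trans IH _; exact: f_step (ks k).
have [b b0 Hb] := quad_bounded (value Ph s).
rewrite -subr_le0; apply: (@le0_geometric _ _ (b * quad (value P s) z) l) => // k.
apply: le_trans (fk k) _; rewrite -mulrA [_ * l ^+ k]mulrC.
apply: le_trans (_ : quad (value Ph s) (iter k L z) <= _).
  by rewrite /f gerBl mulr_ge0 ?(ltW al1) // (psd_value Ps).2.
apply: le_trans (Hb _) _; rewrite ler_wpM2l //; apply: le_trans (Vk k).
apply: le_trans (value_ge PK ss (ks k)); apply: le_trans (Q_ge1 _) _.
by rewrite lerDl (pd_psd Rc_pd).2.
Qed.

Lemma comparison j k z : msk R n_ (reach j k) *m z = z ->
  quad (value Ph (reach j k)) z <= (1 + al) * quad (value P (reach j k)) z.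
Proof.
move: z; apply: (reach_ind (C := fun s => forall z, msk R n_ s *m z = z -> 
  quad (value Ph s) z <= (1 + al) * quad (value P s) z)) => [s ss z|r s rs IH z zr].
  exact: comparison_root.
apply: le_trans (estimated_value_le rs zr) (le_trans _ (supersolution rs zr)).
rewrite lerD2l -[leLHS]value_msk_id -[X in _ <= _ * X]value_msk_id; apply: IH.
by rewrite mulmxA mskI finset.setIid.
Qed.

End Comparison.

(** * Internal states as sums over chains of delayed noise *)

Section Chains.
Variables (R : realType) (p : nat) (n_ m_ : 'I_p -> nat).
Variables (arc : rel 'I_p) (delay : 'I_p -> 'I_p -> nat).
Hypothesis G : delay_graph arc delay.
Notation n := (\sum_(i < p) n_ i)%N.
Notation m := (\sum_(i < p) m_ i)%N.
Notation reach := (reach arc delay).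
Notation U := (info_nodes arc delay).
Variable (Kh : forall s : {set 'I_p}, 'M[R]_(#|coords m_ s|, #|coords n_ s|)).
Notation F := (feedback Kh).

Lemma mul_mskE d (s : {set 'I_p}) l (M : 'M[R]_(l, \sum_(i < p) d i)) i j :
  (M *m msk R d s) i j = M i j * (tagnat.sig1 j \in s)%:R.
Proof.
rewrite -[M *m _]trmxK trmx_mul msk_tr mxE msk_mulE mxE mulrC; congr (_ * _).
Qed.

Lemma sum_sel_msk d (x : 'cV[R]_(\sum_(i < p) d i)) :
  x = \sum_j msk R d [set j]%SET *m x.
Proof. by rewrite -mulmx_suml sum_msk1 mul1mx. Qed.

Section Dynamics.
Variables (A : 'M[R]_n) (B : 'M[R]_(n, m)).

Definition closed_loop (s : {set 'I_p}) : 'M[R]_n := A + B *m F s.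

(** The matrix carrying the noise entering subsystem j to the node that it has
    reached k steps later. *)
Fixpoint chain (j : 'I_p) (k : nat) : 'M[R]_n :=
  if k is l.+1 then msk R n_ (reach j l.+1) *m (closed_loop (reach j l) *m chain j l)
  else msk R n_ [set j]%SET.

Lemma chain_msk j k : msk R n_ (reach j k) *m chain j k = chain j k.
Proof.
case: k => [|k] /=; last by rewrite mulmxA mskI finset.setIid.
rewrite mskI; congr msk; apply/finset.setIidPr; rewrite finset.sub1set; exact: mem_reach0.
Qed.

Variable v : nat -> 'cV[R]_n.

Definition chain_state j k t : 'cV[R]_n := chain j k *m v (t - k.+1).

Definition total_state t : 'cV[R]_n := \sum_j \sum_(k < t) chain_state j k t.

Definition total_input t : 'cV[R]_m :=
  \sum_j \sum_(k < t) F (reach j k) *m chain_state j k t.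

Lemma chain_stateS j k t :
  chain_state j k.+1 t.+1 =
  msk R n_ (reach j k.+1) *m (closed_loop (reach j k) *m chain_state j k t).
Proof. by rewrite /chain_state subSS /= !mulmxA. Qed.

Lemma chain_state_msk j k t : msk R n_ (reach j k) *m chain_state j k t = chain_state j k t.
Proof. by rewrite /chain_state mulmxA chain_msk. Qed.

Lemma chain_state0 j t : chain_state j 0 t.+1 = msk R n_ [set j]%SET *m v t.
Proof. by rewrite /chain_state subSS subn0. Qed.

Lemma total_state0 : total_state 0 = 0.
Proof. by rewrite /total_state [LHS]big1 // => j _; rewrite big_ord0. Qed.

Lemma total_stateS t : total_state t.+1 =
  v t + \sum_j \sum_(k < t) msk R n_ (reach j k.+1) *m (closed_loop (reach j k) *m chain_state j k t).
Proof.
rewrite /total_state [v t in RHS]sum_sel_msk -big_split /=; apply: eq_bigr => j _.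
rewrite [LHS]big_ord_recl chain_state0; congr (_ + _).
by apply: eq_bigr => k _; rewrite /= /bump leq0n add1n chain_stateS.
Qed.

Section Internal.
Variable zeta : nat -> forall s : {set 'I_p}, 'cV[R]_#|coords n_ s|.
Variable vj : nat -> forall j : 'I_p, 'cV[R]_#|coords n_ [set j]%SET|.
Hypothesis vE : forall t, v t = \sum_j (sel R n_ [set j]%SET)^T *m vj t j.
Hypothesis zeta0 : forall r, r \in U -> zeta 0%N r = 0.
Hypothesis zetaS : forall t r, r \in U ->
  zeta t.+1 r =
    \sum_(s | info_edge arc delay s r) (subm r s A + subm r s B *m Kh s) *m zeta t s
    + \sum_(j | reach j 0 == r) subI R n_ r [set j]%SET *m vj t j.

Lemma msk_v j t : msk R n_ [set j]%SET *m v t = (sel R n_ [set j]%SET)^T *m vj t j.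
Proof.
rewrite vE mulmx_sumr [LHS](bigD1 j) //= mulmxA msk_selT [X in _ + X]big1 ?addr0 // => i ij.
by rewrite mulmxA msk1_selT ?mul0mx // inE eq_sym.
Qed.

(** Each chain position k of j feeds exactly the node reach j k.+1, so the
    graph recursion and the chain recursion have the same terms. *)
Lemma internal_state t s : s \in U ->
  (sel R n_ s)^T *m zeta t s =
  \sum_j \sum_(k < t | reach j k == s) chain_state j k t.
Proof.
elim: t s => [|t IH] s sU.
  by rewrite zeta0 // mulmx0 [RHS]big1 // => j _; rewrite big_ord0.
rewrite zetaS // mulmxDr addrC.
have -> : \sum_j \sum_(k < t.+1 | reach j k == s) chain_state j k t.+1 =
    \sum_(j | reach j 0 == s) msk R n_ [set j]%SET *m v t +
    \sum_j \sum_(k < t | reach j k.+1 == s)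
       msk R n_ s *m (closed_loop (reach j k) *m chain_state j k t).
  rewrite [X in X + _]big_mkcond -big_split /=; apply: eq_bigr => j _.
  rewrite [LHS]big_mkcond [LHS]big_ord_recl chain_state0; congr (_ + _).
  rewrite [RHS]big_mkcond; apply: eq_bigr => k _; rewrite /= /bump leq0n add1n chain_stateS.
  by case: eqP => // ->.
congr (_ + _).
  rewrite mulmx_sumr; apply: eq_bigr => j /eqP js.
  rewrite msk_v /subI submE mulmx1 !mulmxA -[_^T *m _]/(msk R n_ s) msk_sub_selT //.
  by rewrite -js finset.sub1set mem_reach0.
transitivity (\sum_(r | info_edge arc delay r s)
    \sum_j \sum_(k < t | reach j k == r)
       msk R n_ s *m (closed_loop (reach j k) *m chain_state j k t)).
  rewrite mulmx_sumr; apply: eq_bigr => r rs.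
  have rU : r \in U by case/asboolP: rs => j [k [-> _]]; exact: mem_info_nodes.
  transitivity (msk R n_ s *m (closed_loop r *m ((sel R n_ r)^T *m zeta t r))).
    rewrite !submE /closed_loop /feedback !mulmxA; congr (_ *m _).
    rewrite -!mulmxA [in RHS]mulmxDl -!mulmxA sel_selT mulmx1 !mulmxDr.
    by rewrite /msk !mulmxA.
  rewrite IH // !mulmx_sumr; apply: eq_bigr => j _; rewrite !mulmx_sumr.
  by apply: eq_bigr => k /eqP ->.
rewrite exchange_big /=; apply: eq_bigr => j _.
rewrite (exchange_big_dep (fun=> true)) //= [RHS]big_mkcond /=; apply: eq_bigr => k _.
rewrite -(info_edgeE G); case: ifP => [ks|ks].
  rewrite (bigD1 (reach j k)) /=; last by rewrite ks eqxx.
  by rewrite [X in _ + X]big1 ?addr0 // => r /andP[/andP[_ /eqP ->]]; rewrite eqxx.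
by rewrite [LHS]big1 // => r /andP[rs /eqP rk]; rewrite rk rs in ks.
Qed.

Lemma sum_by_node (V : nmodType) (f : 'I_p -> nat -> {set 'I_p} -> V) t :
  \sum_(s in U) \sum_j \sum_(k < t | reach j k == s) f j k s =
  \sum_j \sum_(k < t) f j k (reach j k).
Proof.
rewrite exchange_big /=; apply: eq_bigr => j _.
rewrite (exchange_big_dep (fun=> true)) //=; apply: eq_bigr => k _.
rewrite (bigD1 (reach j k)) /=; last by rewrite mem_info_nodes eqxx.
by rewrite [X in _ + X]big1 ?addr0 // => r /andP[/andP[_ /eqP ->]]; rewrite eqxx.
Qed.

Lemma input_chains (u : nat -> 'cV[R]_m) : control_law arc delay Kh u zeta ->
  forall t, u t = total_input t.
Proof.
move=> law t; rewrite [u t]sum_sel_msk.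
have -> : \sum_j msk R m_ [set j]%SET *m u t =
    \sum_j \sum_(r in U) msk R m_ [set j]%SET *m (F r *m ((sel R n_ r)^T *m zeta t r)).
  apply: eq_bigr => i _; rewrite /msk -mulmxA -subvE law mulmx_sumr.
  rewrite [RHS](bigID (fun r : {set 'I_p} => i \in r)) /= [X in _ = _ + X]big1 ?addr0.
    apply: eq_bigr => r /andP[_ ir]; rewrite /subI submE mulmx1 /feedback.
    by rewrite -!mulmxA [sel R n_ r *m (_ *m _)]mulmxA sel_selT mul1mx.
  move=> r /andP[_ ir]; rewrite -/(msk R m_ [set i]%SET) /feedback !mulmxA.
  by rewrite msk1_selT // !mul0mx.
rewrite exchange_big /= /total_input -(sum_by_node (fun j k s => F s *m chain_state j k t)).
apply: eq_bigr => r rU; rewrite -mulmx_suml sum_msk1 mul1mx internal_state //.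
by rewrite !mulmx_sumr; apply: eq_bigr => j _; rewrite !mulmx_sumr.
Qed.

End Internal.
End Dynamics.

Section Sparsity.
Variable (nbr : 'I_p -> {set 'I_p}).
Hypothesis nbr_dist : forall i j, j \in nbr i -> dist_le arc delay i j 1.

Section OneMatrix.
Variables (e : 'I_p -> nat) (M : 'M[R]_(n, \sum_(i < p) e i)).
Hypothesis M_nbr : forall i j, j \notin nbr i -> subm [set i]%SET [set j]%SET M = 0.

Lemma sparse_entry a b : tagnat.sig1 b \notin nbr (tagnat.sig1 a) -> M a b = 0.
Proof.
move=> /M_nbr; rewrite submE => H.
have : (msk R n_ [set tagnat.sig1 a]%SET *m (M *m msk R e [set tagnat.sig1 b]%SET)) a b = 0.
  rewrite /msk; have -> : forall X Y Z T, (X^T *m X) *m (Y *m (T *m Z)) =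
     X^T *m ((X *m Y *m T) *m Z) :> 'M[R]_(_, _).
    by move=> *; rewrite !mulmxA.
  by rewrite H mul0mx mulmx0 mxE.
by rewrite msk_mulE mul_mskE !inE !eqxx mul1r mulr1.
Qed.

Lemma sparse_row j : msk R n_ [set j]%SET *m (M *m msk R e (nbr j)) = msk R n_ [set j]%SET *m M.
Proof.
apply/matrixP => a b; rewrite !msk_mulE mul_mskE inE.
case: eqP => [aj|_]; last by rewrite !mul0r.
have [|/sparse_entry ->] := boolP (tagnat.sig1 b \in nbr (tagnat.sig1 a)).
  by rewrite aj => ->; rewrite mulr1.
by rewrite mul0r mulr0.
Qed.

Lemma sparse_reach j k : msk R n_ (reach j k.+1) *m (M *m msk R e (reach j k)) =
  M *m msk R e (reach j k).
Proof.
apply/matrixP => a b; rewrite msk_mulE mul_mskE.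
have [bk|_] := boolP (tagnat.sig1 b \in reach j k); last by rewrite !mulr0.
have [|/sparse_entry ->] := boolP (tagnat.sig1 b \in nbr (tagnat.sig1 a)).
  by move=> /(neighbour_reachS G nbr_dist bk) ->; rewrite mul1r.
by rewrite !mul0r mulr0.
Qed.

End OneMatrix.

Variables (A : 'M[R]_n) (B : 'M[R]_(n, m)).
Hypothesis A_nbr : forall i j, j \notin nbr i -> subm [set i]%SET [set j]%SET A = 0.
Hypothesis B_nbr : forall i j, j \notin nbr i -> subm [set i]%SET [set j]%SET B = 0.

(** The true closed loop maps the support of a node into that of its successor, so
    the masks in the chains remove nothing, and the chains add up to the state. *)
Lemma closed_loop_reach j k (y : 'cV[R]_n) : msk R n_ (reach j k) *m y = y ->
  msk R n_ (reach j k.+1) *m (closed_loop A B (reach j k) *m y) = closed_loop A B (reach j k) *m y.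
Proof.
move=> yk; rewrite /closed_loop mulmxDl mulmxDr; congr (_ + _).
  by rewrite -yk (mulmxA A) (mulmxA (msk R n_ (reach j k.+1))) sparse_reach.
by rewrite -mulmxA -feedback_msk (mulmxA B) (mulmxA (msk R n_ (reach j k.+1))) sparse_reach.
Qed.

End Sparsity.
End Chains.

(** * Energy of real sequences *)

Section Energy.
Variable R : realType.
Implicit Types (f g h b : nat -> R) (T : nat).

Definition l2 T f : R := Num.sqrt (\sum_(t < T) f t ^+ 2).

Lemma l2_ge0 T f : 0 <= l2 T f.
Proof. exact: sqrtr_ge0. Qed.

Lemma sqr_l2 T f : l2 T f ^+ 2 = \sum_(t < T) f t ^+ 2.
Proof. by rewrite sqr_sqrtr // sumr_ge0 // => t _; exact: sqr_ge0. Qed.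

Lemma l2E T f : l2 T f = enorm (\col_(t < T) f t).
Proof. by rewrite /l2 /enorm; congr Num.sqrt; apply: eq_bigr => t _; rewrite mxE. Qed.

Lemma l2D T f g : l2 T (fun t => f t + g t) <= l2 T f + l2 T g.
Proof.
rewrite !l2E; have -> : \col_(t < T) (f t + g t) = \col_(t < T) f t + \col_(t < T) g t.
  by apply/matrixP => i j; rewrite !mxE.
exact: enormD.
Qed.

Lemma l2Z T a f : 0 <= a -> l2 T (fun t => a * f t) = a * l2 T f.
Proof.
move=> a0; rewrite !l2E.
have -> : \col_(t < T) (a * f t) = a *: \col_(t < T) f t.
  by apply/matrixP => i j; rewrite !mxE.
by rewrite enormZ ger0_norm.
Qed.

Lemma l2_le T f g : (forall t, 0 <= f t) -> (forall t, f t <= g t) -> l2 T f <= l2 T g.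
Proof.
move=> f0 fg; apply: ler_wsqrtr; apply: ler_sum => t _.
by rewrite ler_pXn2r // nnegrE // (le_trans (f0 t)).
Qed.

Lemma l2_CS T f g : \sum_(t < T) f t * g t <= l2 T f * l2 T g.
Proof.
have := bform_le (\col_(t < T) f t) (\col_(t < T) g t) (psd1 R T).
rewrite -!enormE -!l2E /bform mulmx1 mxE; apply: le_trans.
by rewrite le_eqVlt; apply/orP; left; apply/eqP; apply: eq_bigr => t _; rewrite !mxE.
Qed.

(** Energy gain of a stable scalar filter. By convexity (th h + b)^2 is at most
    th h^2 + b^2 / (1 - th), and summing over time absorbs the first term. *)
Lemma l2_filter T th h b : 0 <= th < 1 -> h 0%N = 0 -> (forall t, 0 <= h t) ->
  (forall t, h t.+1 <= th * h t + b t) -> (1 - th) * l2 T h <= l2 T b.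
Proof.
move=> /andP[th0 th1] h0 hp hS; have d0 : 0 < 1 - th by rewrite subr_gt0.
apply: ler_of_sqr; first exact: l2_ge0.
rewrite exprMn !sqr_l2; set H := \sum_(t < T) h t ^+ 2; set B := \sum_(t < T) b t ^+ 2.
have step t : (1 - th) * h t.+1 ^+ 2 <= (1 - th) * (th * h t ^+ 2) + b t ^+ 2.
  have le2 : h t.+1 ^+ 2 <= (th * h t + b t) ^+ 2.
    by rewrite ler_pXn2r // nnegrE // (le_trans (hp t.+1)).
  have := sqr_ge0 ((1 - th) * h t - b t) => /(mulr_ge0 th0) sq.
  apply: le_trans (_ : (1 - th) * (th * h t + b t) ^+ 2 <= _); first by rewrite ler_pM2l.
  rewrite -subr_ge0; apply: le_trans sq _; rewrite le_eqVlt; apply/orP; left; apply/eqP; ring.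
have HT : H <= \sum_(t < T) h t.+1 ^+ 2.
  have E : \sum_(t < T.+1) h t ^+ 2 = \sum_(t < T) h t.+1 ^+ 2.
    by rewrite big_ord_recl h0 expr0n add0r; apply: eq_bigr.
  by rewrite -E big_ord_recr /= lerDl sqr_ge0.
have : (1 - th) * \sum_(t < T) h t.+1 ^+ 2 <= (1 - th) * (th * H) + B.
  by rewrite !mulr_sumr -big_split /=; apply: ler_sum => t _; exact: step.
have := HT; rewrite -(ler_pM2l d0) => /le_trans/[apply].
have -> : (1 - th) ^+ 2 * H = (1 - th) * H - (1 - th) * (th * H) by ring.
by rewrite lerBlDl.
Qed.

(** The small-gain computation. Here r and h stand for the square roots of p
    and g, X for kappa / (1 - gamma), and the l2 norms are: W of the noise, a of
    the chains driven by the estimated noise, v of the error in the estimated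
    noise, E of the part of the state outside the chains, st of the chains of the
    comparison policy, sd of the difference of the two families of chains. *)
Lemma small_gain (r h X eps W a v E st sd : R) :
  let g := h ^+ 2 in
  1 <= r -> 1 <= h -> 1 <= X -> 0 <= eps -> 0 <= W -> 0 <= a -> 0 <= v -> 0 <= E ->
  0 <= st -> 0 <= sd ->
  X * eps * r ^+ 2 * g ^+ 6 <= 768^-1 ->
  a <= 2 * g * (h * r * (W + v)) ->
  E <= X * (v + 2 * eps * a) ->
  v <= eps * r * (2 * a + E) ->
  st <= 4 * g * (h * r * W) ->
  sd <= 2 * g * (2 * eps * h * st + h * r * v) ->
  (sd + h * r * E) ^+ 2 + 2 * ((sd + h * r * E) * st) <= 396 * (X * r ^+ 4 * g ^+ 5 * eps) * W ^+ 2.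
Proof.
move=> g r1 h1 X1 e0 W0 a0 v0 E0 st0 sd0 small aE EE vE stE sdE.
have [r0 h0 X0] : [/\ 0 <= r, 0 <= h & 0 <= X] by split; lra.
have g1 : 1 <= g by rewrite /g exprn_ege1.
have g0 : 0 <= g by lra.
have hg : h <= g by rewrite /g expr2 ler_peMl.
have nn := (mulr_ge0, exprn_ge0, addr_ge0).
have k0 : 0 <= X * eps by rewrite mulr_ge0.
have ge1 := (exprn_ege1, mulr_ege1).
set M := g * (h * r * W).
have M0 : 0 <= M by rewrite /M !nn.
have s1 : X * eps * r <= 768^-1.
  apply: le_trans small; rewrite -[leLHS]mulr1.
  by apply: ler_pM; rewrite ?nn ?ge1 // ler_wpM2l // expr2 ler_peMl.
have s2 : eps * r ^+ 2 * g * h <= 768^-1.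
  apply: le_trans small; apply: le_trans (_ : eps * r ^+ 2 * g ^+ 6 <= _).
    rewrite -mulrA ler_wpM2l ?nn // (_ : g ^+ 6 = g * g * g ^+ 4); last by ring.
    by rewrite -[leLHS]mulr1; apply: ler_pM; rewrite ?nn ?ge1 // ler_wpM2l.
  by rewrite ler_wpM2r ?nn // -mulrA ler_peMl ?nn.
have vle : v <= 3 * (eps * r * a).
  have h1' : eps * r * X * v <= v / 768.
    rewrite [leRHS]mulrC ler_wpM2r // (_ : eps * r * X = X * eps * r) //; ring.
  have h2' : eps * r * X * (eps * a) <= eps * r * a / 768.
    have : X * eps * r * (eps * a) <= 768^-1 * (eps * r * a).
      apply: ler_pM; rewrite ?nn //.
      by rewrite mulrAC ler_peMr ?nn.
    lra.
  have : v <= eps * r * (2 * a + X * (v + 2 * eps * a)).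
    by apply: le_trans vE _; rewrite ler_wpM2l ?nn // lerD2l.
  have : 0 <= eps * r * a by rewrite !nn.
  lra.
have aM : a <= 3 * M.
  have h3 : g * (h * r * v) <= 3 * (a / 768).
    apply: le_trans (_ : g * (h * r * (3 * (eps * r * a))) <= _).
      by rewrite !ler_wpM2l ?nn.
    have : eps * r ^+ 2 * g * h * a <= 768^-1 * a by rewrite ler_wpM2r.
    lra.
  have : a <= 2 * M + 2 * (g * (h * r * v)) by rewrite /M; lra.
  lra.
have vM : v <= 9 * (eps * r * M).
  have : eps * r * a <= eps * r * (3 * M) by rewrite ler_wpM2l ?nn.
  lra.
have EM : E <= 15 * (X * eps * (r * M)).
  apply: le_trans EE _.
  have h4 : v + 2 * eps * a <= 15 * (eps * (r * M)).
    have : eps * a <= eps * (3 * M) by rewrite ler_wpM2l.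
    have : eps * M <= eps * (r * M) by rewrite ler_wpM2l // ler_peMl.
    lra.
  apply: le_trans (ler_wpM2l X0 h4) _; lra.
have stM : st <= 4 * M by rewrite /M mulrA.
have sdM : sd <= 34 * (eps * (g * (h * (r ^+ 2 * M)))).
  apply: le_trans sdE _.
  have h5 : 2 * eps * h * st <= 8 * (eps * (h * (r ^+ 2 * M))).
    have : eps * h * st <= eps * h * (4 * (r ^+ 2 * M)).
      rewrite ler_wpM2l ?nn //; apply: le_trans stM _; rewrite ler_pM2l //.
      by rewrite ler_peMl // ge1.
    lra.
  have h6 : h * r * v <= 9 * (eps * (h * (r ^+ 2 * M))).
    have : h * r * v <= h * r * (9 * (eps * r * M)) by rewrite ler_wpM2l ?nn.
    lra.
  have := ler_wpM2l g0 (lerD h5 h6); lra.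
set L := X * eps * (g * (h * (r ^+ 2 * M))).
have L0 : 0 <= L by rewrite /L !nn.
have NM : sd + h * r * E <= 49 * L.
  have h7 : eps * (g * (h * (r ^+ 2 * M))) <= L.
    by rewrite /L -mulrA ler_peMl // !nn.
  have h8 : h * r * E <= 15 * L.
    apply: le_trans (_ : h * r * (15 * (X * eps * (r * M))) <= _).
      by rewrite ler_wpM2l ?nn.
    have : X * eps * (h * (r ^+ 2 * M)) <= L.
      by rewrite /L ler_wpM2l // ler_peMl // !nn.
    lra.
  lra.
have N0 : 0 <= sd + h * r * E by rewrite !nn.
have P1 : (sd + h * r * E) ^+ 2 <= (49 * L) ^+ 2 by rewrite ler_pXn2r // nnegrE mulr_ge0.
have P2 : (sd + h * r * E) * st <= 49 * L * (4 * M) by rewrite ler_pM.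
have W2 : 0 <= W ^+ 2 by rewrite nn.
have P3 : L * M <= X * r ^+ 4 * g ^+ 5 * eps * W ^+ 2.
  have -> : L * M = X * r ^+ 4 * (g ^+ 4 * h) * eps * W ^+ 2.
    by rewrite /L /M /g; ring.
  rewrite ler_wpM2r // ler_wpM2r // ler_wpM2l ?nn // [g ^+ 5]exprSr ler_wpM2l ?nn //.
have P4 : L ^+ 2 <= 768^-1 * (X * r ^+ 4 * g ^+ 5 * eps * W ^+ 2).
  have -> : L ^+ 2 = X * eps * r ^+ 2 * g ^+ 6 * (X * r ^+ 4 * eps * W ^+ 2).
    by rewrite /L /M /g; ring.
  apply: ler_pM => //; rewrite ?nn //.
  by rewrite ler_wpM2r // ler_wpM2r // ler_peMr ?nn // ge1.
have : 0 <= X * r ^+ 4 * g ^+ 5 * eps * W ^+ 2 by rewrite !nn.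
move: P1 P2 P3 P4; rewrite exprMn; lra.
Qed.

End Energy.

(** * Pathwise comparison of the two policies *)

Section Pathwise.
Variables (R : realType) (p : nat) (n_ m_ : 'I_p -> nat).
Variables (arc : rel 'I_p) (delay : 'I_p -> 'I_p -> nat).
Hypothesis G : delay_graph arc delay.
Notation n := (\sum_(i < p) n_ i)%N.
Notation m := (\sum_(i < p) m_ i)%N.
Notation reach := (reach arc delay).
Variables (Q : 'M[R]_n) (Rc : 'M[R]_m).
Hypotheses (Q_psd : psd Q) (Rc_pd : pd Rc).
Hypothesis Q_ge1 : forall x, quad 1%:M x <= quad Q x.
Hypothesis R_ge1 : forall x, quad 1%:M x <= quad Rc x.
Variables (A : 'M[R]_n) (B : 'M[R]_(n, m)) (Ah : 'M[R]_n) (Bh : 'M[R]_(n, m)).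
Variables (Ph : forall s : {set 'I_p}, 'M[R]_#|coords n_ s|)
          (Kh : forall s : {set 'I_p}, 'M[R]_(#|coords m_ s|, #|coords n_ s|)).
Hypothesis PKh : is_gains arc delay Ah Bh Q Rc Ph Kh.
Variables (g eps : R).
Hypothesis g_ge1 : 1 <= g.
Hypothesis eps_ge0 : 0 <= eps.
Hypothesis A_le : forall x, enorm ((Ah - A) *m x) <= eps * enorm x.
Hypothesis B_le : forall x, enorm ((Bh - B) *m x) <= eps * enorm x.
Hypothesis Ph_le : forall j k z, msk R n_ (reach j k) *m z = z ->
  quad (value Ph (reach j k)) z <= g * quad 1%:M z.

Notation F := (feedback Kh).
Notation V j k := (value Ph (reach j k)).
Notation N j k := (qnorm (value Ph (reach j k))).
Notation supp j k y := (msk R n_ (reach j k) *m y = y).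
Notation cl := (closed_loop Kh A B).
Notation clh := (closed_loop Kh Ah Bh).

Let r : R := Num.sqrt p%:R.
Let h : R := Num.sqrt g.

Lemma reach_edge j k : info_edge arc delay (reach j k) (reach j k.+1).
Proof. by rewrite info_edgeE. Qed.

Lemma psd_V j k : psd (V j k).
Proof. exact/psd_value/(psd_gain G Q_psd Rc_pd PKh). Qed.

Lemma V_msk j k z : N j k (msk R n_ (reach j k) *m z) = N j k z.
Proof. by rewrite /qnorm value_msk. Qed.

Lemma V_le j k z : N j k z <= h * enorm z.
Proof.
rewrite -V_msk; apply: le_trans (_ : h * enorm (msk R n_ (reach j k) *m z) <= _).
  rewrite /h enormE /qnorm -sqrtrM; last exact: le_trans g_ge1.
  by rewrite ler_wsqrtr // Ph_le // mulmxA mskI finset.setIid.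
by rewrite ler_wpM2l ?sqrtr_ge0 // enorm_msk.
Qed.

Lemma cost_le_V j k z : supp j k z ->
  quad Q z + quad Rc (F (reach j k) *m z) <= quad (V j k) z.
Proof. exact: (value_ge G Q_psd Rc_pd PKh (reach_edge j k)). Qed.

Lemma state_le_V j k z : supp j k z -> enorm z <= N j k z.
Proof.
move=> zs; rewrite enormE ler_wsqrtr //; apply: le_trans (cost_le_V zs).
by rewrite -[leLHS]addr0 lerD // (pd_psd Rc_pd).2.
Qed.

Lemma input_le_V j k z : supp j k z -> enorm (F (reach j k) *m z) <= N j k z.
Proof.
move=> zs; rewrite enormE ler_wsqrtr //; apply: le_trans (cost_le_V zs).
by rewrite -[leLHS]add0r lerD // Q_psd.2.
Qed.

(* The square root of 1 - 1 / g is at most th. *)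
Let th : R := 1 - (2 * g)^-1.

Lemma th_bounds : 0 <= th < 1.
Proof.
have g2 : 1 <= 2 * g by move: g_ge1; lra.
by rewrite /th subr_ge0 invf_le1 ?(lt_le_trans ltr01 g2) // g2 ltrBlDr ltrDl invr_gt0 (lt_le_trans ltr01 g2).
Qed.

(** The running cost is at least a fraction 1 / g of the value, so the value
    norm of the estimated chains decays at a rate common to all nodes. *)
Lemma V_contract j k z : supp j k z -> N j k.+1 (clh (reach j k) *m z) <= th * N j k z.
Proof.
move=> zs; have /andP[th0 _] := th_bounds.
have g0 : 0 < g by apply: lt_le_trans g_ge1.
apply: ler_of_sqr; first by rewrite mulr_ge0 ?qnorm_ge0.
rewrite exprMn !sqr_qnorm; [|exact: psd_V|exact: psd_V].
have := value_eq (PKh.1 _ _ (reach_edge j k)) zs.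
have -> : clh (reach j k) *m z = Ah *m z + Bh *m (F (reach j k) *m z).
  by rewrite /closed_loop mulmxDl mulmxA.
have := Ph_le zs; have := Q_ge1 z; have := (pd_psd Rc_pd).2 (F (reach j k) *m z).
set v := quad (V j k) z; set v1 := quad (V j k.+1) _; set z1 := quad 1%:M z.
set q := quad Q z => Rz qz vg vE.
have vq : g^-1 * v <= q by rewrite ler_pdivrMl // (le_trans vg) // ler_wpM2l // ltW.
have v0 : 0 <= v by exact: (psd_V j k).2.
have -> : th ^+ 2 * v = v - g^-1 * v + (2 * g)^-1 ^+ 2 * v.
  by rewrite /th invfM; field; rewrite gt_eqF.
have : 0 <= (2 * g)^-1 ^+ 2 * v by rewrite mulr_ge0 ?sqr_ge0.
by move: vE; lra.
Qed.

Lemma gap_le j k z : supp j k z ->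
  enorm ((cl (reach j k) - clh (reach j k)) *m z) <= 2 * eps * N j k z.
Proof.
move=> zs; have -> : (cl (reach j k) - clh (reach j k)) *m z =
    - ((Ah - A) *m z + (Bh - B) *m (F (reach j k) *m z)).
  by rewrite /closed_loop !mulmxBl !mulmxDl -!mulmxA opprD [in RHS]opprD !opprB addrACA.
rewrite enormN; apply: le_trans (enormD _ _) _.
apply: le_trans (lerD (A_le _) (B_le _)) _; rewrite -mulrDr.
have := ler_wpM2l eps_ge0 (lerD (state_le_V zs) (input_le_V zs)); lra.
Qed.

Lemma sqrt_card_le (f : 'I_p -> R) (c : R) : 0 <= c -> (forall j, 0 <= f j) ->
  \sum_j f j ^+ 2 <= c ^+ 2 -> \sum_j f j <= r * c.
Proof.
move=> c0 f0 fc; apply: ler_of_sqr; first by rewrite mulr_ge0 ?sqrtr_ge0.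
apply: le_trans (sqr_sum_le _) _; rewrite exprMn sqr_sqrtr // ler_wpM2l //.
Qed.

Lemma sum_blocks_le (v : 'cV[R]_n) :
  \sum_j enorm (msk R n_ [set j]%SET *m v) <= r * enorm v.
Proof.
apply: sqrt_card_le => [|j|]; [exact: enorm_ge0|exact: enorm_ge0|].
by under eq_bigr do rewrite sqr_enorm; rewrite quad1_sum_msk sqr_enorm.
Qed.

Lemma injection_le (v : 'cV[R]_n) :
  \sum_j N j 0 (msk R n_ [set j]%SET *m v) <= h * r * enorm v.
Proof.
rewrite -mulrA; apply: le_trans (ler_wpM2l (sqrtr_ge0 _) (sum_blocks_le v)).
by rewrite mulr_sumr; apply: ler_sum => j _; exact: V_le.
Qed.

(** The diagonal block of Q at subsystem j is at most the value function of the
    node reach j 0. *)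
Lemma qnormQ_le (e : 'cV[R]_n) : qnorm Q e <= h * r * enorm e.
Proof.
rewrite {1}[e]sum_sel_msk; apply: le_trans (qnorm_sum _ _ _ Q_psd) _.
apply: le_trans (injection_le e); apply: ler_sum => j _.
apply: ler_wsqrtr; apply: le_trans (cost_le_V _); first by rewrite lerDl (pd_psd Rc_pd).2.
rewrite mulmxA mskI; congr (msk _ _ _ *m _); apply/finset.setIidPr.
by rewrite finset.sub1set mem_reach0.
Qed.

Section Chains.
Variables (Ab : 'M[R]_n) (Bb : 'M[R]_(n, m)) (v : nat -> 'cV[R]_n).
Notation c := (chain_state arc delay Kh Ab Bb v).

Definition chain_size t : R := \sum_j \sum_(k < t) N j k (c j k t).

Lemma chain_size0 : chain_size 0 = 0.
Proof. by rewrite /chain_size big1 // => j _; rewrite big_ord0. Qed.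

Lemma chain_size_ge0 t : 0 <= chain_size t.
Proof. by apply: sumr_ge0 => j _; apply: sumr_ge0 => k _; exact: qnorm_ge0. Qed.

Lemma total_state_le t : enorm (total_state arc delay Kh Ab Bb v t) <= chain_size t.
Proof.
apply: le_trans (enorm_sum _ _ _) _; apply: ler_sum => j _.
apply: le_trans (enorm_sum _ _ _) _; apply: ler_sum => k _.
exact/state_le_V/chain_state_msk.
Qed.

Lemma total_input_le t : enorm (total_input arc delay Kh Ab Bb v t) <= chain_size t.
Proof.
apply: le_trans (enorm_sum _ _ _) _; apply: ler_sum => j _.
apply: le_trans (enorm_sum _ _ _) _; apply: ler_sum => k _.
exact/input_le_V/chain_state_msk.
Qed.

Lemma chain_size_step (a : R) t :
  (forall j k y, supp j k y -> N j k.+1 (closed_loop Kh Ab Bb (reach j k) *m y) <= a * N j k y) ->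
  chain_size t.+1 <= a * chain_size t + h * r * enorm (v t).
Proof.
move=> step; rewrite addrC; apply: le_trans (lerD (injection_le (v t)) (lexx _)).
rewrite /chain_size mulr_sumr -big_split /=; apply: ler_sum => j _.
rewrite big_ord_recl chain_state0 lerD2l mulr_sumr; apply: ler_sum => k _.
rewrite /= /bump leq0n add1n chain_stateS V_msk; apply: step; exact: chain_state_msk.
Qed.

End Chains.

Lemma hat_size_step v t :
  chain_size Ah Bh v t.+1 <= th * chain_size Ah Bh v t + h * r * enorm (v t).
Proof. by apply: chain_size_step => j k y; exact: V_contract. Qed.

(** The true dynamics with the estimated gains contract in the same norms, up to
    the gap between the two closed loops. *)
Lemma tilde_contract j k y : supp j k y ->
  N j k.+1 (cl (reach j k) *m y) <= (th + 2 * eps * h) * N j k y.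
Proof.
move=> ys; rewrite -[cl _](subrKC (clh (reach j k))) mulmxDl mulrDl.
apply: le_trans (qnormD _ _ (psd_V _ _)) _; apply: lerD; first exact: V_contract.
apply: le_trans (V_le _ _ _) _; rewrite mulrAC [_ * h]mulrC mulrC.
by rewrite mulrC ler_wpM2l ?sqrtr_ge0 // gap_le.
Qed.

Lemma tilde_size_step v t :
  chain_size A B v t.+1 <= (th + 2 * eps * h) * chain_size A B v t + h * r * enorm (v t).
Proof. by apply: chain_size_step => j k y; exact: tilde_contract. Qed.

Section Gap.
Variables (v w : nat -> 'cV[R]_n).
Notation ch := (chain_state arc delay Kh Ah Bh v).
Notation ct := (chain_state arc delay Kh A B w).

Definition gap_size t : R := \sum_j \sum_(k < t) N j k (ch j k t - ct j k t).

Lemma gap_size0 : gap_size 0 = 0.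
Proof. by rewrite /gap_size big1 // => j _; rewrite big_ord0. Qed.

Lemma gap_size_ge0 t : 0 <= gap_size t.
Proof. by apply: sumr_ge0 => j _; apply: sumr_ge0 => k _; exact: qnorm_ge0. Qed.

Lemma gap_size_step t : gap_size t.+1 <=
  th * gap_size t + (2 * eps * h * chain_size A B w t + h * r * enorm (v t - w t)).
Proof.
rewrite addrA addrC; apply: le_trans (lerD (injection_le (v t - w t)) (lexx _)).
rewrite /gap_size /chain_size !mulr_sumr -big_split -big_split /=; apply: ler_sum => j _.
rewrite big_ord_recl !chain_state0 mulmxBr lerD2l !mulr_sumr -big_split; apply: ler_sum => k _.
rewrite /= /bump leq0n add1n !chain_stateS -mulmxBr V_msk.
set y := ch j k t; set z := ct j k t.
have ys : supp j k y by exact: chain_state_msk.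
have zs : supp j k z by exact: chain_state_msk.
have -> : clh (reach j k) *m y - cl (reach j k) *m z =
    clh (reach j k) *m (y - z) - (cl (reach j k) - clh (reach j k)) *m z.
  by rewrite mulmxBr mulmxBl opprB addrA subrK.
apply: le_trans (qnormB _ _ (psd_V _ _)) _; apply: lerD.
  by apply: V_contract; rewrite mulmxBr ys zs.
apply: le_trans (V_le _ _ _) _; rewrite [2 * eps * h]mulrC -mulrA.
by rewrite ler_wpM2l ?sqrtr_ge0 // gap_le.
Qed.

(** The square root of the cost, as a seminorm of the pair of state and input, so
    that the triangle inequality applies to both at once. *)
Definition cost_norm (x : 'cV[R]_n) (u : 'cV[R]_m) : R :=
  qnorm (block_mx Q 0 0 Rc) (col_mx x u).

Lemma quad_block x u : quad (block_mx Q 0 0 Rc) (col_mx x u) = quad Q x + quad Rc u.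
Proof.
rewrite /quad tr_col_mx mul_row_block !mulmx0 addr0 add0r mul_row_col mxE //.
Qed.

Lemma psd_block : psd (block_mx Q 0 0 Rc).
Proof.
split=> [|x]; first by rewrite tr_block_mx !linear0 Q_psd.1 Rc_pd.1.
by rewrite -[x]vsubmxK quad_block addr_ge0 ?Q_psd.2 // (pd_psd Rc_pd).2.
Qed.

Lemma sqr_cost_norm x u : cost_norm x u ^+ 2 = quad Q x + quad Rc u.
Proof. by rewrite sqr_qnorm ?quad_block //; exact: psd_block. Qed.

Lemma cost_normD x y u z : cost_norm (x + y) (u + z) <= cost_norm x u + cost_norm y z.
Proof. by rewrite /cost_norm -add_col_mx qnormD //; exact: psd_block. Qed.

Lemma cost_norm0 : cost_norm 0 0 = 0.
Proof. by rewrite /cost_norm col_mx0 qnorm0. Qed.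

Lemma cost_norm_chains (f : 'I_p -> nat -> 'cV[R]_n) t :
  (forall j k, supp j k (f j k)) ->
  cost_norm (\sum_j \sum_(k < t) f j k) (\sum_j \sum_(k < t) F (reach j k) *m f j k) <=
  \sum_j \sum_(k < t) N j k (f j k).
Proof.
have cs (I : finType) (x : I -> 'cV[R]_n) (u : I -> 'cV[R]_m) :
    cost_norm (\sum_i x i) (\sum_i u i) <= \sum_i cost_norm (x i) (u i).
  elim/big_rec3: _ => [|i c y z _ H]; first by rewrite cost_norm0.
  by apply: le_trans (cost_normD _ _ _ _) _; rewrite lerD2l.
move=> fs; apply: le_trans (cs _ _ _) _; apply: ler_sum => j _.
apply: le_trans (cs _ _ _) _; apply: ler_sum => k _.
by rewrite /cost_norm ler_wsqrtr // quad_block cost_le_V.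
Qed.

End Gap.

Section Run.
Variables (kappa gamma : R).
Hypothesis kappa_ge1 : 1 <= kappa.
Hypothesis gamma_bounds : 0 <= gamma < 1.
Hypothesis A_decay : forall k x, enorm (A ^+ k *m x) <= kappa * gamma ^+ k * enorm x.
Variable (nbr : 'I_p -> {set 'I_p}).
Hypothesis nbr_dist : forall i j, j \in nbr i -> dist_le arc delay i j 1.
Hypothesis A_nbr : forall i j, j \notin nbr i -> subm [set i]%SET [set j]%SET A = 0.
Hypothesis B_nbr : forall i j, j \notin nbr i -> subm [set i]%SET [set j]%SET B = 0.
Variable w : nat -> 'cV[R]_n.

Lemma plant_step Ab Bb v t :
  A *m total_state arc delay Kh Ab Bb v t + B *m total_input arc delay Kh Ab Bb v t =
  \sum_j \sum_(k < t) msk R n_ (reach j k.+1) *m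
     (cl (reach j k) *m chain_state arc delay Kh Ab Bb v j k t).
Proof.
rewrite !mulmx_sumr -big_split; apply: eq_bigr => j _ /=.
rewrite !mulmx_sumr -big_split; apply: eq_bigr => k _ /=.
rewrite (closed_loop_reach G _ nbr_dist) // ?chain_state_msk //.
by rewrite /closed_loop mulmxDl mulmxA.
Qed.

Section Tilde.
Variables (xt : nat -> 'cV[R]_n) (ut : nat -> 'cV[R]_m).
Variable zt : nat -> forall s : {set 'I_p}, 'cV[R]_#|coords n_ s|.
Hypothesis run : tilde_policy arc delay A B Kh w xt ut zt.

Lemma tilde_input t : ut t = total_input arc delay Kh A B w t.
Proof.
have [_ law z0 zS] := run.
apply: (input_chains G (vj := fun t i => subv [set i]%SET (w t)) _ z0 zS law) => t'.
rewrite {1}[w t']sum_sel_msk; apply: eq_bigr => j _.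
by rewrite subvE mulmxA.
Qed.

Lemma tilde_state t : xt t = total_state arc delay Kh A B w t.
Proof.
have [[x0 xS] _ _ _] := run; elim: t => [|t IH]; first by rewrite x0 total_state0.
by rewrite xS IH tilde_input plant_step total_stateS addrC.
Qed.

End Tilde.

Section Hat.
Variables (xh : nat -> 'cV[R]_n) (uh : nat -> 'cV[R]_m).
Variable zh : nat -> forall s : {set 'I_p}, 'cV[R]_#|coords n_ s|.
Hypothesis run : hat_policy arc delay nbr A B Ah Bh Kh w xh uh zh.

Definition estimated_noise t : 'cV[R]_n :=
  \sum_j (sel R n_ [set j]%SET)^T *m noise_estimate nbr Ah Bh xh uh t j.

Notation wh := estimated_noise.

(** Row block j of the true matrices meets only the neighbours of j, so the true
    and the estimated one-step predictions use the same coordinates. *)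
Lemma noise_block j t : msk R n_ [set j]%SET *m (wh t - w t) =
  - (msk R n_ [set j]%SET *m ((Ah - A) *m (msk R n_ (nbr j) *m xh t) +
                          (Bh - B) *m (msk R m_ (nbr j) *m uh t))).
Proof.
have [[_ xS] _ _ _] := run.
rewrite mulmxBr (msk_v (vj := noise_estimate nbr Ah Bh xh uh)) //.
have -> : noise_estimate nbr Ah Bh xh uh t j = sel R n_ [set j]%SET *m
    (xh t.+1 - (Ah *m (msk R n_ (nbr j) *m xh t) + Bh *m (msk R m_ (nbr j) *m uh t))).
  rewrite /noise_estimate subvE mulmxBr; congr (_ - _).
  rewrite mulmxDr -(sum_msk R n_ (nbr j)) -(sum_msk R m_ (nbr j)).
  rewrite !mulmx_suml !mulmx_sumr -big_split /=; apply: eq_bigr => l _.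
  by rewrite !submE !subvE !mulmxA.
rewrite mulmxA -/(msk R n_ [set j]%SET) xS.
have sp (e : 'I_p -> nat) (M : 'M[R]_(n, \sum_(i < p) e i)) (y : 'cV[R]_(\sum_(i < p) e i)) :
    (forall i j, j \notin nbr i -> subm [set i]%SET [set j]%SET M = 0) ->
    msk R n_ [set j]%SET *m (M *m y) = msk R n_ [set j]%SET *m (M *m (msk R e (nbr j) *m y)).
  by move=> H; rewrite !mulmxA -[in LHS](sparse_row H) !mulmxA.
rewrite !mulmxBl !(mulmxBr, mulmxDr) (sp _ _ _ A_nbr) (sp _ _ _ B_nbr).
by rewrite [LHS]addrAC addrK opprD [in RHS]opprD !opprB addrACA.
Qed.

(** Each of the p blocks errs by at most eps times the norms of the full state and
    input, whence the factor sqrt p. *)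
Lemma noise_error t : enorm (wh t - w t) <= eps * r * (enorm (xh t) + enorm (uh t)).
Proof.
rewrite -mulrA mulrC -mulrA; set c := _ * eps.
have c0 : 0 <= c by rewrite mulr_ge0 // addr_ge0 // enorm_ge0.
apply: ler_of_sqr; first by rewrite mulr_ge0 ?sqrtr_ge0.
rewrite sqr_enorm -quad1_sum_msk exprMn sqr_sqrtr //.
apply: le_trans (_ : \sum_(j < p) c ^+ 2 <= _); last first.
  by rewrite sumr_const card_ord mulr_natl.
apply: ler_sum => j _; rewrite -sqr_enorm ler_pXn2r // ?nnegrE ?enorm_ge0 //.
rewrite noise_block enormN; apply: le_trans (enorm_msk _ _) _.
apply: le_trans (enormD _ _) _; rewrite /c mulrC mulrDr; apply: lerD.
  by apply: le_trans (A_le _) _; rewrite ler_wpM2l // enorm_msk.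
by apply: le_trans (B_le _) _; rewrite ler_wpM2l // enorm_msk.
Qed.

Lemma hat_input t : uh t = total_input arc delay Kh Ah Bh wh t.
Proof.
by have [_ law z0 zS] := run; exact: (input_chains G _ z0 zS law).
Qed.

Definition drift t : 'cV[R]_n := xh t - total_state arc delay Kh Ah Bh wh t.

Definition drift_input t : 'cV[R]_n := (w t - wh t) +
  \sum_j \sum_(k < t) msk R n_ (reach j k.+1) *m
     ((cl (reach j k) - clh (reach j k)) *m chain_state arc delay Kh Ah Bh wh j k t).

(** The state is driven by the true dynamics, so what separates it from the sum
    of the chains is filtered by the stable matrix A. *)
Lemma driftS t : drift t.+1 = A *m drift t + drift_input t.
Proof.
have [[_ xS] _ _ _] := run; rewrite /drift /drift_input xS total_stateS mulmxBr.
have -> : \sum_j \sum_(k < t) msk R n_ (reach j k.+1) *m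
     ((cl (reach j k) - clh (reach j k)) *m chain_state arc delay Kh Ah Bh wh j k t) =
   A *m total_state arc delay Kh Ah Bh wh t + B *m uh t -
   \sum_j \sum_(k < t) msk R n_ (reach j k.+1) *m
     (clh (reach j k) *m chain_state arc delay Kh Ah Bh wh j k t).
  rewrite hat_input plant_step -sumrB; apply: eq_bigr => j _; rewrite -sumrB.
  by apply: eq_bigr => k _; rewrite mulmxBl mulmxBr.
have regroup (a b c d e f : 'cV[R]_n) : a + b + e - (f + d) = a - c + (e - f + (c + b - d)).
  by apply/matrixP => i j; rewrite !mxE; ring.
exact: regroup.
Qed.

Lemma drift_input_le t : enorm (drift_input t) <=
  enorm (wh t - w t) + 2 * eps * chain_size Ah Bh wh t.
Proof.
apply: le_trans (enormD _ _) _; rewrite -enormN opprB; apply: lerD => //.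
apply: le_trans (enorm_sum _ _ _) _; rewrite /chain_size mulr_sumr; apply: ler_sum => j _.
apply: le_trans (enorm_sum _ _ _) _; rewrite mulr_sumr; apply: ler_sum => k _.
by apply: le_trans (enorm_msk _ _) _; apply: gap_le; exact: chain_state_msk.
Qed.

Lemma driftE t : drift t = \sum_(k < t) A ^+ k *m drift_input (t - k.+1).
Proof.
have [[x0 _] _ _ _] := run.
elim: t => [|t IH]; first by rewrite /drift x0 total_state0 subr0 [RHS]big_ord0.
rewrite driftS IH [RHS]big_ord_recl subSS subn0 expr0 mul1mx addrC; congr (_ + _).
rewrite mulmx_sumr; apply: eq_bigr => k _.
by rewrite /= /bump leq0n add1n subSS exprS -mulmxA.
Qed.

Definition filtered_drift t : R :=
  \sum_(k < t) gamma ^+ k * enorm (drift_input (t - k.+1)).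

Lemma drift_le t : enorm (drift t) <= kappa * filtered_drift t.
Proof.
rewrite driftE mulr_sumr; apply: le_trans (enorm_sum _ _ _) _.
by apply: ler_sum => k _; rewrite mulrA.
Qed.

Lemma filtered_driftS t :
  filtered_drift t.+1 = gamma * filtered_drift t + enorm (drift_input t).
Proof.
rewrite /filtered_drift big_ord_recl expr0 mul1r subSS subn0 addrC; congr (_ + _).
rewrite mulr_sumr; apply: eq_bigr => k _.
by rewrite /= /bump leq0n add1n subSS exprS mulrA.
Qed.

Lemma filtered_drift_ge0 t : 0 <= filtered_drift t.
Proof.
apply: sumr_ge0 => k _; rewrite mulr_ge0 ?enorm_ge0 // exprn_ge0 //.
by case/andP: gamma_bounds.
Qed.

End Hat.

Variables (xh xt : nat -> 'cV[R]_n) (uh ut : nat -> 'cV[R]_m).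
Variables zh zt : nat -> forall s : {set 'I_p}, 'cV[R]_#|coords n_ s|.
Hypothesis hat_run : hat_policy arc delay nbr A B Ah Bh Kh w xh uh zh.
Hypothesis tilde_run : tilde_policy arc delay A B Kh w xt ut zt.
Hypothesis p_gt0 : (0 < p)%N.

Notation wh := (estimated_noise xh uh).

Lemma cost_gap t : cost_norm (xh t - xt t) (uh t - ut t) <=
  gap_size wh w t + h * r * enorm (drift xh uh t).
Proof.
have -> : xh t - xt t =
    \sum_j \sum_(k < t) (chain_state arc delay Kh Ah Bh wh j k t -
                          chain_state arc delay Kh A B w j k t) + drift xh uh t.
  rewrite (tilde_state tilde_run) /drift.
  under [X in _ = X + _]eq_bigr do rewrite sumrB.
  by rewrite sumrB [RHS]addrC addrA subrK.
have -> : uh t - ut t =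
    \sum_j \sum_(k < t) F (reach j k) *m (chain_state arc delay Kh Ah Bh wh j k t -
                          chain_state arc delay Kh A B w j k t) + 0.
  rewrite (hat_input hat_run) (tilde_input tilde_run) addr0 -sumrB; apply: eq_bigr => j _.
  by rewrite -sumrB; apply: eq_bigr => k _; rewrite mulmxBr.
apply: le_trans (cost_normD _ _ _ _) _; apply: lerD.
  apply: (cost_norm_chains (f := fun j k => chain_state arc delay Kh Ah Bh wh j k t -
    chain_state arc delay Kh A B w j k t)) => j k.
  by rewrite mulmxBr !chain_state_msk.
by rewrite /cost_norm /qnorm quad_block quad0 addr0; exact: qnormQ_le.
Qed.

Lemma tilde_cost_le t : cost_norm (xt t) (ut t) <= chain_size A B w t.
Proof.
rewrite (tilde_state tilde_run) (tilde_input tilde_run).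
apply: (cost_norm_chains (f := fun j k => chain_state arc delay Kh A B w j k t)) => j k.
exact: chain_state_msk.
Qed.

Hypothesis eps_small : kappa / (1 - gamma) * eps * r ^+ 2 * g ^+ 6 <= 768^-1.

Lemma sqr_h : h ^+ 2 = g.
Proof. by rewrite sqr_sqrtr // (le_trans _ g_ge1). Qed.

Lemma h_ge1 : 1 <= h.
Proof. by rewrite -sqrtr1 ler_wsqrtr. Qed.

Lemma r_ge1 : 1 <= r.
Proof. by rewrite -sqrtr1 ler_wsqrtr // ler1n. Qed.

Lemma X_ge1 : 1 <= kappa / (1 - gamma).
Proof.
case/andP: gamma_bounds => g0 g1; rewrite ler_pdivlMr ?subr_gt0 // mul1r.
by apply: le_trans kappa_ge1; rewrite lerBlDr lerDl.
Qed.

Lemma eps_hg_small : 8 * (eps * h * g) <= 1.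
Proof.
have g0 : 0 <= g by apply: le_trans g_ge1.
have h0 := le_trans ler01 h_ge1.
have hg : h <= g by rewrite -sqr_h expr2 ler_peMl // h_ge1.
have : eps * h * g <= 768^-1.
  apply: le_trans eps_small; apply: le_trans (_ : eps * g ^+ 6 <= _).
    rewrite -mulrA ler_wpM2l // (_ : g ^+ 6 = g * g * g ^+ 4); last by ring.
    by rewrite -[leLHS]mulr1; apply: ler_pM; rewrite ?mulr_ge0 ?exprn_ege1 // ler_wpM2r.
  rewrite ler_wpM2r ?exprn_ge0 // [leRHS]mulrAC -[leLHS]mul1r ler_wpM2r //.
  by rewrite mulr_ege1 ?X_ge1 // exprn_ege1 // r_ge1.
lra.
Qed.

Section Bounds.
Variable T : nat.
Let W := l2 T (fun t => enorm (w t)).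
Let v := l2 T (fun t => enorm (wh t - w t)).
Let a := l2 T (chain_size Ah Bh wh).
Let st := l2 T (chain_size A B w).
Let sd := l2 T (gap_size wh w).
Let E := l2 T (fun t => enorm (drift xh uh t)).

Lemma hr_ge0 : 0 <= h * r.
Proof. by rewrite mulr_ge0 ?sqrtr_ge0. Qed.

Lemma g2_gt0 : 0 < 2 * g.
Proof. by have := g_ge1; lra. Qed.

Lemma energy_hat : a <= 2 * g * (h * r * (W + v)).
Proof.
have := l2_filter T th_bounds (chain_size0 _ _ _) (chain_size_ge0 _ _ _) (hat_size_step wh).
rewrite /th subKr (l2Z _ _ hr_ge0) ler_pdivrMl ?g2_gt0 // => /le_trans; apply.
rewrite ler_wpM2l ?(ltW g2_gt0) // ler_wpM2l ?hr_ge0 //.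
apply: le_trans (l2D _ _ _); apply: l2_le => t; first exact: enorm_ge0.
by rewrite -{1}[wh t](subrKC (w t)) enormD.
Qed.

(** The perturbed rate th + 2 eps h is still at most 1 - 1 / (4 g). *)
Lemma energy_tilde : st <= 4 * g * (h * r * W).
Proof.
have g0 : 0 < g by apply: lt_le_trans g_ge1.
have th' : 0 <= 1 - (4 * g)^-1 < 1.
  rewrite subr_ge0 invf_le1 ?mulr_gt0 // ltrBlDr ltrDl invr_gt0 mulr_gt0 // andbT.
  by have := g_ge1; lra.
have le_th : th + 2 * eps * h <= 1 - (4 * g)^-1.
  rewrite -subr_ge0.
  have -> : 1 - (4 * g)^-1 - (th + 2 * eps * h) = (1 - 8 * (eps * h * g)) / (4 * g).
    by rewrite /th; field; rewrite gt_eqF.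
  by rewrite divr_ge0 ?subr_ge0 ?eps_hg_small // mulr_ge0 // ltW.
have := l2_filter T th' (chain_size0 _ _ _) (chain_size_ge0 _ _ _)
  (fun t => le_trans (tilde_size_step w t)
     (lerD (ler_wpM2r (chain_size_ge0 _ _ _ t) le_th) (lexx _))).
by rewrite subKr (l2Z _ _ hr_ge0) ler_pdivrMl ?mulr_gt0.
Qed.

(** Valid for every noise sequence, in particular for impulses. *)
Lemma chains_energy :
  \sum_(t < T) (quad Q (total_state arc delay Kh A B w t) +
                quad Rc (total_input arc delay Kh A B w t)) <=
  (4 * g * (h * r)) ^+ 2 * \sum_(t < T) quad 1%:M (w t).
Proof.
have -> : \sum_(t < T) quad 1%:M (w t) = W ^+ 2.
  by rewrite sqr_l2; apply: eq_bigr => t _; rewrite sqr_enorm.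
rewrite -exprMn -[_ * W]mulrA.
apply: le_trans (_ : st ^+ 2 <= _); last first.
  rewrite ler_pXn2r // ?nnegrE ?l2_ge0 ?energy_tilde //.
  exact: le_trans (l2_ge0 _ _) energy_tilde.
rewrite sqr_l2; apply: ler_sum => t _; rewrite -sqr_cost_norm.
rewrite ler_pXn2r // ?nnegrE ?qnorm_ge0 ?chain_size_ge0 //.
apply: (cost_norm_chains (f := fun j k => chain_state arc delay Kh A B w j k t)) => j k.
exact: chain_state_msk.
Qed.

Lemma energy_gap : sd <= 2 * g * (2 * eps * h * st + h * r * v).
Proof.
have := l2_filter T th_bounds (gap_size0 _ _) (gap_size_ge0 _ _) (gap_size_step wh w).
rewrite /th subKr ler_pdivrMl ?g2_gt0 // => /le_trans; apply.
rewrite ler_wpM2l ?(ltW g2_gt0) //; apply: le_trans (l2D _ _ _) _.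
by rewrite !l2Z ?hr_ge0 // mulr_ge0 ?sqrtr_ge0 // mulr_ge0.
Qed.

Lemma energy_noise : v <= eps * r * (2 * a + E).
Proof.
have er0 : 0 <= eps * r by rewrite mulr_ge0 ?sqrtr_ge0.
apply: le_trans (_ : eps * r * l2 T (fun t => 2 * chain_size Ah Bh wh t +
   enorm (drift xh uh t)) <= _).
  rewrite -l2Z //; apply: l2_le => t; first exact: enorm_ge0.
  apply: le_trans (noise_error hat_run t) _; rewrite ler_wpM2l //.
  have -> : enorm (xh t) = enorm (total_state arc delay Kh Ah Bh wh t + drift xh uh t).
    by rewrite /drift subrKC.
  have := enormD (total_state arc delay Kh Ah Bh wh t) (drift xh uh t).
  have := total_state_le Ah Bh wh t; have := total_input_le Ah Bh wh t.
  rewrite -(hat_input hat_run); lra.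
by rewrite ler_wpM2l //; apply: le_trans (l2D _ _ _) _; rewrite l2Z.
Qed.

Lemma energy_drift : E <= kappa / (1 - gamma) * (v + 2 * eps * a).
Proof.
have /andP[gm0 gm1] := gamma_bounds; have k0 := le_trans ler01 kappa_ge1.
have d0 : 0 < 1 - gamma by rewrite subr_gt0.
apply: le_trans (_ : kappa * l2 T (filtered_drift xh uh) <= _).
  by rewrite -l2Z //; apply: l2_le => t; [exact: enorm_ge0|exact: (drift_le hat_run)].
have F0 : filtered_drift xh uh 0 = 0 by rewrite /filtered_drift big_ord0.
have Fle t : filtered_drift xh uh t.+1 <=
    gamma * filtered_drift xh uh t + enorm (drift_input xh uh t) by rewrite filtered_driftS.
have := l2_filter T gamma_bounds F0 (filtered_drift_ge0 _ _) Fle => H.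
rewrite -mulrA ler_wpM2l // ler_pdivlMl //; apply: le_trans H _.
apply: le_trans (_ : l2 T (fun t => enorm (wh t - w t) + 2 * eps * chain_size Ah Bh wh t) <= _).
  by apply: l2_le => t; [exact: enorm_ge0|exact: drift_input_le].
by apply: le_trans (l2D _ _ _) _; rewrite l2Z // mulr_ge0.
Qed.

(** In the seminorm [cost_norm] the learned trajectory is the comparison trajectory
    plus a gap; the cross term is bounded by Cauchy-Schwarz over time. *)
Lemma pathwise_cost :
  \sum_(t < T) (quad Q (xh t) + quad Rc (uh t)) <=
  \sum_(t < T) (quad Q (xt t) + quad Rc (ut t)) +
    396 * (kappa / (1 - gamma) * p%:R ^+ 2 * g ^+ 5 * eps) * \sum_(t < T) quad 1%:M (w t).
Proof.
pose D t := cost_norm (xh t - xt t) (uh t - ut t).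
pose N' t := cost_norm (xt t) (ut t).
have D0 t : 0 <= D t by exact: qnorm_ge0.
have N0 t : 0 <= N' t by exact: qnorm_ge0.
have hr0 := hr_ge0.
have sE : 0 <= sd + h * r * E by rewrite addr_ge0 ?(mulr_ge0 hr0) ?l2_ge0.
have lD : l2 T D <= sd + h * r * E.
  rewrite /E -l2Z //; apply: le_trans (l2D _ _ _); apply: l2_le => // t; exact: cost_gap.
have lN : l2 T N' <= st by apply: l2_le => // t; exact: tilde_cost_le.
have step t : quad Q (xh t) + quad Rc (uh t) <=
    quad Q (xt t) + quad Rc (ut t) + (D t ^+ 2 + 2 * (D t * N' t)).
  rewrite -!sqr_cost_norm -/(N' t).
  have H : cost_norm (xh t) (uh t) <= N' t + D t.
    have := cost_normD (xt t) (xh t - xt t) (ut t) (uh t - ut t).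
    by rewrite !subrKC.
  have H0 : 0 <= cost_norm (xh t) (uh t) by exact: qnorm_ge0.
  apply: le_trans (_ : (N' t + D t) ^+ 2 <= _).
    by rewrite ler_pXn2r // nnegrE // addr_ge0.
  by rewrite le_eqVlt; apply/orP; left; apply/eqP; ring.
have : \sum_(t < T) (quad Q (xh t) + quad Rc (uh t)) <= \sum_(t < T)
    (quad Q (xt t) + quad Rc (ut t) + (D t ^+ 2 + 2 * (D t * N' t))).
  by apply: ler_sum => t _; exact: step.
move=> /le_trans; apply.
rewrite big_split /= lerD2l big_split /= -mulr_sumr -sqr_l2.
have eps_small' : kappa / (1 - gamma) * eps * r ^+ 2 * (h ^+ 2) ^+ 6 <= 768^-1.
  by rewrite sqr_h.
have := small_gain r_ge1 h_ge1 X_ge1 eps_ge0 (l2_ge0 T _) (l2_ge0 T _) (l2_ge0 T _)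
  (l2_ge0 T _) (l2_ge0 T _) (l2_ge0 T _) eps_small'.
rewrite !sqr_h.
move=> /(_ _ _ _ _ _ _ energy_hat energy_drift energy_noise energy_tilde energy_gap).
have -> : W ^+ 2 = \sum_(t < T) quad 1%:M (w t).
  by rewrite sqr_l2; apply: eq_bigr => t _; exact: sqr_enorm.
have -> : r ^+ 4 = p%:R ^+ 2 by rewrite -[4%N]/(2 * 2)%N exprM sqr_sqrtr.
apply: le_trans; apply: lerD; first by rewrite ler_pXn2r // nnegrE ?l2_ge0.
rewrite ler_pM2l //; apply: le_trans (l2_CS _ _ _) _.
by apply: ler_pM; rewrite ?l2_ge0.
Qed.

End Bounds.
End Run.
End Pathwise.

(** * Moments of the normal law *)

Section NormalMoments.
Variables (R : realType) (s : R).
Hypothesis s_gt0 : 0 < s.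
Notation mu := (@lebesgue_measure R).
Notation nu := (normal_prob 0 s).
Notation pdf := (normal_pdf 0 s).

(** The law has density pdf with respect to Lebesgue measure; for integrands beyond
    indicators this is a change of variables for the Radon-Nikodym derivative. *)
Lemma integral_normal_prob f D : measurable D ->
  nu.-integrable D f ->
  (\int[nu]_(x in D) f x = \int[mu]_(x in D) (f x * (pdf x)%:E))%E.
Proof.
move=> mD fi; have dom := normal_prob_dominates (0 : R) s.
rewrite -(Radon_Nikodym_change_of_variables dom mD fi).
have mf : measurable_fun D f by exact: measurable_int fi.
apply: ae_eq_integral => //.
- apply: emeasurable_funM => //; apply: (measurable_int mu).
  apply: (integrableS _ _ (@subsetT _ _)) => //=.
  by apply: Radon_Nikodym_integrable; exact: dom.
- apply: emeasurable_funM => //; apply/measurable_EFinP/measurable_funTS.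
  exact: measurable_normal_pdf.
- apply: ae_eqe_mul2l => /=; rewrite Radon_NikodymE//=.
  case: cid => /= h [h1 h2 h3]; apply: integral_ae_eq => //=.
  + exact: integrableS h2.
  + by apply/measurable_EFinP/measurable_funTS; exact: measurable_normal_pdf.
  + by move=> E ED mE; rewrite -h3.
Qed.

Lemma pdfE x : pdf x = normal_peak s * expR (- x ^+ 2 / (s ^+ 2 *+ 2)).
Proof. by rewrite normal_pdfE ?gt_eqF // /normal_fun subr0. Qed.

Lemma is_derive_pdf (x : R) : is_derive x (1 : R) (pdf : R -> R) (- (x / s ^+ 2) * pdf x).
Proof.
have -> : pdf = fun x => normal_peak s * expR (- x ^+ 2 / (s ^+ 2 *+ 2)).
  by apply/funext => y; rewrite pdfE.
apply: is_derive_eq; rewrite /= /GRing.scale /= -(mulr_natr (s ^+ 2)).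
by field; rewrite gt_eqF.
Qed.

Lemma integral_derive (F f : R -> R) a : 0 < a ->
  (forall x : R, is_derive x (1 : R) F (f x)) -> continuous f ->
  (\int[mu]_(x in `[(- a)%R, a]) (f x)%:E = (F a - F (- a)%R)%:E)%E.
Proof.
move=> a0 dF cf; have cF x : F y @[y --> x] --> F x.
  apply: differentiable_continuous; apply/derivable1_diffP.
  by have [] := dF x.
rewrite EFinB; apply: continuous_FTC2.
- by rewrite gtrN.
- exact: continuous_subspaceT.
- split=> [x _| |]; first by have [] := dF x.
    exact: cvg_at_right_filter.
  exact: cvg_at_left_filter.
- by move=> x _; rewrite derive1E; exact: derive_val.
Qed.

Lemma continuous_pdf : continuous (pdf : R -> R).
Proof. by apply: continuous_normal_pdf; rewrite gt_eqF. Qed.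

Lemma integrable_itv (f : R -> R) a : continuous f -> nu.-integrable `[(- a)%R, a] (EFin \o f).
Proof.
move=> cf; apply: measurable_bounded_integrable => //.
- by apply: le_lt_trans (probability_le1 _ _) _ => //; rewrite ltry.
- by apply: measurable_funTS; exact: continuous_measurable_fun.
- have c : {within `[(- a)%R, a], continuous f} by exact: continuous_subspaceT.
  have /compact_bounded[M [_ mrt]] := continuous_compact c (@segment_compact _ _ _).
  by exists M; split; rewrite ?num_real // => ? ? ? ?; exact: mrt.
Qed.

(** x pdf x is the derivative of - s^2 pdf, an even function. *)
Lemma truncated_mean a : 0 < a -> (\int[nu]_(x in `[(- a)%R, a]) x%:E = 0)%E.
Proof.
move=> a0; rewrite integral_normal_prob //; last by apply: (integrable_itv (f := id)) => x; exact: cvg_id.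
have d x : is_derive x (1 : R) (fun x => - s ^+ 2 * pdf x) (x * pdf x).
  have dp := is_derive_pdf x; apply: is_derive_eq.
  by rewrite /= /GRing.scale /=; field; rewrite gt_eqF.
under eq_integral do rewrite -EFinM.
rewrite (integral_derive a0 d).
  by rewrite !pdfE sqrrN subrr.
by move=> x; apply: cvgM; [exact: cvg_id|exact: continuous_pdf].
Qed.

(** (s^2 - x^2) pdf x is the derivative of s^2 x pdf x, which is odd and positive
    at a, so the integral of s^2 - x^2 is nonnegative. *)
Lemma truncated_second_moment a : 0 < a ->
  (\int[nu]_(x in `[(- a)%R, a]) (x ^+ 2)%:E <= (s ^+ 2)%:E)%E.
Proof.
move=> a0.
have c2 : continuous (fun x : R => x ^+ 2) by exact: exprn_continuous.
have cc : continuous (fun x : R => s ^+ 2) by move=> x; exact: cvg_cst.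
have cd : continuous (fun x : R => s ^+ 2 - x ^+ 2).
  by move=> x; apply: cvgB; [exact: cvg_cst|exact: c2].
have H : (0 <= \int[nu]_(x in `[(- a)%R, a]) (s ^+ 2 - x ^+ 2)%:E)%E.
  rewrite integral_normal_prob //; last exact: (integrable_itv _ cd).
  have d x : is_derive x (1 : R) (fun x => s ^+ 2 * (x * pdf x)) ((s ^+ 2 - x ^+ 2) * pdf x).
    have dp := is_derive_pdf x; apply: is_derive_eq.
    by rewrite /= /GRing.scale /=; field; rewrite gt_eqF.
  under eq_integral do rewrite -EFinM.
  rewrite (integral_derive a0 d).
    rewrite lee_fin !pdfE sqrrN; set e := _ * expR _.
    have e0 : 0 <= e by rewrite mulr_ge0 ?normal_peak_ge0 ?expR_ge0.
    have h1 : 0 <= s ^+ 2 * (a * e) by rewrite mulr_ge0 ?sqr_ge0 // mulr_ge0 // ltW.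
    by rewrite mulNr mulrN opprK addr_ge0.
  by move=> x; apply: cvgM; [exact: cd|exact: continuous_pdf].
move: H; under eq_integral do rewrite EFinB.
rewrite integralB //; last 2 first.
- exact: (integrable_itv _ cc).
- exact: (integrable_itv _ c2).
rewrite sube_ge0; last first.
  apply/orP; left; apply: integrable_fin_num => //.
  exact: (integrable_itv _ c2).
move=> /le_trans; apply; rewrite integral_cst //.
rewrite -[leRHS]mule1; apply: lee_wpmul2l; first by rewrite lee_fin sqr_ge0.
exact: probability_le1.
Qed.

Lemma second_moment_le : (\int[nu]_x (x ^+ 2)%:E <= (s ^+ 2)%:E)%E.
Proof.
pose D (n : nat) : set R := [set` `[(- n.+1%:R)%R, n.+1%:R]].
have DT : \bigcup_n D n = setT.
  rewrite -subTset => x _; exists (Num.truncn `|x|) => //=.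
  by rewrite /D /= in_itv /= -ler_norml ltW // truncnS_gt.
rewrite -DT.
have nD : nondecreasing_seq D.
  move=> i j ij; apply/subsetPset => x; rewrite /D /= !in_itv /= => /andP[h1 h2].
  have h : i.+1%:R <= j.+1%:R :> R by rewrite ler_nat.
  by rewrite (le_trans _ h1) ?lerN2 // (le_trans h2).
have mD i : measurable (D i) by exact: measurable_itv.
have mf i : measurable_fun (D i) (fun x : R => (x ^+ 2)%:E).
  apply/measurable_EFinP/measurable_funTS; exact: continuous_measurable_fun (@exprn_continuous _ 2).
have f0 i x : D i x -> (0 <= (x ^+ 2)%:E)%E by rewrite lee_fin sqr_ge0.
have := ge0_nondecreasing_set_cvg_integral (mu := nu) nD mD mf f0.
apply: cvge_le; apply: nearW => n; exact: truncated_second_moment.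
Qed.

Lemma integrable_sqr : nu.-integrable setT (fun x => (x ^+ 2)%:E).
Proof.
apply/integrableP; split.
  apply/measurable_EFinP; exact: continuous_measurable_fun (@exprn_continuous _ 2).
under eq_integral do rewrite /= ger0_norm ?sqr_ge0 //.
by apply: le_lt_trans second_moment_le _; rewrite ltry.
Qed.

Lemma integrable_id : nu.-integrable setT (fun x => x%:E).
Proof.
have i1 : nu.-integrable setT (fun x => (1 + x ^+ 2)%:E).
  under eq_fun do rewrite EFinD; apply: integrableD => //; last exact: integrable_sqr.
  exact: finite_measure_integrable_cst.
apply: (le_integrable measurableT _ _ i1).
  exact/measurable_EFinP.
move=> x _; rewrite lee_fin [leRHS]ger0_norm ?addr_ge0 ?sqr_ge0 //.
apply: ler_of_sqr; first by rewrite addr_ge0 ?sqr_ge0.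
by rewrite real_normK ?num_real //; have := sqr_ge0 x; nra.
Qed.

Lemma mean0 : (\int[nu]_x x%:E = 0)%E.
Proof.
pose D (n : nat) : set R := [set` `[(- n.+1%:R)%R, n.+1%:R]].
pose f_ n := (fun x : R => x%:E) \_ (D n).
have mD i : measurable (D i) by exact: measurable_itv.
have mfn n : measurable_fun [set: measurableTypeR R] (f_ n).
  rewrite /f_; apply/(measurable_restrictT (fun x : measurableTypeR R => x%:E) (mD n)).
  by apply/measurable_EFinP.
have H : (fun n => \int[nu]_x f_ n x)%E @ \oo --> (\int[nu]_x x%:E)%E.
  have [||||| _ _ //] := @dominated_convergence _ _ R nu setT measurableT f_
    (fun x => x%:E) (fun x => `|x|%:E).
  - exact: mfn.
  - exact/measurable_EFinP.
  - apply: aeW => x _; apply: cvg_near_cst.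
    exists (Num.truncn `|x|) => // n /= xn; rewrite /f_ patchE mem_set //.
    rewrite /D /= in_itv /= -ler_norml ltW // (lt_le_trans (truncnS_gt _)) //.
    by rewrite ler_nat.
  - exact: integrable_norm integrable_id.
  - apply: aeW => x n _; rewrite /f_ patchE; case: ifP => // _.
    by rewrite abse0 lee_fin.
apply: cvg_unique H _ => //; apply: cvg_near_cst; apply: nearW => n.
by rewrite /f_ -integral_mkcond truncated_mean.
Qed.

End NormalMoments.

(** * Second moments of the noise *)

Section NoiseMoments.
Context d (Omega : measurableType d) (R : realType) (Pr : probability Omega R).
Variables (n : nat) (s : R).
Hypothesis s_gt0 : 0 < s.
Variable w : nat -> Omega -> 'cV[R]_n.
Hypothesis w_iid : iid_gaussian_noise Pr s w.
Notation nu := (normal_prob 0 s).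

Lemma measurable_noise t k : measurable_fun [set: Omega] (fun om => w t om k ord0).
Proof. by have [/(_ t)[]] := w_iid. Qed.

Lemma measurable_noiseR t k :
  @measurable_fun _ _ Omega (measurableTypeR R) setT (fun om => w t om k ord0).
Proof. exact: measurable_noise. Qed.

Lemma noise_law t k (b : set (measurableTypeR R)) : measurable b ->
  Pr [set om | b (w t om k ord0)] = nu b.
Proof.
move=> mb; have [/(_ t)[_ box] _] := w_iid.
pose b' j : set (measurableTypeR R) := if j == k then b else setT.
have -> : [set om | b (w t om k ord0)] = [set om | forall j, b' j (w t om j ord0)].
  apply/seteqP; split=> om /= H; last by have := H k; rewrite /b' eqxx.
  by move=> j; rewrite /b'; case: eqP => // ->.
rewrite box => [|j]; last by rewrite /b'; case: ifP.
rewrite (bigD1 k) //= /b' eqxx big1 ?mule1 // => j /negPf ->.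
exact: (probability_setT (normal_prob 0 s)).
Qed.

(** Two coordinates at the same time are independent by the box formula, and at
    different times by mutual independence. *)
Lemma noise_pair_law t k u l (a b : set (measurableTypeR R)) : (t, k) != (u, l) ->
  measurable a -> measurable b ->
  Pr [set om | a (w t om k ord0) /\ b (w u om l ord0)] = (nu a * nu b)%E.
Proof.
move=> neq ma mb; have [box indep] := w_iid.
have [tu|tu] := eqVneq t u.
  move: neq; rewrite tu xpair_eqE eqxx /= => kl.
  pose b' j : set (measurableTypeR R) := if j == k then a else if j == l then b else setT.
  have -> : [set om | a (w u om k ord0) /\ b (w u om l ord0)] =
      [set om | forall j, b' j (w u om j ord0)].
    apply/seteqP; split=> om /=.
      move=> [ak bl] j; rewrite /b'; case: eqP => [->//|_]; by case: eqP => // ->.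
    move=> H; split; first by have := H k; rewrite /b' eqxx.
    by have := H l; rewrite /b' eq_sym (negPf kl) eqxx.
  have [_ ->] := box u; last by move=> j; rewrite /b'; case: ifP => // _; case: ifP.
  rewrite (bigD1 k) //= (bigD1 l) /=; last by rewrite eq_sym.
  rewrite /b' eqxx [l == k]eq_sym (negPf kl) eqxx big1 ?mule1 // => j /andP[/negPf -> /negPf ->].
  exact: (probability_setT (normal_prob 0 s)).
pose E j := if j == t then [set om | a (w t om k ord0)] else [set om | b (w u om l ord0)].
have ut : (u == t) = false by rewrite eq_sym; exact: negPf.
have := indep [:: t; u] E.
rewrite /= inE tu => /(_ isT) H.
have -> : [set om | a (w t om k ord0) /\ b (w u om l ord0)] = \bigcap_(j in [set` [:: t; u]]) E j.
  apply/seteqP; split=> om /=.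
    move=> [ak bl] j; rewrite /= !inE => /orP[] /eqP ->; first by rewrite /E eqxx.
    by rewrite /E ut.
  move=> H'; split; first by have := H' t; rewrite /E /= !inE eqxx => /(_ isT).
  by have := H' u; rewrite /E /= !inE ut eqxx => /(_ isT).
rewrite H => [|j].
  by rewrite !big_cons big_nil mule1 /E eqxx ut !noise_law.
rewrite !inE => /orP[] /eqP ->; rewrite /E ?eqxx ?ut; apply: sub_sigma_algebra.
  by exists k, a.
by exists l, b.
Qed.

Lemma integral_noise t k (f : measurableTypeR R -> \bar R) :
  measurable_fun setT f -> (forall x, 0 <= f x)%E ->
  (\int[Pr]_om f (w t om k ord0) = \int[nu]_x f x)%E.
Proof.
move=> mf f0; have mX := measurable_noiseR t k.
pose X : {mfun Omega >-> measurableTypeR R} :=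
  HB.pack (fun om => w t om k ord0) (isMeasurableFun.Build _ _ _ _ _ mX).
transitivity (\int[pushforward Pr X]_x f x)%E; first by rewrite ge0_integral_pushforward.
by apply: eq_measure_integral => A mA _; exact: noise_law.
Qed.

Definition noise_var : R := fine (\int[nu]_x (x ^+ 2)%:E).

Lemma noise_varE : (\int[nu]_x (x ^+ 2)%:E)%E = noise_var%:E.
Proof. by rewrite fineK // integrable_fin_num //; exact: integrable_sqr. Qed.

Lemma noise_var_le : noise_var <= s ^+ 2.
Proof. by rewrite -lee_fin -noise_varE; exact: second_moment_le. Qed.

Lemma noise_var_ge0 : 0 <= noise_var.
Proof. by apply: fine_ge0; apply: integral_ge0 => x _; rewrite lee_fin sqr_ge0. Qed.

Lemma noise_sqr t k : (\int[Pr]_om (w t om k ord0 ^+ 2)%:E)%E = noise_var%:E.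
Proof.
rewrite -noise_varE (integral_noise t k (f := fun x => (x ^+ 2)%:E)) //.
  apply/measurable_EFinP; exact: continuous_measurable_fun (@exprn_continuous _ 2).
by move=> x; rewrite lee_fin sqr_ge0.
Qed.

Lemma integrable_noise_sqr t k : Pr.-integrable setT (fun om => (w t om k ord0 ^+ 2)%:E).
Proof.
apply/integrableP; split.
  by apply/measurable_EFinP/measurable_funX; exact: measurable_noise.
under eq_integral do rewrite /= ger0_norm ?sqr_ge0 //.
by rewrite noise_sqr ltry.
Qed.

Lemma integrable_noiseM t k u l :
  Pr.-integrable setT (fun om => (w t om k ord0 * w u om l ord0)%:E).
Proof.
have i : Pr.-integrable setT (fun om => (w t om k ord0 ^+ 2 + w u om l ord0 ^+ 2)%:E).
  by under eq_fun do rewrite EFinD; apply: integrableD => //; exact: integrable_noise_sqr.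
apply: (le_integrable measurableT _ _ i).
  by apply/measurable_EFinP/measurable_funM; exact: measurable_noise.
move=> om _; rewrite lee_fin [leRHS]ger0_norm ?addr_ge0 ?sqr_ge0 //.
set x := w t om k ord0; set y := w u om l ord0.
rewrite ler_norml; apply/andP; split.
  by have := sqr_ge0 (x + y); have := sqr_ge0 x; have := sqr_ge0 y; nra.
by have := sqr_ge0 (x - y); have := sqr_ge0 x; have := sqr_ge0 y; nra.
Qed.

(** The joint law of the two coordinates is the product law, so Fubini's theorem
    reduces the integral to the product of the means. *)
Lemma noise_orthogonal t k u l : (t, k) != (u, l) ->
  (\int[Pr]_om (w t om k ord0 * w u om l ord0)%:E)%E = 0%E.
Proof.
move=> neq.
pose XY om : measurableTypeR R * measurableTypeR R := (w t om k ord0, w u om l ord0).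
have mXY : measurable_fun [set: Omega] XY.
  by apply: measurable_fun_pair; exact: measurable_noiseR.
pose f (z : measurableTypeR R * measurableTypeR R) : \bar R := (z.1 * z.2)%:E.
have mf : measurable_fun setT f.
  by apply/measurable_EFinP/measurable_funM; [exact: measurable_fst|exact: measurable_snd].
have fi : Pr.-integrable (XY @^-1` setT) (f \o XY) by rewrite preimage_setT; exact: integrable_noiseM.
pose XYm : {mfun Omega >-> (measurableTypeR R * measurableTypeR R)%type} :=
  HB.pack XY (isMeasurableFun.Build _ _ _ _ _ mXY).
have lawE A : measurable A -> (nu \x nu)%E A = pushforward Pr XYm A.
  move=> mA; apply: (product_measure_unique (m' := pushforward Pr XYm)) => // B C mB mC.
  by rewrite /= -(noise_pair_law neq mB mC).
have pi := integrable_pushforward mXY mf fi measurableT.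
transitivity (\int[pushforward Pr XYm]_z f z)%E.
  by rewrite (integral_pushforward mXY mf fi).
transitivity (\int[(nu \x nu)%E]_z f z)%E.
  by apply: eq_measure_integral => A mA _; exact/esym/lawE.
rewrite -integral12_prod_meas1; last first.
  apply/integrableP; split=> //.
  have /integrableP[_] := pi; apply: le_lt_trans.
  by rewrite le_eqVlt; apply/orP; left; apply/eqP; apply: eq_measure_integral => A mA _; exact: lawE.
rewrite /fubini_F /f /= integral0_eq // => x _.
under eq_integral do rewrite EFinM.
by rewrite integralZl //; [rewrite mean0 // mule0|exact: integrable_id].
Qed.

End NoiseMoments.

(** * Expected quadratic costs of moving averages of the noise *)

Section FiniteExpectation.
Context d (Omega : measurableType d) (R : realType) (Pr : probability Omega R).

Definition has_expectation (f : Omega -> R) (e : R) : Prop :=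
  Pr.-integrable setT (fun om => (f om)%:E) /\ (\int[Pr]_om (f om)%:E)%E = e%:E.

Lemma has_expectation0 : has_expectation (fun=> 0) 0.
Proof. by split; [exact: integrable0|rewrite integral0]. Qed.

Lemma has_expectationD f g a b : has_expectation f a -> has_expectation g b ->
  has_expectation (fun om => f om + g om) (a + b).
Proof.
move=> [fi fa] [gi gb]; split.
  exact: (integrableD measurableT fi gi).
by under eq_integral do rewrite EFinD; rewrite integralD // fa gb.
Qed.

Lemma has_expectationZ f a k : has_expectation f a ->
  has_expectation (fun om => k * f om) (k * a).
Proof.
move=> [fi fa]; split.
  exact: (integrableZl measurableT k fi).
by under eq_integral do rewrite EFinM; rewrite integralZl // fa.
Qed.

Lemma has_expectation_sum I (r : seq I) (P : pred I) (f : I -> Omega -> R) (e : I -> R) :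
  (forall i, P i -> has_expectation (f i) (e i)) ->
  has_expectation (fun om => \sum_(i <- r | P i) f i om) (\sum_(i <- r | P i) e i).
Proof.
move=> H; elim: r => [|i r IH].
  have -> : (fun om => \sum_(i <- [::] | P i) f i om) = fun=> 0.
    by apply/funext => om; rewrite big_nil.
  by rewrite big_nil; exact: has_expectation0.
have -> : (fun om => \sum_(j <- i :: r | P j) f j om) =
    fun om => (if P i then f i om else 0) + \sum_(j <- r | P j) f j om.
  by apply/funext => om; rewrite big_cons; case: ifP => // _; rewrite add0r.
have -> : \sum_(j <- i :: r | P j) e j = (if P i then e i else 0) + \sum_(j <- r | P j) e j.
  by rewrite big_cons; case: ifP => // _; rewrite add0r.
apply: has_expectationD => //; case: ifP => [/H //|_]; exact: has_expectation0.
Qed.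

Lemma has_expectationE f e : has_expectation f e -> ('E_Pr[f] = e%:E)%E.
Proof. by move=> [_ <-]; rewrite unlock. Qed.

Definition measurable_vector n (f : Omega -> 'cV[R]_n) : Prop :=
  forall k, measurable_fun setT (fun om => f om k ord0).

Lemma measurable_vectorD n (f g : Omega -> 'cV[R]_n) : measurable_vector f ->
  measurable_vector g -> measurable_vector (fun om => f om + g om).
Proof.
move=> mf mg k; under eq_fun do rewrite mxE.
by apply: measurable_funD; [exact: mf|exact: mg].
Qed.

Lemma measurable_vectorM n m (M : 'M[R]_(m, n)) (f : Omega -> 'cV[R]_n) :
  measurable_vector f -> measurable_vector (fun om => M *m f om).
Proof.
move=> mf k; under eq_fun do rewrite mxE.
by apply: measurable_sum => j; apply: measurable_funM => //; exact: mf.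
Qed.

Lemma measurable_vectorN n (f : Omega -> 'cV[R]_n) :
  measurable_vector f -> measurable_vector (fun om => - f om).
Proof.
move=> mf; have -> : (fun om => - f om) = fun om => (- 1%:M) *m f om.
  by apply/funext => om; rewrite mulNmx mul1mx.
exact: measurable_vectorM.
Qed.

Lemma measurable_vector_sum n I (r : seq I) (P : pred I) (f : I -> Omega -> 'cV[R]_n) :
  (forall i, P i -> measurable_vector (f i)) ->
  measurable_vector (fun om => \sum_(i <- r | P i) f i om).
Proof.
move=> H; elim: r => [|i r IH].
  have -> : (fun om => \sum_(i <- [::] | P i) f i om) = fun=> 0.
    by apply/funext => om; rewrite big_nil.
  by move=> k; exact: measurable_cst.
have [Pi|Pi] := boolP (P i).
  have -> : (fun om => \sum_(j <- i :: r | P j) f j om) =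
      fun om => f i om + \sum_(j <- r | P j) f j om.
    by apply/funext => om; rewrite big_cons Pi.
  by apply: measurable_vectorD => //; exact: H.
have -> // : (fun om => \sum_(j <- i :: r | P j) f j om) =
    fun om => \sum_(j <- r | P j) f j om.
by apply/funext => om; rewrite big_cons (negPf Pi).
Qed.

Lemma measurable_quad n (M : 'M[R]_n) (f : Omega -> 'cV[R]_n) :
  measurable_vector f -> measurable_fun setT (fun om => quad M (f om)).
Proof.
move=> mf; under eq_fun do rewrite quad_bform bformE.
apply: measurable_sum => i; apply: measurable_sum => j.
apply: measurable_funM; last exact: mf.
by apply: measurable_funM => //; exact: mf.
Qed.

Variables (n : nat) (s : R).
Hypothesis s_gt0 : 0 < s.
Variable w : nat -> Omega -> 'cV[R]_n.
Hypothesis w_iid : iid_gaussian_noise Pr s w.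
Notation c := (noise_var s).

Lemma expectation_noiseM t k u l :
  has_expectation (fun om => w t om k ord0 * w u om l ord0)
                  (if (t, k) == (u, l) then c else 0).
Proof.
split; first exact: (integrable_noiseM s_gt0 w_iid).
case: eqP => [[-> ->]|/eqP neq]; last exact: (noise_orthogonal s_gt0 w_iid).
by rewrite -(noise_sqr s_gt0 w_iid u l).
Qed.

(** Expanding the quadratic form, orthogonality keeps the diagonal terms only; these
    form the traces. *)
Lemma expectation_moving_average l (M : 'M[R]_l) (H : nat -> 'M[R]_(l, n)) t :
  has_expectation (fun om => quad M (\sum_(k < t) H k *m w (t - k.+1) om))
                  (\sum_(k < t) c * \tr ((H k)^T *m M *m H k)).
Proof.
pose C (k k' : nat) := (H k)^T *m M *m H k'.
have qE om : quad M (\sum_(k < t) H k *m w (t - k.+1) om) =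
    \sum_(k < t) \sum_(k' < t) \sum_i \sum_j
      C k k' i j * (w (t - k.+1) om i ord0 * w (t - k'.+1) om j ord0).
  rewrite quad_bform (big_morph (bform M ^~ _) (fun x y => bformDl M x y _) (_ : bform M 0 _ = 0)).
    apply: eq_bigr => k _.
    rewrite (big_morph (bform M _) (fun x y => bformDr M x y _) (_ : bform M _ 0 = 0)).
      apply: eq_bigr => k' _.
      have -> : bform M (H k *m w (t - k.+1) om) (H k' *m w (t - k'.+1) om) =
          bform (C k k') (w (t - k.+1) om) (w (t - k'.+1) om).
        by rewrite /bform trmx_mul !mulmxA.
      rewrite bformE; apply: eq_bigr => i _; apply: eq_bigr => j _.
      by rewrite mulrAC mulrC.
    by rewrite /bform mulmx0 mxE.
  by rewrite /bform trmx0 !mul0mx mxE.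
have -> : (fun om => quad M (\sum_(k < t) H k *m w (t - k.+1) om)) = fun om =>
    \sum_(k < t) \sum_(k' < t) \sum_i \sum_j
      C k k' i j * (w (t - k.+1) om i ord0 * w (t - k'.+1) om j ord0).
  by apply/funext.
have -> : \sum_(k < t) c * \tr ((H k)^T *m M *m H k) =
    \sum_(k < t) \sum_(k' < t) \sum_i \sum_j
      C k k' i j * (if ((t - k.+1)%N, i) == ((t - k'.+1)%N, j) then c else 0).
  apply: eq_bigr => k _; rewrite (bigD1 k) //= [X in _ = _ + X]big1 => [|k' kk'].
    rewrite addr0 /mxtrace mulr_sumr; apply: eq_bigr => i _.
    rewrite (bigD1 i) //= eqxx [X in _ = _ + X]big1 ?addr0 1?mulrC // => j ji.
    by rewrite xpair_eqE eq_sym in ji *; rewrite eqxx (negPf ji) mulr0.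
  apply: big1 => i _; apply: big1 => j _.
  rewrite xpair_eqE; case: eqP => [E|]; last by rewrite mulr0.
  case/negP: kk'; apply/eqP/val_inj => /=.
  by have := ltn_ord k; have := ltn_ord k'; move: E => /=; lia.
apply: has_expectation_sum => k _; apply: has_expectation_sum => k' _.
apply: has_expectation_sum => i _; apply: has_expectation_sum => j _.
by apply: has_expectationZ; exact: expectation_noiseM.
Qed.

Lemma expectation_noise_energy t :
  has_expectation (fun om => quad 1%:M (w t om)) (n%:R * c).
Proof.
have -> : (fun om => quad 1%:M (w t om)) = fun om => \sum_(k < n) w t om k ord0 * w t om k ord0.
  by apply/funext => om; rewrite quad1E; apply: eq_bigr => k _; rewrite expr2.
have -> : n%:R * c = \sum_(k < n) c by rewrite sumr_const card_ord mulr_natl.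
apply: has_expectation_sum => k _.
by have := expectation_noiseM t k t k; rewrite eqxx.
Qed.

End FiniteExpectation.

(** * Average costs *)

Section AverageCost.
Context d (Omega : measurableType d) (R : realType) (Pr : probability Omega R).
Variables (n m : nat) (s : R).
Hypothesis s_gt0 : 0 < s.
Variable w : nat -> Omega -> 'cV[R]_n.
Hypothesis w_iid : iid_gaussian_noise Pr s w.
Variables (Q : 'M[R]_n) (Rc : 'M[R]_m).
Hypotheses (Q_psd : psd Q) (R_psd : psd Rc).
Notation c := (noise_var s).

Lemma has_expectation_average (f : nat -> Omega -> R) (e : nat -> R) T :
  (forall t, has_expectation Pr (f t) (e t)) ->
  has_expectation Pr (fun om => T%:R^-1 * \sum_(0 <= t < T) f t om)
    (T%:R^-1 * \sum_(0 <= t < T) e t).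
Proof. by move=> H; apply: has_expectationZ; apply: has_expectation_sum. Qed.

Lemma limn_esup_le (u v : nat -> \bar R) (l : \bar R) :
  (forall k, (u k <= v k)%E) -> v @ \oo --> l -> (limn_esup u <= l)%E.
Proof.
move=> uv vl; have <- : limn_esup v = l.
  by rewrite is_cvg_limn_esupE; [exact/cvg_lim|apply/cvg_ex; exists l].
rewrite !limn_esup_lim; apply: lee_lim; [exact: is_cvg_esups|exact: is_cvg_esups|].
apply: nearW => k; apply: ge_ereal_sup => _ [i /= ki <-].
by apply: le_trans (uv i) _; apply: ereal_sup_ubound; exists i.
Qed.

Lemma cesaro_mean (a : nat -> R) (l : R) : a @ \oo --> l ->
  (fun T => T%:R^-1 * \sum_(0 <= t < T) a t) @ \oo --> l.
Proof. by move=> al; rewrite -cvg_shiftS; exact: cesaro al. Qed.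

Section MovingAverage.
Variables (G : nat -> 'M[R]_n) (H : nat -> 'M[R]_(m, n)) (C : R).

Definition moving_average l (F : nat -> 'M[R]_(l, n)) (v : nat -> 'cV[R]_n) t :=
  \sum_(k < t) F k *m v (t - k.+1)%N.

Hypothesis energy : forall v T,
  \sum_(t < T) (quad Q (moving_average G v t) + quad Rc (moving_average H v t)) <=
  C * \sum_(t < T) quad 1%:M (v t).

Definition lag_cost k : R :=
  c * (\tr ((G k)^T *m Q *m G k) + \tr ((H k)^T *m Rc *m H k)).

Lemma trace_quad l (M : 'M[R]_l) (F : 'M[R]_(l, n)) :
  \tr (F^T *m M *m F) = \sum_i quad M (F *m (delta_mx i ord0 : 'cV[R]_n)).
Proof.
apply: eq_bigr => i _; rewrite -quad_congr /quad trmx_delta -rowE -colE.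
by rewrite !mxE.
Qed.

Lemma lag_cost_ge0 k : 0 <= lag_cost k.
Proof.
rewrite mulr_ge0 ?noise_var_ge0 // !trace_quad addr_ge0 // sumr_ge0 // => i _.
  exact: Q_psd.2.
exact: R_psd.2.
Qed.

(** Feeding unit impulses into the energy bound sums the costs of the lags. *)
Lemma sum_lag_cost T : \sum_(k < T) lag_cost k <= c * (n%:R * C).
Proof.
rewrite -mulr_sumr ler_wpM2l ?noise_var_ge0 //.
under eq_bigr do rewrite !trace_quad -big_split.
rewrite exchange_big /=.
have -> : n%:R * C = \sum_(i < n) C by rewrite sumr_const card_ord mulr_natl.
apply: ler_sum => i _.
pose e : 'cV[R]_n := delta_mx i ord0.
pose v t : 'cV[R]_n := if t == 0%N then e else 0.
have e1 : quad 1%:M e = 1.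
  rewrite quad1E (bigD1 i) //= big1 => [|j /negPf ji]; first by rewrite mxE !eqxx expr1n addr0.
  by rewrite mxE ji expr0n.
have vE l (F : nat -> 'M[R]_(l, n)) t : moving_average F v t.+1 = F t *m e.
  rewrite /moving_average big_ord_recr /= subnn /v eqxx big1 ?add0r // => k _.
  by rewrite subSS gtn_eqF ?mulmx0 // subn_gt0.
have := energy v T.+1.
have -> : \sum_(t < T.+1) quad 1%:M (v t) = 1.
  by rewrite big_ord_recl /v /= e1 big1 ?addr0 // => t _; rewrite quad0.
rewrite mulr1; apply: le_trans; rewrite big_ord_recl /=.
rewrite (eq_bigr (fun k : 'I_T => quad Q (moving_average G v k.+1) +
   quad Rc (moving_average H v k.+1))) => [|k _]; last by rewrite !vE.
by rewrite lerDr addr_ge0 ?Q_psd.2 ?R_psd.2.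
Qed.

Variables (x : nat -> Omega -> 'cV[R]_n) (u : nat -> Omega -> 'cV[R]_m).
Hypothesis xE : forall t om, x t om = moving_average G (w ^~ om) t.
Hypothesis uE : forall t om, u t om = moving_average H (w ^~ om) t.

Lemma expectation_cost t :
  has_expectation Pr (fun om => quad Q (x t om) + quad Rc (u t om)) (\sum_(k < t) lag_cost k).
Proof.
have -> : (fun om => quad Q (x t om) + quad Rc (u t om)) = fun om =>
    quad Q (\sum_(k < t) G k *m w (t - k.+1) om) + quad Rc (\sum_(k < t) H k *m w (t - k.+1) om).
  by apply/funext => om; rewrite xE uE.
under eq_bigr do rewrite /lag_cost mulrDr.
by rewrite big_split; apply: has_expectationD; exact: expectation_moving_average.
Qed.

Lemma average_costE T : average_cost Pr Q Rc x u T =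
  (T%:R^-1 * \sum_(0 <= t < T) \sum_(k < t) lag_cost k)%:E.
Proof.
exact: has_expectationE (has_expectation_average _ expectation_cost).
Qed.

(** The expected cost at time t is nondecreasing in t and bounded, hence convergent,
    and so are its averages. *)
Lemma average_cost_cvg : exists J : R, average_cost Pr Q Rc x u @ \oo --> J%:E.
Proof.
pose a t := \sum_(k < t) lag_cost k.
have nd : nondecreasing_seq a.
  by apply/nondecreasing_seqP => t; rewrite /a big_ord_recr /= lerDl lag_cost_ge0.
have ub : has_ubound (range a) by exists (c * (n%:R * C)) => _ [t _ <-]; exact: sum_lag_cost.
have [J aJ] : exists J : R, a @ \oo --> J.
  by exists (limn a); exact: (nondecreasing_is_cvgn nd ub).
exists J; have -> : average_cost Pr Q Rc x u =
    fun T => (T%:R^-1 * \sum_(0 <= t < T) a t)%:E.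
  by apply/funext => T; rewrite average_costE.
by apply: cvg_EFin; [exact: nearW|exact: cesaro_mean].
Qed.

Variables (y : nat -> Omega -> 'cV[R]_n) (z : nat -> Omega -> 'cV[R]_m) (D : R).
Hypothesis my : forall t, measurable_vector (y t).
Hypothesis mz : forall t, measurable_vector (z t).
Hypothesis D_ge0 : 0 <= D.
Hypothesis pathwise : forall om T,
  \sum_(t < T) (quad Q (y t om) + quad Rc (z t om)) <=
  \sum_(t < T) (quad Q (x t om) + quad Rc (u t om)) + D * \sum_(t < T) quad 1%:M (w t om).

(** Taking expectations in the pathwise bound: the noise has mean energy at most
    n s^2 per step. *)
Lemma average_cost_le T :
  (average_cost Pr Q Rc y z T <= average_cost Pr Q Rc x u T + (D * (n%:R * s ^+ 2))%:E)%E.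
Proof.
pose f t om := quad Q (x t om) + quad Rc (u t om) + D * quad 1%:M (w t om).
have fE : has_expectation Pr (fun om => T%:R^-1 * \sum_(0 <= t < T) f t om)
    (T%:R^-1 * \sum_(0 <= t < T) (\sum_(k < t) lag_cost k + D * (n%:R * c))).
  apply: has_expectation_average => t; apply: has_expectationD; first exact: expectation_cost.
  by apply: has_expectationZ; exact: expectation_noise_energy.
have cost_ge0 t om : 0 <= quad Q (y t om) + quad Rc (z t om).
  by rewrite addr_ge0 ?Q_psd.2 ?R_psd.2.
have T0 : 0 <= T%:R^-1 :> R by rewrite invr_ge0.
have le_f om : T%:R^-1 * \sum_(0 <= t < T) (quad Q (y t om) + quad Rc (z t om)) <=
    T%:R^-1 * \sum_(0 <= t < T) f t om.
  rewrite ler_wpM2l // !big_mkord; apply: le_trans (pathwise om T) _.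
  by rewrite /f [leRHS]big_split /= -mulr_sumr.
apply: (@le_trans _ _ ('E_Pr[fun om => (T%:R^-1 * \sum_(0 <= t < T) f t om)%R])%E).
  apply: expectation_le => //.
  - apply: measurable_funM => //; apply: measurable_sum => t.
    by apply: measurable_funD; exact: measurable_quad.
  - have [fi _] := fE; apply/measurable_EFinP; exact: measurable_int fi.
  - by move=> om; rewrite mulr_ge0 // sumr_ge0.
  - by move=> om; apply: le_trans (le_f om); rewrite mulr_ge0 // sumr_ge0.
  - exact: aeW.
rewrite (has_expectationE fE) average_costE -EFinD lee_fin big_split /= mulrDr lerD2l.
have -> : \sum_(0 <= t < T) D * (n%:R * c) = T%:R * (D * (n%:R * c)).
  by rewrite big_mkord sumr_const card_ord [RHS]mulr_natl.
rewrite [leLHS]mulrA.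
have [->|T_neq0] := eqVneq (T%:R : R) 0.
  by rewrite mulr0 mul0r mulr_ge0 // mulr_ge0 ?sqr_ge0.
by rewrite mulVf // mul1r !ler_wpM2l // noise_var_le.
Qed.

Lemma limsup_average_cost_le : exists J : R,
  average_cost Pr Q Rc x u @ \oo --> J%:E /\
  (limn_esup (average_cost Pr Q Rc y z) - J%:E <= (D * (n%:R * s ^+ 2))%:E)%E.
Proof.
have [J xJ] := average_cost_cvg; exists J; split=> //.
rewrite leeBlDr //; apply: limn_esup_le average_cost_le _.
rewrite [X in _ --> X]addeC; apply: cvgeD => //; exact: cvg_cst.
Qed.

End MovingAverage.
End AverageCost.

(** * Constants *)

Section Constants.
Variable R : realType.
Implicit Types kappa gam p q g : R.

(** The two smallness conditions that the choice of eps provides: the second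
    conclusion is what the small-gain argument uses, the third is the margin in the
    comparison of value functions. *)
Lemma eps_bound (N D kappa p q g a b : R) k :
  0 < N -> 0 < D <= 1 -> 1 <= kappa -> 1 <= p -> 1 <= q -> 1 <= g -> 1 <= a -> 1 <= b ->
  let eps := D ^+ 3 / (N * kappa ^+ 4 * p * q) * (g + 1) ^- 2 * g ^- 9 * a ^- 2 * b ^- k in
  [/\ 0 <= eps, kappa / D * eps * p * g ^+ 6 <= N^-1 & eps * g ^+ 3 <= N^-1].
Proof.
move=> N0 /andP[D0 D1] k1 p1 q1 g1 a1 b1 eps.
have [kp pp qp gp] : [/\ 0 < kappa, 0 < p, 0 < q & 0 < g].
  by split; apply: lt_le_trans ltr01 _.
have inv1 (x : R) j : 1 <= x -> 0 <= x ^- j <= 1.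
  move=> x1; have x0 := lt_le_trans ltr01 x1.
  rewrite invr_ge0 exprn_ge0 ?(ltW x0) //=.
  by rewrite invf_le1 ?exprn_gt0 // exprn_ege1.
have nn := (mulr_ge0, exprn_ge0, invr_ge0).
set e1 := D ^+ 3 / (N * kappa ^+ 4 * p * q) * g ^- 9.
have e10 : 0 <= e1.
  by rewrite /e1 !nn // ltW.
have [g20 g21] : 0 <= (g + 1) ^- 2 /\ (g + 1) ^- 2 <= 1.
  have g11 : 1 <= g + 1 by rewrite lerDr ltW.
  by have /andP[] := inv1 _ 2%N g11.
have [/andP[a20 a21] /andP[b20 b21]] := (inv1 _ 2%N a1, inv1 _ k b1).
have epsE : eps = e1 * ((g + 1) ^- 2 * (a ^- 2 * b ^- k)) by rewrite /eps /e1; ring.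
have eps0 : 0 <= eps by rewrite epsE mulr_ge0 // mulr_ge0 // mulr_ge0.
have eps1 : eps <= e1.
  rewrite epsE ler_piMr // mulr_ile1 ?mulr_ge0 //.
  by rewrite mulr_ile1.
have D3 : D ^+ 2 <= 1 by rewrite exprn_ile1 // ltW.
split=> //.
  apply: le_trans (_ : kappa / D * e1 * p * g ^+ 6 <= _).
    rewrite ler_wpM2r ?exprn_ge0 ?(ltW gp) // ler_wpM2r ?(ltW pp) // ler_wpM2l //.
    by rewrite mulr_ge0 ?invr_ge0 // ltW.
  have -> : kappa / D * e1 * p * g ^+ 6 = N^-1 * (D ^+ 2 / (kappa ^+ 3 * (q * g ^+ 3))).
    by rewrite /e1; field; rewrite !gt_eqF.
  rewrite ler_piMr ?invr_ge0 ?(ltW N0) // ler_pdivrMr ?mul1r.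
    by rewrite (le_trans D3) // mulr_ege1 ?exprn_ege1 // mulr_ege1 ?exprn_ege1.
  by rewrite !mulr_gt0 ?exprn_gt0.
apply: le_trans (_ : e1 * g ^+ 3 <= _); first by rewrite ler_wpM2r ?exprn_ge0 ?(ltW gp).
have -> : e1 * g ^+ 3 = N^-1 * (D ^+ 3 / (kappa ^+ 4 * (p * (q * g ^+ 6)))).
  by rewrite /e1; field; rewrite !gt_eqF.
rewrite ler_piMr ?invr_ge0 ?(ltW N0) // ler_pdivrMr ?mul1r.
  have D31 : D ^+ 3 <= 1 by rewrite exprn_ile1 // ltW.
  apply: le_trans D31 _; rewrite mulr_ege1 ?exprn_ege1 //.
  by rewrite mulr_ege1 // mulr_ege1 ?exprn_ege1.
by rewrite !mulr_gt0 ?exprn_gt0.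
Qed.

(** Both sides are s n eps times powers of numbers that are at least 1, among them
    1 / D and 1 / E, and the exponents on the right are larger. *)
Lemma final_constant (D E kappa p q g S s n eps : R) k :
  0 < D <= 1 -> 0 < E <= 1 -> 1 <= kappa -> 1 <= p -> 1 <= q -> 1 <= g -> 1 <= S ->
  0 <= s -> 0 <= n -> 0 <= eps ->
  396 * (kappa / D * p ^+ 2 * g ^+ 5 * eps) * (n * s) <=
  696 * (kappa ^+ 6 * s * n * p ^+ 4 * q ^+ 3 / (D ^+ 4 * E))
    * g ^+ (4 * k + 2) * (g + 1) ^+ (2 * k + 3) * S * eps.
Proof.
move=> /andP[D0 D1] /andP[E0 E1] k1 p1 q1 g1 S1 s0 n0 e0.
have [kp pp qp gp] : [/\ 0 < kappa, 0 < p, 0 < q & 0 < g].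
  by split; apply: lt_le_trans ltr01 _.
have nn := (mulr_ge0, exprn_ge0, invr_ge0).
set Y := n * s * eps; have Y0 : 0 <= Y by rewrite /Y !nn.
set K1 := kappa / D * p ^+ 2 * g ^+ 5.
set K2 := kappa ^+ 6 * p ^+ 4 * q ^+ 3 / (D ^+ 4 * E) * (g ^+ (4 * k + 2) * (g + 1) ^+ (2 * k + 3)) * S.
have K10 : 0 <= K1 by rewrite /K1 !nn // ltW.
have kp_le : kappa * p ^+ 2 <= kappa ^+ 6 * p ^+ 4 * q ^+ 3.
  rewrite -[leLHS]mulr1; apply: ler_pM; rewrite ?exprn_ege1 //.
    by rewrite mulr_ge0 ?exprn_ge0 ?(ltW kp) ?(ltW pp).
  apply: ler_pM; rewrite ?exprn_ge0 ?(ltW kp) ?(ltW pp) //.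
    by rewrite -[leLHS]expr1 ler_weXn2l.
  by rewrite ler_weXn2l.
have D_le : D^-1 <= (D ^+ 4 * E)^-1.
  rewrite lef_pV2 ?posrE ?mulr_gt0 ?exprn_gt0 //.
  rewrite -[leRHS]mulr1; apply: ler_pM; rewrite ?exprn_ge0 ?(ltW D0) ?(ltW E0) //.
  by rewrite exprS ler_piMr ?(ltW D0) // exprn_ile1 ?(ltW D0).
have g_le : g ^+ 5 <= g ^+ (4 * k + 2) * (g + 1) ^+ (2 * k + 3).
  rewrite (_ : 5 = 2 + 3)%N // exprD; apply: ler_pM; rewrite ?exprn_ge0 ?(ltW gp) //.
    by rewrite ler_weXn2l // leq_addl.
  apply: le_trans (_ : (g + 1) ^+ 3 <= _).
    by rewrite ler_pXn2r ?nnegrE ?addr_ge0 ?(ltW gp) // lerDl.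
  by rewrite ler_weXn2l ?leq_addl // lerDr ltW.
have K12 : K1 <= K2.
  have -> : K1 = kappa * p ^+ 2 * D^-1 * g ^+ 5 by rewrite /K1; ring.
  rewrite -[leLHS]mulr1; apply: ler_pM => //.
    by rewrite !nn // ltW.
  apply: ler_pM => //; [by rewrite !nn // ltW|by rewrite exprn_ge0 // ltW|].
  by apply: ler_pM => //; rewrite ?nn // ltW.
have -> : 396 * (kappa / D * p ^+ 2 * g ^+ 5 * eps) * (n * s) = 396 * (K1 * Y).
  by rewrite /K1 /Y; ring.
have -> : 696 * (kappa ^+ 6 * s * n * p ^+ 4 * q ^+ 3 / (D ^+ 4 * E))
    * g ^+ (4 * k + 2) * (g + 1) ^+ (2 * k + 3) * S * eps = 696 * (K2 * Y).
  rewrite /K2 /Y; move: (g ^+ _) ((g + 1) ^+ _) => X1 X2; ring.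
have := ler_wpM2r Y0 K12; have := mulr_ge0 K10 Y0; lra.
Qed.

(** With g = c + 1 the step error is at most 3 g^2 eps, and al is twice that; al is
    small enough that (1 + al) P stays below g. *)
Lemma margin_bound (c eps : R) : 0 <= c -> 0 <= eps -> eps * (c + 1) ^+ 3 <= 768^-1 ->
  let al := 6 * ((c + 1) ^+ 2 * eps) in
  [/\ 0 <= al, (1 + al) * step_error c eps <= al & (1 + al) * c <= c + 1].
Proof.
move=> c0 e0 small al; set g := c + 1 in small al *.
have g1 : 1 <= g by rewrite /g lerDr.
have g0 : 0 <= g := le_trans ler01 g1.
set y := g ^+ 2 * eps.
have y0 : 0 <= y by rewrite mulr_ge0 ?exprn_ge0.
have yg : y * g <= 768^-1 by rewrite (_ : y * g = eps * g ^+ 3) // /y; ring.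
have y_yg : y <= y * g by rewrite ler_peMr.
have ge_y : g * eps <= y by rewrite /y expr2 -mulrA ler_peMl // mulr_ge0.
have cg : c <= g by rewrite /g lerDl.
have c1 : c * (g * eps) <= y.
  by rewrite /y expr2 -mulrA ler_wpM2r ?mulr_ge0.
have ge1 : g * eps <= 1 by lra.
have c2 : c * (g * eps) ^+ 2 <= y.
  rewrite expr2 mulrA; apply: le_trans (_ : y * 1 <= _); last by rewrite mulr1.
  by apply: ler_pM; rewrite ?mulr_ge0.
have se : step_error c eps <= 3 * y by rewrite /step_error -/g; lra.
split.
- by rewrite /al mulr_ge0.
- apply: le_trans (_ : (1 + al) * (3 * y) <= _).
    by rewrite ler_wpM2l // addr_ge0 // mulr_ge0.
  rewrite /al -/y; have : y * y <= 768^-1 * y by rewrite ler_wpM2r //; lra.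
  lra.
have yc : y * c <= y * g by rewrite ler_wpM2l.
by rewrite /al -/y /g; lra.
Qed.

End Constants.

Section LagMatrices.
Variables (R : realType) (p : nat) (n_ m_ : 'I_p -> nat).
Variables (arc : rel 'I_p) (delay : 'I_p -> 'I_p -> nat).
Notation n := (\sum_(i < p) n_ i)%N.
Notation m := (\sum_(i < p) m_ i)%N.
Variable (Kh : forall s : {set 'I_p}, 'M[R]_(#|coords m_ s|, #|coords n_ s|)).
Variables (A : 'M[R]_n) (B : 'M[R]_(n, m)).

Definition state_lag k : 'M[R]_n := \sum_j chain arc delay Kh A B j k.

Definition input_lag k : 'M[R]_(m, n) :=
  \sum_j feedback Kh (reach arc delay j k) *m chain arc delay Kh A B j k.

Lemma total_state_lag v t :
  total_state arc delay Kh A B v t = moving_average state_lag v t.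
Proof.
rewrite /total_state exchange_big; apply: eq_bigr => k _.
by rewrite /state_lag mulmx_suml.
Qed.

Lemma total_input_lag v t :
  total_input arc delay Kh A B v t = moving_average input_lag v t.
Proof.
rewrite /total_input exchange_big; apply: eq_bigr => k _.
by rewrite /input_lag mulmx_suml; apply: eq_bigr => j _; rewrite -mulmxA.
Qed.

End LagMatrices.

(** * Measurability of the learned policy *)

Lemma measurable_subv d (Omega : measurableType d) (R : realType) p (e : 'I_p -> nat)
    (s : {set 'I_p}) (f : Omega -> 'cV[R]_(\sum_(i < p) e i)) :
  measurable_vector f -> measurable_vector (fun om => subv s (f om)).
Proof.
move=> mf k; have -> : (fun om => subv s (f om) k ord0) = fun om => f om (enum_val k) ord0.
  by apply/funext => om; rewrite mxE.
exact: mf.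
Qed.

Section Measurability.
Context d (Omega : measurableType d).
Variables (R : realType) (p : nat) (n_ m_ : 'I_p -> nat).
Variables (arc : rel 'I_p) (delay : 'I_p -> 'I_p -> nat).
Hypothesis G : delay_graph arc delay.
Notation n := (\sum_(i < p) n_ i)%N.
Notation m := (\sum_(i < p) m_ i)%N.
Variables (A : 'M[R]_n) (B : 'M[R]_(n, m)) (Ah : 'M[R]_n) (Bh : 'M[R]_(n, m)).
Variable (Kh : forall s : {set 'I_p}, 'M[R]_(#|coords m_ s|, #|coords n_ s|)).
Variable (nbr : 'I_p -> {set 'I_p}).
Variables (w xh : nat -> Omega -> 'cV[R]_n) (uh : nat -> Omega -> 'cV[R]_m).
Variable zh : nat -> forall s : {set 'I_p}, Omega -> 'cV[R]_#|coords n_ s|.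
Hypothesis w_meas : forall t, measurable_vector (w t).
Hypothesis run : forall om, hat_policy arc delay nbr A B Ah Bh Kh
  (fun t => w t om) (fun t => xh t om) (fun t => uh t om) (fun t s => zh t s om).

Let wh t om := estimated_noise Ah Bh nbr (fun t => xh t om) (fun t => uh t om) t.

Lemma measurable_hat_input t : (forall s, (s < t)%N -> measurable_vector (wh s)) ->
  measurable_vector (uh t).
Proof.
move=> mw.
have -> : uh t = fun om => \sum_j \sum_(k < t) feedback Kh (reach arc delay j k) *m
    (chain arc delay Kh Ah Bh j k *m wh (t - k.+1)%N om).
  by apply/funext => om; rewrite (hat_input G (run om)).
apply: measurable_vector_sum => j _; apply: measurable_vector_sum => k _.
apply: measurable_vectorM; apply: measurable_vectorM; apply: mw.
by have kt : (k < t)%N := ltn_ord k; lia.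
Qed.

Lemma measurable_hat t : measurable_vector (xh t) /\ measurable_vector (uh t).
Proof.
suff H : measurable_vector (xh t) /\ forall s, (s < t)%N -> measurable_vector (wh s).
  by have [mx mw] := H; split=> //; exact: measurable_hat_input.
elim: t => [|t [mx mw]].
  split=> //; have -> : xh 0%N = fun=> 0.
    by apply/funext => om; have [[-> _] _ _ _] := run om.
  by move=> k; exact: measurable_cst.
have mu := measurable_hat_input mw.
have mxS : measurable_vector (xh t.+1).
  have -> : xh t.+1 = fun om => A *m xh t om + B *m uh t om + w t om.
    by apply/funext => om; have [[_ ->] _ _ _] := run om.
  by apply: measurable_vectorD => //; apply: measurable_vectorD; apply: measurable_vectorM.
split=> // s; rewrite ltnS leq_eqVlt => /orP[/eqP ->|]; last exact: mw.
apply: measurable_vector_sum => j _; apply: measurable_vectorM.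
apply: measurable_vectorD; first exact: measurable_subv.
apply: measurable_vectorN; apply: measurable_vector_sum => l _.
apply: measurable_vectorD; apply: measurable_vectorM.
  exact: measurable_subv.
exact: measurable_subv.
Qed.

End Measurability.

Theorem proposition4 (R : realType)
  (* network *)
  (p : nat) (p_ge1 : (1 <= p)%N) (n_ m_ : 'I_p -> nat)
  (mn : forall i, (m_ i <= n_ i)%N)
  (nbr : 'I_p -> {set 'I_p})
  (A : 'M[R]_(\sum_(i < p) n_ i)%N)
  (B : 'M[R]_((\sum_(i < p) n_ i)%N, (\sum_(i < p) m_ i)%N))
  (A_nbr : forall i j, j \notin nbr i -> subm [set i] [set j] A = 0)
  (B_nbr : forall i j, j \notin nbr i -> subm [set i] [set j] B = 0)
  (* delays *)
  (arc : rel 'I_p) (delay : 'I_p -> 'I_p -> nat)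
  (G : delay_graph arc delay)
  (nbr_dist : forall i j, j \in nbr i -> dist_le arc delay i j 1)
  (* noise *)
  (d : measure_display) (Omega : measurableType d) (Pr : probability Omega R)
  (sigma_w : R) (sigma_w_gt0 : 0 < sigma_w)
  (w : nat -> Omega -> 'cV[R]_(\sum_(i < p) n_ i)%N)
  (w_iid : iid_gaussian_noise Pr sigma_w w)
  (* gains *)
  (Q : 'M[R]_(\sum_(i < p) n_ i)%N) (Rc : 'M[R]_(\sum_(i < p) m_ i)%N)
  (Q_psd : psd Q) (Rc_pd : pd Rc)
  (P : forall s : {set 'I_p}, 'M[R]_#|coords n_ s|)
  (K : forall s : {set 'I_p}, 'M[R]_(#|coords m_ s|, #|coords n_ s|))
  (PK : is_gains arc delay A B Q Rc P K)
  (* constants *)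
  (kappa_ gamma_ : {set 'I_p} -> R) (kappa0 gamma0 : R)
  (kappa_ge1 : forall s, info_root arc delay s -> 1 <= kappa_ s)
  (gamma_bounds : forall s, info_root arc delay s ->
     spectral_radius (subm s s A + subm s s B *m K s) < gamma_ s < 1)
  (closed_loop_decay : forall s, info_root arc delay s -> forall k : nat,
     specnorm ((subm s s A + subm s s B *m K s) ^+ k) <= kappa_ s * gamma_ s ^+ k)
  (* estimated gains *)
  (Ah : 'M[R]_(\sum_(i < p) n_ i)%N)
  (Bh : 'M[R]_((\sum_(i < p) n_ i)%N, (\sum_(i < p) m_ i)%N))
  (Ph : forall s : {set 'I_p}, 'M[R]_#|coords n_ s|)
  (Kh : forall s : {set 'I_p}, 'M[R]_(#|coords m_ s|, #|coords n_ s|))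
  (PKh : is_gains arc delay Ah Bh Q Rc Ph Kh)
  (* the two policies *)
  (xh xt : nat -> Omega -> 'cV[R]_(\sum_(i < p) n_ i)%N)
  (uh ut : nat -> Omega -> 'cV[R]_(\sum_(i < p) m_ i)%N)
  (zh zt : nat -> forall s : {set 'I_p}, Omega -> 'cV[R]_#|coords n_ s|)
  (hat_run : forall om, hat_policy arc delay nbr A B Ah Bh Kh
     (fun t => w t om) (fun t => xh t om) (fun t => uh t om)
     (fun t s => zh t s om))
  (tilde_run : forall om, tilde_policy arc delay A B Kh
     (fun t => w t om) (fun t => xt t om) (fun t => ut t om)
     (fun t s => zt t s om)) :
  let n := (\sum_(i < p) n_ i)%N in
  let m := (\sum_(i < p) m_ i)%N in
  let U := info_nodes arc delay in
  let q := #|U| in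
  let Dmax := dist_max arc delay in
  let gamma := Num.max (\big[Num.max/gamma0]_(s | info_root arc delay s) gamma_ s) gamma0 in
  let kappa := Num.max (\big[Num.max/kappa0]_(s | info_root arc delay s) kappa_ s) kappa0 in
  let Gamma := Num.max (Num.max (specnorm A) (specnorm B))
                 (Num.max (\big[Num.max/0]_(s in U) specnorm (P s))
                          (\big[Num.max/0]_(s in U) specnorm (K s))) in
  let Gammat := Gamma + 1 in
  let eps := (1 - gamma) ^+ 3 / (768 * kappa ^+ 4 * p%:R * q%:R)
             * (Gammat + 1) ^- 2 * Gammat ^- 9
             * (1 + singval 1 (invmx Rc)) ^- 2
             * (20 * (Gammat + 1) ^+ 2 * Gammat ^+ 7 * singval 1 Rc) ^- Dmax in
  (* (i) *)
  (forall s, info_root arc delay s ->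
     stabilizable (subm s s A) (subm s s B) /\
     exists (l : nat) (C : 'M[R]_(l, #|coords n_ s|)),
       subm s s Q = C^T *m C /\ detectable (subm s s A) C) ->
  (* (ii) *)
  stable A ->
  (forall k : nat, specnorm (A ^+ k) <= kappa0 * gamma0 ^+ k) ->
  1 <= kappa0 ->
  spectral_radius A < gamma0 < 1 ->
  (* (iii) *)
  1 <= singval m Rc ->
  1 <= singval n Q ->
  (* (iv) *)
  specnorm (Ah - A) <= eps ->
  specnorm (Bh - B) <= eps ->
  exists Jt : R,
    average_cost Pr Q Rc xt ut @ \oo --> Jt%:E /\
    (limn_esup (average_cost Pr Q Rc xh uh) - Jt%:E
     <= (696 * (kappa ^+ 6 * sigma_w ^+ 2 * n%:R * p%:R ^+ 4 * q%:R ^+ 3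
                / ((1 - gamma) ^+ 4 * (1 - gamma ^+ 2)))
         * Gammat ^+ (4 * Dmax + 2) * (Gammat + 1) ^+ (2 * Dmax + 3)
         * (singval 1 Q + singval 1 Rc) * eps)%:E)%E.
Proof.
move=> n m U q Dmax gamma kappa Gamma Gammat eps _ _ A_decay0 kappa0_ge1 /andP[_ gamma0_lt1].
move=> R_sv Q_sv Ah_close Bh_close.
have Rc_psd := pd_psd Rc_pd.
have Q_ge1 := singval_psd_ge1 Q_psd Q_sv.
have R_ge1 := singval_psd_ge1 Rc_psd R_sv.
have sQ_ge1 := singval1_ge1 Q_sv; have sR_ge1 := singval1_ge1 R_sv.
have kappa0_gt0 := lt_le_trans ltr01 kappa0_ge1.
have gamma0_ge0 : 0 <= gamma0.
  by have := le_trans (specnorm_ge0 _) (A_decay0 1%N); rewrite expr1 pmulr_rge0.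
have gamma0_le : gamma0 <= gamma by rewrite /gamma le_max lexx orbT.
have gamma_ge0 : 0 <= gamma := le_trans gamma0_ge0 gamma0_le.
have gamma_lt1 : gamma < 1.
  rewrite /gamma gt_max gamma0_lt1 andbT; elim/big_ind: _ => // [a b a1 b1|s ss].
    by rewrite gt_max a1 b1.
  by case/andP: (gamma_bounds s ss).
have kappa0_le : kappa0 <= kappa by rewrite /kappa le_max lexx orbT.
have kappa_ge1' : 1 <= kappa := le_trans kappa0_ge1 kappa0_le.
have A_decay k x : enorm (A ^+ k *m x) <= kappa * gamma ^+ k * enorm x.
  apply: le_trans (specnormP _ _) _; rewrite ler_wpM2r ?enorm_ge0 //.
  apply: le_trans (A_decay0 k) _; apply: ler_pM; rewrite ?exprn_ge0 ?(ltW kappa0_gt0) //.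
  by case: k => // k; rewrite ler_pXn2r.
have Gamma_ge0 : 0 <= Gamma by rewrite /Gamma !le_max specnorm_ge0.
have Gammat_ge1 : 1 <= Gammat by rewrite /Gammat lerDr.
have P_le s : s \in U -> forall x, quad (P s) x <= Gamma * quad 1%:M x.
  move=> sU x; apply: le_trans (quad_specnorm _ _) _; rewrite ler_wpM2r ?(psd1 R _).2 //.
  by rewrite /Gamma !le_max (le_bigmax_cond _ (fun s => specnorm (P s)) sU) orbT.
have K_le s : s \in U -> forall x, enorm (K s *m x) <= Gamma * enorm x.
  move=> sU x; apply: le_trans (specnormP _ _) _; rewrite ler_wpM2r ?enorm_ge0 //.
  by rewrite /Gamma !le_max (le_bigmax_cond _ (fun s => specnorm (K s)) sU) !orbT.
have Ah_le x : enorm ((Ah - A) *m x) <= eps * enorm x.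
  by apply: le_trans (specnormP _ _) _; rewrite ler_wpM2r ?enorm_ge0.
have Bh_le x : enorm ((Bh - B) *m x) <= eps * enorm x.
  by apply: le_trans (specnormP _ _) _; rewrite ler_wpM2r ?enorm_ge0.
have p1 : 1 <= p%:R :> R by rewrite ler1n.
have q1 : 1 <= q%:R :> R.
  rewrite ler1n card_gt0; apply/finset.set0Pn; exists (reach arc delay (Ordinal p_ge1) 0).
  exact: mem_info_nodes.
have D01 : 0 < 1 - gamma <= 1 by rewrite subr_gt0 gamma_lt1 gerBl.
have a1 : 1 <= 1 + singval 1 (invmx Rc) by rewrite lerDl singval_ge0.
have b1 : 1 <= 20 * (Gammat + 1) ^+ 2 * Gammat ^+ 7 * singval 1 Rc.
  rewrite mulr_ege1 // mulr_ege1 ?exprn_ege1 // mulr_ege1 ?ler1n // exprn_ege1 //.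
  by rewrite lerDr (le_trans ler01).
have N0 : 0 < 768 :> R by rewrite ltr0n.
have [eps_ge0 eps_gain eps_margin] := eps_bound Dmax N0 D01 kappa_ge1' p1 q1 Gammat_ge1 a1 b1.
rewrite -/eps in eps_ge0 eps_gain eps_margin.
clearbody eps kappa gamma.
have [al_ge0 al_step al_c] := margin_bound Gamma_ge0 eps_ge0 eps_margin.
have Ph_le j k z : msk R n_ (reach arc delay j k) *m z = z ->
    quad (value Ph (reach arc delay j k)) z <= Gammat * quad 1%:M z.
  move=> zs; have := comparison G Q_psd Rc_pd PK PKh Q_ge1 Gamma_ge0 eps_ge0 P_le K_le
    Ah_le Bh_le al_ge0 al_step zs.
  move=> /le_trans; apply.
  apply: le_trans (_ : (1 + 6 * ((Gamma + 1) ^+ 2 * eps)) * (Gamma * quad 1%:M z) <= _).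
    rewrite ler_wpM2l ?addr_ge0 //; apply: value_ub => // x.
    by apply: P_le; exact: mem_info_nodes.
  by rewrite [leLHS]mulrA ler_wpM2r ?(psd1 R _).2.
have eps_small : kappa / (1 - gamma) * eps * Num.sqrt p%:R ^+ 2 * Gammat ^+ 6 <= 768^-1.
  by rewrite sqr_sqrtr.
have gamma01 : 0 <= gamma < 1 by rewrite gamma_ge0.
pose gain := 396 * (kappa / (1 - gamma) * p%:R ^+ 2 * Gammat ^+ 5 * eps).
have pathwise om T := pathwise_cost G Q_psd Rc_pd Q_ge1 R_ge1 PKh Gammat_ge1 eps_ge0 Ah_le Bh_le
  Ph_le kappa_ge1' gamma01 A_decay nbr_dist A_nbr B_nbr (hat_run om) (tilde_run om) p_ge1
  eps_small T.
have energy v T :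
    \sum_(t < T) (quad Q (moving_average (state_lag arc delay Kh A B) v t) +
                  quad Rc (moving_average (input_lag arc delay Kh A B) v t)) <=
    (4 * Gammat * (Num.sqrt Gammat * Num.sqrt p%:R)) ^+ 2 * \sum_(t < T) quad 1%:M (v t).
  have := chains_energy G Q_psd Rc_pd Q_ge1 R_ge1 PKh Gammat_ge1 eps_ge0 Ah_le Bh_le
    Ph_le kappa_ge1' gamma01 v p_ge1 eps_small T.
  apply: le_trans; rewrite le_eqVlt; apply/orP; left; apply/eqP; apply: eq_bigr => t _.
  by rewrite total_state_lag total_input_lag.
have w_meas t : measurable_vector (w t) by move=> k; exact: (measurable_noise w_iid).
have hat_meas := measurable_hat G w_meas hat_run.
have gain_ge0 : 0 <= gain.
  have Gammat_ge0 := le_trans ler01 Gammat_ge1.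
  have X_ge0 : 0 <= kappa / (1 - gamma).
    by rewrite divr_ge0 ?(le_trans ler01 kappa_ge1') // subr_ge0 ltW.
  apply: mulr_ge0; first exact: ler0n.
  apply: mulr_ge0 eps_ge0; apply: mulr_ge0; last exact: exprn_ge0.
  by apply: mulr_ge0 X_ge0 _; exact: exprn_ge0.
have xtE t om : xt t om = moving_average (state_lag arc delay Kh A B) (w ^~ om) t.
  by rewrite (tilde_state G nbr_dist A_nbr B_nbr (tilde_run om)) total_state_lag.
have utE t om : ut t om = moving_average (input_lag arc delay Kh A B) (w ^~ om) t.
  by rewrite (tilde_input G (tilde_run om)) total_input_lag.
have [J [J_lim J_le]] := limsup_average_cost_le sigma_w_gt0 w_iid Q_psd Rc_psd energy xtE utE
  (fun t => (hat_meas t).1) (fun t => (hat_meas t).2) gain_ge0 pathwise.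
exists J; split=> //; apply: le_trans J_le _; rewrite lee_fin.
apply: (final_constant _ D01 _ kappa_ge1' p1 q1 Gammat_ge1 _ _ _ eps_ge0).
- have g2 : gamma ^+ 2 < 1 by rewrite expr_lt1.
  by rewrite subr_gt0 g2 gerBl exprn_ge0.
- by apply: le_trans sQ_ge1 _; rewrite lerDl; exact: le_trans ler01 sR_ge1.
- exact: sqr_ge0.
- exact: ler0n.
Qed.
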